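(* Let $\mathbb{G}$ be a stratified Lie group of homogeneous dimension $Q\geq 2$ and let $1<q<\infty$. Let $\Omega\subset\mathbb{G}$ be a bounded open domain with smooth boundary $\partial\Omega$, and fix $p$ such that $0<p<q-1$. Then there exist $\lambda^*=\lambda^*(\Omega)>0$ and $\alpha^*=\alpha^*(\Omega)>0$ (depending only on $p$, $Q$, $q$ and $\Omega$) such that, for every $0<\lambda<\lambda^*$ and every $0<\alpha<\alpha^*$, the subelliptic boundary-value problem $$ \begin{cases} -\mathcal{L}_q u=\lambda u^{p}+\exp\left(\alpha u^{\frac{Q}{Q-1}}\right) & \text{in } \Omega,\\ u>0 & \text{in } \Omega,\\ u=0 & \text{on } \partial\Omega, \end{cases} $$ admits at least one positive weak solution $u\in W_0^{1,q}(\Omega)$.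
   Context: A stratified Lie group (homogeneous Carnot group) is a Lie group $\mathbb{G}=(\mathbb{R}^n,\circ)$ such that: (a) $\mathbb{R}^n=\mathbb{R}^{N_1}\times\cdots\times\mathbb{R}^{N_r}$ with $N:=N_1$ and $n=N_1+\cdots+N_r$, and for every $\lambda>0$ the dilation $\delta_\lambda(x^{(1)},\ldots,x^{(r)})=(\lambda x^{(1)},\lambda^2x^{(2)},\ldots,\lambda^r x^{(r)})$, $x^{(k)}\in\mathbb{R}^{N_k}$, is an automorphism of $\mathbb{G}$; (b) if $X_1,\ldots,X_N$ are the left-invariant vector fields with $X_k(0)=\partial/\partial x_k|_0$, $k=1,\ldots,N$, then their iterated commutators span the Lie algebra of $\mathbb{G}$, i.e. $\operatorname{rank}(\mathrm{Lie}\{X_1,\ldots,X_N\})=n$. Its homogeneous dimension is $Q=\sum_{k=1}^r kN_k$. The Haar measure $dx$ is the Lebesgue measure on $\mathbb{R}^n$. The horizontal gradient is $\nabla_{\mathbb{G}}=(X_1,\ldots,X_N)$, the horizontal divergence is $\operatorname{div}_{\mathbb{G}}v=\sum_{j=1}^N X_jv_j$, and the horizontal $q$-Laplacian ($q$-sub-Laplacian) is $\mathcal{L}_q u=\operatorname{div}_{\mathbb{G}}\left(|\nabla_{\mathbb{G}}u|^{q-2}\nabla_{\mathbb{G}}u\right)$. $W_0^{1,q}(\Omega)$ denotes the completion of $C_0^1(\Omega)$ in the norm $u\mapsto\left(\int_\Omega|\nabla_{\mathbb{G}}u|^q\,dx\right)^{1/q}$. A positive weak solution of the problem is a function $u\in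 W_0^{1,q}(\Omega)$ with $u>0$ in $\Omega$ such that $$\int_\Omega|\nabla_{\mathbb{G}}u|^{q-2}\nabla_{\mathbb{G}}u\cdot\nabla_{\mathbb{G}}\psi\,dx=\lambda\int_\Omega u^p\psi\,dx+\int_\Omega\exp\left(\alpha u^{\frac{Q}{Q-1}}\right)\psi\,dx\qquad\text{for every }\psi\in W_0^{1,q}(\Omega).$$ *)

(* Defs.v *)
From HB Require Import structures.
From mathcomp Require Import all_boot all_order all_algebra.
From mathcomp Require Import all_classical all_reals all_analysis.

Set Implicit Arguments.
Unset Strict Implicit.
Unset Printing Implicit Defensive.

Import Order.TTheory GRing.Theory Num.Theory.
Import numFieldNormedType.Exports.

Local Open Scope classical_set_scope.
Local Open Scope ring_scope.

(* 'rV[R]_n carries the product sigma-algebra, i.e. the one generated by the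
   coordinates; it is the Borel sigma-algebra, R being second countable. *)
Definition measure_rV_display : measure_display.
Proof. exact: default_measure_display. Qed.

Section measurable_rV.
Context {R : realType} (n : nat).

Let coord (i : 'I_n) (x : 'rV[R]_n) : R := x ord0 i.

Let rV_set0 : g_sigma_preimage coord set0.
Proof. exact: sigma_algebra0. Qed.

Let rV_setC A : g_sigma_preimage coord A -> g_sigma_preimage coord (~` A).
Proof. exact: sigma_algebraC. Qed.

Let rV_bigcup (F : (set 'rV[R]_n)^nat) :
  (forall i, g_sigma_preimage coord (F i)) ->
  g_sigma_preimage coord (\bigcup_i F i).
Proof. exact: sigma_algebra_bigcup. Qed.

HB.instance Definition _ := @isMeasurable.Build measure_rV_display
  'rV[R]_n (g_sigma_preimage coord) rV_set0 rV_setC rV_bigcup.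

Lemma measurable_coord (i : 'I_n) :
  measurable_fun [set: 'rV[R]_n] (fun x : 'rV[R]_n => x ord0 i).
Proof.
move=> _ Y mY; rewrite setTI; apply: sub_sigma_algebra => /=.
rewrite -bigcup_seq/=; exists i => /=; first by rewrite mem_index_enum.
by exists Y => //; rewrite setTI.
Qed.

Lemma measurable_fun_rV d (T : measurableType d) (f : T -> 'rV[R]_n) :
  (forall i, measurable_fun [set: T] (fun t => f t ord0 i)) ->
  measurable_fun [set: T] f.
Proof.
move=> mf; pose G := \big[setU/set0]_(i < n)
  preimage_set_system setT (coord i) (@measurable _ R).
apply: (@measurability _ _ _ _ _ _ G) => // _ [A GA <-].
move: GA; rewrite /G -bigcup_seq/= => -[i _ [B mB <-]].
by have := mf i measurableT B mB; rewrite !setTI.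
Qed.

End measurable_rV.

Section lebesgue_rV.
Context {R : realType}.

Definition cons_rV n (z : R * 'rV[R]_n) : 'rV[R]_n.+1 :=
  row_mx (const_mx z.1 : 'rV_1) z.2.

Definition uncons_rV n (x : 'rV[R]_n.+1) : R * 'rV[R]_n :=
  (x ord0 ord0, rsubmx (x : 'rV_(1 + n))).

Lemma cons_rVK n : cancel (@cons_rV n) (@uncons_rV n).
Proof.
move=> [t y]; rewrite /uncons_rV /cons_rV row_mxKr; congr pair.
have := row_mxEl (const_mx t : 'rV[R]_1) y ord0 ord0.
by rewrite [const_mx _ _ _]mxE; apply: etrans; congr (fun_of_matrix _ _ _); exact/val_inj.
Qed.

Lemma uncons_rVK n : cancel (@uncons_rV n) (@cons_rV n).
Proof.
move=> x; rewrite /uncons_rV /cons_rV/=.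
apply: etrans (@hsubmxK _ 1 1 n x); congr (@row_mx R 1 1 n _ _).
apply/rowP => i; rewrite !mxE; congr (x _ _).
by apply/val_inj; rewrite (ord1 i).
Qed.

Lemma cons_rV0 n (z : R * 'rV[R]_n) : cons_rV z ord0 ord0 = z.1.
Proof. by have /(congr1 fst) := cons_rVK z. Qed.

Lemma cons_rVS n (z : R * 'rV[R]_n) i :
  cons_rV z ord0 (lift ord0 i) = z.2 ord0 i.
Proof.
have /(congr1 (fun w : R * 'rV[R]_n => w.2 ord0 i)) := cons_rVK z.
rewrite /= [rsubmx _ _ _]mxE => <-; congr (fun_of_matrix _ _ _).
exact/val_inj.
Qed.

Lemma measurable_cons_rV n : measurable_fun setT (@cons_rV n).
Proof.
apply: measurable_fun_rV => i.
rewrite (_ : (fun _ => _) = fun z : R * 'rV[R]_n =>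
    if @fintype.split 1 n i is inr k then z.2 ord0 k else z.1).
  case: (fintype.split _) => k; first exact: measurable_fst.
  exact: (measurableT_comp (measurable_coord k) measurable_snd).
by apply/funext => z; rewrite /cons_rV mxE; case: (fintype.split _) => // k; rewrite mxE.
Qed.

Lemma measurable_uncons_rV n : measurable_fun setT (@uncons_rV n).
Proof.
apply/measurable_fun_pair; first exact: measurable_coord.
apply: measurable_fun_rV => i; rewrite /uncons_rV/=.
under eq_fun do rewrite mxE.
exact: measurable_coord.
Qed.

(* Lebesgue measure on R^(n.+1) as the image of the product measure of
   R * R^n under [cons_rV]. *)
Section cons_measure.
Local Open Scope ereal_scope.
Variables (n : nat) (mu : {sigma_finite_measure set 'rV[R]_n -> \bar R}).

Definition cons_measure : set 'rV[R]_n.+1 -> \bar R :=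
  pushforward (@lebesgue_measure R \x mu) (@cons_rV n).

Let preim_measurable (A : set 'rV[R]_n.+1) : measurable A ->
  measurable (@cons_rV n @^-1` A : set (measurableTypeR R * 'rV[R]_n)).
Proof.
by move=> mA; have := @measurable_cons_rV n measurableT _ mA; rewrite setTI.
Qed.

Let cons_measure0 : cons_measure set0 = 0.
Proof. by rewrite /cons_measure /pushforward preimage_set0 measure0. Qed.

Let cons_measure_ge0 A : 0 <= cons_measure A.
Proof. by rewrite /cons_measure /pushforward; exact: measure_ge0. Qed.

Let cons_measure_sigma_additive : semi_sigma_additive cons_measure.
Proof.
move=> F mF tF mUF; rewrite /cons_measure /pushforward preimage_bigcup.
apply: measure_semi_sigma_additive.
- by move=> k; exact: preim_measurable.
- apply/trivIsetP => /= i j _ _ ij; rewrite -preimage_setI.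
  by move/trivIsetP : tF => /(_ _ _ _ _ ij) ->//; rewrite preimage_set0.
- by rewrite -preimage_bigcup; exact: preim_measurable.
Qed.

HB.instance Definition _ := isMeasure.Build _ _ _ cons_measure
  cons_measure0 cons_measure_ge0 cons_measure_sigma_additive.

Let cons_measure_sigma_finite : sigma_finite setT cons_measure.
Proof.
have /sigma_finiteP[F [TF ndF Foo]] := sigma_finiteT (@lebesgue_measure R).
have /sigma_finiteP[G [TG ndG Goo]] := sigma_finiteT mu.
exists (fun k => @uncons_rV n @^-1` (F k `*` G k)).
  rewrite -preimage_bigcup -[LHS](@preimage_setT _ _ (@uncons_rV n)).
  congr (_ @^-1` _); rewrite -setXTT TF TG predeqE => -[x y]; split.
    move=> [/= [k _ Fkx] [l _ Gly]]; exists (maxn k l) => //; split.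
    - by move: x Fkx; exact/subsetPset/ndF/leq_maxl.
    - by move: y Gly; exact/subsetPset/ndG/leq_maxr.
  by move=> [k _ []/= ? ?]; split; exists k.
move=> k; have [mF Fk] := Foo k; have [mG Gk] := Goo k.
have mFG : measurable (F k `*` G k) by exact: measurableX.
split.
  by have := @measurable_uncons_rV n measurableT _ mFG; rewrite setTI.
rewrite /cons_measure /pushforward -comp_preimage.
rewrite (_ : _ \o _ = id); last by apply/funext => z; exact: cons_rVK.
by rewrite preimage_id product_measure1E// lte_mul_pinfty// ge0_fin_numE.
Qed.

HB.instance Definition _ := @Measure_isSigmaFinite.Build _ _ _ cons_measure
  cons_measure_sigma_finite.

End cons_measure.

Fixpoint lebesgue_rV n : {sigma_finite_measure set 'rV[R]_n -> \bar R} :=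
  match n with
  | 0 => \d_(0 : 'rV[R]_0)
  | n'.+1 => cons_measure (lebesgue_rV n')
  end.

(* This characterizes [lebesgue_rV n] among measures on R^n. *)
Lemma lebesgue_rV_box n (I : 'I_n -> set R) : (forall i, measurable (I i)) ->
  lebesgue_rV n [set x | forall i, I i (x ord0 i)] =
  (\prod_(i < n) lebesgue_measure (I i))%E.
Proof.
elim: n I => [|n ih] I mI; first by rewrite big_ord0 /= diracE mem_set// => -[].
have mB : measurable [set y : 'rV[R]_n | forall i, I (lift ord0 i) (y ord0 i)].
  rewrite (_ : [set _ | _] = \bigcap_(i in [set: 'I_n])
      ((fun y : 'rV[R]_n => y ord0 i) @^-1` I (lift ord0 i))).
    apply: fin_bigcap_measurable; first exact: finite_finset.
    move=> i _; have := measurable_coord i measurableT (mI (lift ord0 i)).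
    by rewrite setTI.
  by apply/seteqP; split => [y yI i _|y yI i]; [exact: yI|exact: (yI i)].
rewrite big_ord_recl /= -(ih (fun i => I (lift ord0 i)))//.
rewrite -product_measure1E//=; last exact: mI.
rewrite /cons_measure /pushforward; congr product_measure1.
apply/seteqP; split => [z zI|z [z1 z2] i] /=.
  split=> [|i]; first by rewrite -cons_rV0; exact: zI.
  by rewrite -cons_rVS; exact: zI.
by case: (unliftP ord0 i) => [k ->|->]; rewrite ?cons_rV0 ?cons_rVS//; exact: z2.
Qed.

End lebesgue_rV.

Section smoothness.
Context {R : realType}.

(* C^k for maps between finite-dimensional spaces: f is differentiable and
   all its directional derivatives are C^(k-1). *)
Fixpoint Ck (V W : normedModType R) (k : nat) (f : V -> W) : Prop :=
  match k with
  | 0 => continuous f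
  | k'.+1 => (forall x, differentiable f x) /\
             (forall v, Ck k' (fun x => 'D_v f x))
  end.

Lemma derive_chain (U W Z : normedModType R) (f : U -> W) (g : W -> Z) x v :
  differentiable f x -> differentiable g (f x) ->
  'D_v (g \o f) x = 'D_('D_v f x) g (f x).
Proof.
move=> df dg; rewrite !deriveE//; last exact: differentiable_comp.
by rewrite diff_comp.
Qed.

Definition smooth (V W : normedModType R) (f : V -> W) : Prop :=
  forall k, Ck k f.

(* Defining-function form: around each boundary point, Omega is the sublevel set
   {rho < 0} of a smooth function with nonvanishing differential. Since this is
   only required near x, rho may be taken smooth on the whole space. *)
Definition smooth_boundary n (Omega : set 'rV[R]_n) : Prop :=
  forall x, (closure Omega `\` interior Omega) x ->
  exists rho : 'rV[R]_n -> R,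
    [/\ smooth rho, rho x = 0, exists v, 'D_v rho x != 0 &
        \forall y \near x, Omega y <-> rho y < 0].

Definition smooth_bounded_domain n (Omega : set 'rV[R]_n) : Prop :=
  [/\ Omega !=set0, open Omega, connected Omega, bounded_set Omega &
      smooth_boundary Omega].

(* Vector fields on R^n are identified with their coefficient maps: X acts on
   functions by f |-> 'D_(X x) f x. *)
Definition lie_bracket n (X Y : 'rV[R]_n -> 'rV[R]_n) : 'rV[R]_n -> 'rV[R]_n :=
  fun x => 'D_(X x) Y x - 'D_(Y x) X x.

Inductive lie_span n (S : set ('rV[R]_n -> 'rV[R]_n)) :
    ('rV[R]_n -> 'rV[R]_n) -> Prop :=
  | lie_span_gen X : S X -> lie_span S X
  | lie_span0 : lie_span S (fun=> 0)
  | lie_span_lin a X Y : lie_span S X -> lie_span S Y ->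
      lie_span S (fun x => a *: X x + Y x)
  | lie_span_bracket X Y : lie_span S X -> lie_span S Y ->
      lie_span S (lie_bracket X Y).

Definition left_invariant n (mul : 'rV[R]_n -> 'rV[R]_n -> 'rV[R]_n)
    (X : 'rV[R]_n -> 'rV[R]_n) : Prop :=
  forall a x, 'D_(X x) (mul a) x = X (mul a x).

(* The left-invariant vector field with value v at the identity 0; see
   [left_invariantP] below. *)
Definition left_field n (mul : 'rV[R]_n -> 'rV[R]_n -> 'rV[R]_n)
    (v : 'rV[R]_n) : 'rV[R]_n -> 'rV[R]_n :=
  fun x => 'D_v (mul x) 0.

(* The layers are numbered from 0, hence the exponents k.+1 here and in
   [hom_dim]. *)
Definition dilation r (N : 'I_r.+1 -> nat) (lam : R)
    (x : 'rV[R]_(\sum_(k < r.+1) N k)) : 'rV[R]_(\sum_(k < r.+1) N k) :=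
  \mxrow_(k < r.+1) (lam ^+ k.+1 *: submxrow x k).

End smoothness.

(* The identity of a homogeneous Carnot group is necessarily 0, being fixed by
   all the dilations. *)
Record stratified_group (R : realType) := StratifiedGroup {
  last_layer : nat ;
  layer : 'I_last_layer.+1 -> nat ;
  gdim := (\sum_(k < last_layer.+1) layer k)%N ;
  gmul : 'rV[R]_gdim -> 'rV[R]_gdim -> 'rV[R]_gdim ;
  ginv : 'rV[R]_gdim -> 'rV[R]_gdim ;
  gmulA : forall x y z, gmul x (gmul y z) = gmul (gmul x y) z ;
  gmul0x : forall x, gmul 0 x = x ;
  gmulx0 : forall x, gmul x 0 = x ;
  gmulVx : forall x, gmul (ginv x) x = 0 ;
  gmulxV : forall x, gmul x (ginv x) = 0 ;
  gmul_smooth : smooth (fun z : 'rV[R]_gdim * 'rV[R]_gdim => gmul z.1 z.2) ;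
  ginv_smooth : smooth ginv ;
  dilation_gmul : forall lam : R, 0 < lam -> forall x y,
    dilation lam (gmul x y) = gmul (dilation lam x) (dilation lam y) ;
  hfield := fun j : 'I_(layer ord0) =>
    left_field gmul (delta_mx ord0 (tagnat.Rank ord0 j)) ;
  hfield_generating : forall X, left_invariant gmul X ->
    lie_span (range hfield) X
}.

Section carnot.
Context {R : realType}.
Variable G : stratified_group R.
Local Notation V := 'rV[R]_(gdim G).
Local Notation N1 := (layer (ord0 : 'I_(last_layer G).+1)).

Definition hom_dim : nat := (\sum_(k < (last_layer G).+1) k.+1 * layer k)%N.

Lemma differentiable_gmul (a x : V) : differentiable (@gmul R G a) x.
Proof.
have [+ _] := @gmul_smooth R G 1%N => /(_ (a, x)) mulD.
rewrite (_ : gmul a = (fun z : V * V => gmul z.1 z.2) \o (fun y => (a, y)))//.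
exact: differentiable_comp.
Qed.

Lemma left_invariantP (X : V -> V) :
  left_invariant (@gmul R G) X <-> X = left_field (@gmul R G) (X 0).
Proof.
split=> [Xinv|-> a x].
  by apply/funext => x; rewrite /left_field Xinv gmulx0.
have ax : differentiable (gmul a) (gmul x 0) by exact: differentiable_gmul.
have chain := derive_chain (X 0) (differentiable_gmul x 0) ax.
have e1 := congr1 (fun z => 'D_('D_(X 0) (gmul x) 0) (gmul a) z) (gmulx0 x).
have e2 : gmul a \o gmul x = gmul (gmul a x).
  by apply/funext => y; exact: gmulA.
have e3 := congr1 (fun f : V -> V => 'D_(X 0) f 0) e2.
exact: (etrans (esym e1) (etrans (esym chain) e3)).
Qed.

Lemma left_field0 (v : V) : left_field (@gmul R G) v 0 = v.
Proof.
rewrite /left_field (_ : gmul 0 = id) ?derive_id//.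
by apply/funext => x; exact: gmul0x.
Qed.

Definition hgrad (f : V -> R) (x : V) : 'rV[R]_N1 :=
  \row_(j < N1) 'D_(@hfield R G j x) f x.

(* Euclidean structure on horizontal vectors; the library norm `|v| on
   matrices is the sup norm. *)
Definition euclid_dot n (v w : 'rV[R]_n) : R := \sum_(j < n) v ord0 j * w ord0 j.
Definition euclid_norm n (v : 'rV[R]_n) : R := Num.sqrt (euclid_dot v v).

(* C^1 functions with compact support in Omega. *)
Definition C01 (Omega : set V) (f : V -> R) : Prop :=
  [/\ Ck 1 f, compact (closure [set x | f x != 0]) &
      closure [set x | f x != 0] `<=` Omega].

Variables (q : R) (Omega : set V).
Local Notation mu := (lebesgue_rV (gdim G)).

(* [W01 u g]: u is an element of W_0^{1,q}(Omega), with horizontal gradient g.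
   An element of the completion is given by a sequence phi_k in C_0^1(Omega)
   which is Cauchy for the norm (\int_Omega |grad_G phi|^q)^(1/q); by
   completeness of L^q, grad_G phi_k converges in L^q to some g, and since
   Omega is bounded phi_k converges in L^q to some u by the Poincare
   inequality. *)
Definition W01 (u : V -> R) (g : V -> 'rV[R]_N1) : Prop :=
  [/\ measurable_fun Omega u, measurable_fun Omega g &
    exists phi : (V -> R)^nat,
      [/\ forall k, C01 Omega (phi k),
        (\int[mu]_(x in Omega) (`|phi k x - u x| `^ q)%:E)%E @[k --> \oo] --> 0%E &
        (\int[mu]_(x in Omega) (euclid_norm (hgrad (phi k) x - g x) `^ q)%:E)%E
          @[k --> \oo] --> 0%E]].

(* The integrability conditions express that all the terms of the weak
   formulation make sense. *)
Definition positive_weak_solution (p lambda alpha : R) (u : V -> R) : Prop :=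
  let Q := hom_dim%:R : R in
  (forall x, Omega x -> 0 < u x) /\
  exists2 g, W01 u g & forall psi h, W01 psi h ->
    let F := fun x => euclid_norm (g x) `^ (q - 2) * euclid_dot (g x) (h x) in
    let A := fun x => u x `^ p * psi x in
    let B := fun x => expR (alpha * u x `^ (Q / (Q - 1))) * psi x in
    [/\ mu.-integrable Omega (EFin \o F), mu.-integrable Omega (EFin \o A),
        mu.-integrable Omega (EFin \o B) &
        \int[mu]_(x in Omega) F x =
        lambda * (\int[mu]_(x in Omega) A x) + \int[mu]_(x in Omega) B x].

End carnot.

(* Main.v *)
(* Let W be the space of pairs (u, g) of [W01]: it is closed in L^q x L^q and
   stable under truncation. Let x_1 be a coordinate of the first layer. By
   homogeneity X_j x_1 is constant and the coefficient of d/dx_k in X_j does not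
   depend on x_k, hence the X_j are divergence free; therefore
   v = L exp (- exp (- (x_1 + const))) satisfies - L_q v >= 3 weakly on Omega for
   a suitable L, and 0 < v < L. For lambda < L^-p and alpha < ln 2 / L^(Q/(Q-1))
   the reaction term, frozen outside [0, L], takes its values in [1, 3], so v is
   a supersolution. Let F be the (convex) primitive of the frozen term and
   minimize E(u, g) = int |g|^q / q - int F(u) over W; by truncation one may take
   0 <= u <= v. No compact embedding is needed: as
   E(max(u, w)) + E(min(u, w)) = E(u) + E(w), the maximum of two almost
   minimizers is an almost minimizer, so almost minimizers whose integral is
   almost the largest possible are close in L^1; their midpoint and the uniform
   convexity of |.|^q then make their gradients close in L^q. The limit is a
   minimizer, hence a weak solution; it is positive, since lifting it to t eta,
   eta a bump and t small, where it vanishes would decrease the energy. *)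
Require Import Defs.
From mathcomp Require Import all_boot all_order all_algebra.
From mathcomp Require Import all_classical all_reals all_analysis.
From mathcomp Require Import measurable_realfun.
From mathcomp Require Import ring lra.
Set Implicit Arguments.
Unset Strict Implicit.
Unset Printing Implicit Defensive.
Import Order.TTheory GRing.Theory Num.Theory.
Import numFieldNormedType.Exports.
Local Open Scope classical_set_scope.
Local Open Scope ring_scope.

(** * Euclidean norms and powers *)

(** The energy is not convex, since the convex F enters with a minus sign: nothing forces a
    minimizing sequence to be Cauchy. Asking in addition for an almost maximal integral removes this
    freedom. The supersolution depends on x_1 alone because this turns the q-Laplacian into an
    ordinary differential operator: for b' > 0 the gradient of b(x_1) is b'(x_1) e_1, and - L_q
    (b(x_1)) = - ((b')^(q-1))'(x_1). The double exponential is positive and bounded on the whole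
    line, so the bounds on v hold globally, and the factor L raises - L_q v by L^(q-1), that is, to
    any prescribed level. Monotonicity makes F convex, and the subgradient inequality of F then
    points in the direction that the Euler-Lagrange inequality requires. The bound f <= 3 is the
    level of the supersolution, so truncating at v does not raise the energy. The bound f >= 1 makes
    F grow at least linearly, which beats the cost t^q of lifting the minimizer by t eta. *)

Section euclid.
Context {R : realType} (n : nat).
Implicit Types (u v w : 'rV[R]_n) (a : R).

Lemma euclid_dotC v w : euclid_dot v w = euclid_dot w v.
Proof. by apply: eq_bigr => i _; rewrite mulrC. Qed.

Lemma euclid_dotDl u v w : euclid_dot (u + v) w = euclid_dot u w + euclid_dot v w.
Proof. by rewrite -big_split; apply: eq_bigr => i _; rewrite mxE mulrDl. Qed.

Lemma euclid_dotZl a v w : euclid_dot (a *: v) w = a * euclid_dot v w.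
Proof. by rewrite mulr_sumr; apply: eq_bigr => i _; rewrite mxE mulrA. Qed.

Lemma euclid_dotNl v w : euclid_dot (- v) w = - euclid_dot v w.
Proof. by rewrite -scaleN1r euclid_dotZl mulN1r. Qed.

Lemma euclid_dotDr u v w : euclid_dot u (v + w) = euclid_dot u v + euclid_dot u w.
Proof. by rewrite euclid_dotC euclid_dotDl !(euclid_dotC u). Qed.

Lemma euclid_dotNr v w : euclid_dot v (- w) = - euclid_dot v w.
Proof. by rewrite euclid_dotC euclid_dotNl euclid_dotC. Qed.

Lemma euclid_dotZr a v w : euclid_dot v (a *: w) = a * euclid_dot v w.
Proof. by rewrite euclid_dotC euclid_dotZl euclid_dotC. Qed.

Lemma euclid_dot0r v : euclid_dot v 0 = 0.
Proof. by rewrite -(scale0r 0) euclid_dotZr mul0r. Qed.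

Lemma euclid_dot_ge0 v : 0 <= euclid_dot v v.
Proof. by apply: sumr_ge0 => i _; rewrite -expr2 sqr_ge0. Qed.

Lemma euclid_norm_ge0 v : 0 <= euclid_norm v.
Proof. exact: sqrtr_ge0. Qed.

Lemma euclid_norm_sqr v : euclid_norm v ^+ 2 = euclid_dot v v.
Proof. by rewrite sqr_sqrtr// euclid_dot_ge0. Qed.

Lemma euclid_norm0 : euclid_norm (0 : 'rV[R]_n) = 0.
Proof. by rewrite /euclid_norm euclid_dot0r sqrtr0. Qed.

Lemma euclid_normZ a v : euclid_norm (a *: v) = `|a| * euclid_norm v.
Proof.
by rewrite /euclid_norm euclid_dotZl euclid_dotZr mulrA -expr2 sqrtrM ?sqr_ge0// sqrtr_sqr.
Qed.

Lemma euclid_normN v : euclid_norm (- v) = euclid_norm v.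
Proof. by rewrite -scaleN1r euclid_normZ normrN1 mul1r. Qed.

Lemma ler_coord_euclid_norm v i : `|v ord0 i| <= euclid_norm v.
Proof.
rewrite -[leLHS]sqrtr_sqr ler_sqrt ?euclid_dot_ge0// /euclid_dot (bigD1 i)//= -expr2.
by rewrite lerDl sumr_ge0// => j _; rewrite -expr2 sqr_ge0.
Qed.

Lemma euclid_norm_eq0 v : euclid_norm v = 0 -> v = 0.
Proof.
move=> v0; apply/rowP => i; rewrite mxE; apply/eqP; rewrite -normr_le0 -v0.
exact: ler_coord_euclid_norm.
Qed.

Lemma euclid_CS v w : `|euclid_dot v w| <= euclid_norm v * euclid_norm w.
Proof.
have [/eqP v0|v0] := eqVneq (euclid_norm v) 0.
  rewrite (eqP v0) (euclid_norm_eq0 (eqP v0)) euclid_dotC euclid_dot0r.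
  by rewrite normr0 mul0r.
have := euclid_dot_ge0 (euclid_dot v w *: v - euclid_dot v v *: w).
rewrite euclid_dotDl !euclid_dotDr !euclid_dotNl !euclid_dotNr !euclid_dotZl !euclid_dotZr.
rewrite (euclid_dotC w v) => vw.
rewrite -ler_sqr ?nnegrE ?mulr_ge0 ?euclid_norm_ge0 ?normr_ge0//.
rewrite real_normK ?num_real// exprMn !euclid_norm_sqr.
have v2 : 0 < euclid_dot v v.
  by rewrite -euclid_norm_sqr exprn_gt0// lt0r v0 euclid_norm_ge0.
rewrite -(ler_pM2l v2) expr2; nra.
Qed.

Lemma ler_euclid_normD v w : euclid_norm (v + w) <= euclid_norm v + euclid_norm w.
Proof.
rewrite -ler_sqr ?nnegrE ?addr_ge0 ?euclid_norm_ge0//.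
rewrite euclid_norm_sqr euclid_dotDl !euclid_dotDr (euclid_dotC w v) -!euclid_norm_sqr.
have := le_trans (ler_norm _) (euclid_CS v w); nra.
Qed.

Lemma euclid_norm_le_sum v : euclid_norm v <= \sum_i `|v ord0 i|.
Proof.
rewrite -ler_sqr ?nnegrE ?euclid_norm_ge0 ?sumr_ge0// euclid_norm_sqr expr2 mulr_suml.
apply: ler_sum => i _; rewrite (bigD1 i)//= mulrDr -normrM ger0_norm -?expr2 ?sqr_ge0//.
by rewrite lerDl mulr_ge0// sumr_ge0.
Qed.

Lemma euclid_parallelogram v w :
  euclid_norm (v + w) ^+ 2 + euclid_norm (v - w) ^+ 2 =
  2 * (euclid_norm v ^+ 2 + euclid_norm w ^+ 2).
Proof.
rewrite !euclid_norm_sqr !euclid_dotDl !euclid_dotDr !euclid_dotNl !euclid_dotNr.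
by rewrite (euclid_dotC w v); ring.
Qed.

Lemma continuous_euclid_norm : continuous (@euclid_norm R n).
Proof.
move=> v; rewrite /euclid_norm.
apply: (@continuous_comp _ _ _ (fun v => euclid_dot v v) Num.sqrt); last exact: sqrt_continuous.
move: v; rewrite /euclid_dot; apply: continuous_big => [|i _ v]; first exact: add_continuous.
have c := @coord_continuous R 1 n ord0 i v; exact: (cvgM c c).
Qed.

End euclid.

(** * Convexity and Young inequalities for real powers *)

Section powR_facts.
Context {R : realType}.
Implicit Types (a b q r : R).

Lemma powR_continuous_gt0 r a : 0 < a -> {for a, continuous (fun x => x `^ r)}.
Proof.
move=> a0; apply: differentiable_continuous; apply/derivable1_diffP.
exact: (@ex_derive _ _ _ _ _ _ _ (is_derive1_powR r a0)).
Qed.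

Lemma continuous_normr_powR r : 0 < r -> continuous (fun x : R => `|x| `^ r).
Proof.
move=> r0 x; have [->|x0] := eqVneq x 0; last first.
  have nx : 0 < `|x| by rewrite normr_gt0.
  have xx : `|y| @[y --> x] --> `|x| by apply: cvg_norm; exact: cvg_id.
  have yy : y `^ r @[y --> `|x|] --> `|x| `^ r by exact: powR_continuous_gt0.
  exact: (cvg_comp _ _ xx yy).
rewrite /continuous_at normr0 powR0 ?gt_eqF//; apply/cvgrPdist_le => e e0.
near=> y; rewrite sub0r normrN ger0_norm ?powR_ge0//.
have -> : e = (e `^ r^-1) `^ r by rewrite -powRrM mulVf ?gt_eqF// powRr1 ?ltW.
apply: ge0_ler_powR; rewrite ?nnegrE ?powR_ge0 ?normr_ge0 ?(ltW r0)//.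
near: y; exact: (@nbhs0_le R R^o _ (powR_gt0 _ e0)).
Unshelve. all: by end_near. Qed.

(** Strict Bernoulli inequality. With a = exp c it follows from exp((q-1)c) > 1 + (q-1)c and exp(-c)
    >= 1 - c, without differentiating the power. *)
Lemma powR_bernoulli_lt q a : 1 < q -> 0 <= a -> a != 1 -> 1 + q * (a - 1) < a `^ q.
Proof.
move=> q1; have q0 : 0 < q by rewrite (lt_trans _ q1).
rewrite le_eqVlt => /predU1P[<- _|a0 a1]; first by rewrite powR0 ?gt_eqF//; lra.
rewrite /powR gt_eqF//; have <- := lnK a0; set c := ln a; rewrite expRK.
have c0 : c != 0 by apply: contra a1 => /eqP c0; rewrite -(lnK a0) -/c c0 expR0.
have h1 : 1 + (q - 1) * c < expR ((q - 1) * c).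
  by apply: expR_gt1Dx; rewrite mulf_neq0// subr_eq0 gt_eqF.
have h2 : 1 - c <= expR (- c) by exact: expR_ge1Dx.
have e0 : 0 < expR c by exact: expR_gt0.
have -> : expR (q * c) = expR c * expR ((q - 1) * c) by rewrite -expRD; congr expR; ring.
have e1 : expR c * (1 - c) <= 1.
  by rewrite -[leRHS](divff (lt0r_neq0 e0)) -expRN ler_pM2l.
have e2 : expR c * (1 + (q - 1) * c) < expR c * expR ((q - 1) * c) by rewrite ltr_pM2l.
have : 0 <= (q - 1) * (1 - expR c * (1 - c)) by rewrite mulr_ge0// subr_ge0// ltW.
lra.
Qed.

(** The graph of t^q lies above its tangent at b: Bernoulli at a / b, multiplied by b^q. *)
Lemma powR_tangent q a b : 1 < q -> 0 <= a -> 0 <= b ->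
  q * b `^ (q - 1) * (a - b) <= a `^ q - b `^ q.
Proof.
move=> q1 a0; have q0 : 0 < q by rewrite (lt_trans _ q1).
rewrite le_eqVlt => /predU1P[<-|b0].
  by rewrite !powR0 ?gt_eqF// ?subr_gt0// ?mulr0 ?mul0r ?subr0 ?powR_ge0.
have hb : 1 + q * (a / b - 1) <= (a / b) `^ q.
  have [->|ab] := eqVneq (a / b) 1; first by rewrite subrr mulr0 addr0 powR1.
  by rewrite ltW// powR_bernoulli_lt// divr_ge0// ltW.
have -> : a `^ q = (a / b) `^ q * b `^ q.
  by rewrite -powRM ?divr_ge0 ?(ltW b0)// divfK// gt_eqF.
rewrite -(mulr_powRB1 (ltW b0) q0); have := powR_gt0 (q - 1) b0.
set B := b `^ _; set C := _ `^ q in hb * => B0.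
have -> : q * B * (a - b) = B * b * (q * (a / b - 1)) by field; rewrite gt_eqF.
have : 0 < B * b by rewrite mulr_gt0.
nra.
Qed.

(** Bernoulli at a / m and b / m, where m is the midpoint: the linear terms cancel, and the
    inequality at a / m is strict because a differs from m. *)
Lemma powR_midpoint_lt q a b : 1 < q -> 0 <= a -> 0 <= b -> a != b ->
  ((a + b) / 2) `^ q < (a `^ q + b `^ q) / 2.
Proof.
move=> q1 a0 b0 ab; have [m em] : exists m, m = (a + b) / 2 by eexists.
rewrite -em; have q0 : 0 < q by rewrite (lt_trans _ q1).
have m0 : 0 < m.
  rewrite em divr_gt0// lt0r addr_ge0// andbT; apply: contra ab; rewrite paddr_eq0//.
  by move=> /andP[/eqP -> /eqP ->].
have am : a / m != 1.
  apply: contra ab => /eqP am; have : a = m by rewrite -[LHS](divfK (lt0r_neq0 m0)) am mul1r.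
  by rewrite em => ?; apply/eqP; lra.
have ha := powR_bernoulli_lt q1 (divr_ge0 a0 (ltW m0)) am.
have hb : 1 + q * (b / m - 1) <= (b / m) `^ q.
  have [->|bm] := eqVneq (b / m) 1; first by rewrite subrr mulr0 addr0 powR1.
  by rewrite ltW// powR_bernoulli_lt// divr_ge0// ltW.
have Mq : 0 < m `^ q by rewrite powR_gt0.
have -> : a `^ q = (a / m) `^ q * m `^ q.
  by rewrite -powRM ?divr_ge0 ?(ltW m0)// divfK// gt_eqF.
have -> : b `^ q = (b / m) `^ q * m `^ q.
  by rewrite -powRM ?divr_ge0 ?(ltW m0)// divfK// gt_eqF.
have e : a / m + b / m = 2 by rewrite -mulrDl (_ : a + b = 2 * m) ?mulfK ?gt_eqF//; lra.
have e' : q * (a / m - 1) + q * (b / m - 1) = 0.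
  by rewrite -mulrDr (_ : _ + _ = 0) ?mulr0//; lra.
have : 2 < (a / m) `^ q + (b / m) `^ q by lra.
nra.
Qed.

Lemma powR_double q a b : 0 <= q -> 0 <= a -> 0 <= b ->
  (a + b) `^ q <= 2 `^ q * (a `^ q + b `^ q).
Proof.
move=> q0 a0 b0.
have h x y : 0 <= x -> x <= y -> (x + y) `^ q <= 2 `^ q * (x `^ q + y `^ q).
  move=> x0 xy; have y0 : 0 <= y by exact: le_trans xy.
  apply: (@le_trans _ _ ((2 * y) `^ q)).
    by apply: ge0_ler_powR; rewrite ?nnegrE ?addr_ge0 ?mulr_ge0//; lra.
  by rewrite powRM// ler_wpM2l ?powR_ge0// lerDr powR_ge0.
case: (leP a b) => ab; first exact: h.
by rewrite addrC [X in _ * X]addrC; apply: h => //; exact: ltW.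
Qed.

(** A Young inequality with crude constants, by comparing b with e a: if b <= e a the first term
    dominates, otherwise a < b / e and the second one does. The small parameter e is what later
    turns L^q smallness into L^1 smallness on sets of finite measure. *)
Lemma powR_young_split q a b e : 1 < q -> 0 <= a -> 0 <= b -> 0 < e ->
  a `^ (q - 1) * b <= e * a `^ q + e `^ (1 - q) * b `^ q.
Proof.
move=> q1 a0 b0 e0; have q0 : 0 < q by rewrite (lt_trans _ q1).
have q10 : 0 < q - 1 by rewrite subr_gt0.
rewrite -(mulr_powRB1 a0 q0); have := powR_ge0 a (q - 1); set A := a `^ _ => A0.
case: (leP b (e * a)) => ba.
  have := powR_ge0 e (1 - q); have := powR_ge0 b q; nra.
have b0' : 0 < b by apply: le_lt_trans ba; rewrite mulr_ge0// ltW.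
have : A <= (b / e) `^ (q - 1).
  by rewrite ge0_ler_powR ?nnegrE ?(ltW q10) ?divr_ge0 ?(ltW e0)// ler_pdivlMr// mulrC ltW.
rewrite powRM ?invr_ge0 ?(ltW e0)// -(powR_inv1 (ltW e0)) -powRrM.
rewrite -(mulr_powRB1 b0 q0) (_ : -1 * (q - 1) = 1 - q); last by ring.
move=> AB; have : A * b <= b `^ (q - 1) * e `^ (1 - q) * b by rewrite ler_wpM2r.
have : 0 <= e * (a * A) by rewrite !mulr_ge0// ltW.
lra.
Qed.

End powR_facts.

(** * Uniform convexity of the q-th power of the Euclidean norm *)

Section uniform_convexity.
Context {R : realType} (n : nat) (q : R).
Hypothesis q1 : 1 < q.
Implicit Types a b : 'rV[R]_n.

Let q0 : 0 < q. Proof. by rewrite (lt_trans _ q1). Qed.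

Definition midpoint_defect a b : R :=
  (euclid_norm a `^ q + euclid_norm b `^ q) / 2 - euclid_norm (2^-1 *: (a + b)) `^ q.

(** If the norms differ, strict convexity of t^q decides; if they agree, the parallelogram law makes
    the midpoint strictly shorter. *)
Lemma midpoint_defect_gt0 a b : a != b -> 0 < midpoint_defect a b.
Proof.
move=> ab; rewrite subr_gt0 euclid_normZ ger0_norm ?invr_ge0// mulrC.
set s := euclid_norm a; set t := euclid_norm b.
have s0 : 0 <= s by exact: euclid_norm_ge0.
have t0 : 0 <= t by exact: euclid_norm_ge0.
have st : euclid_norm (a + b) <= s + t by exact: ler_euclid_normD.
have [est|nst] := eqVneq s t; last first.
  apply: le_lt_trans (powR_midpoint_lt q1 s0 t0 nst).
  by rewrite ge0_ler_powR ?nnegrE ?divr_ge0 ?addr_ge0 ?euclid_norm_ge0 ?(ltW q0)// ler_pM2r.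
rewrite -est (_ : (s `^ q + s `^ q) / 2 = s `^ q); last by field.
rewrite gt0_ltr_powR ?nnegrE ?divr_ge0 ?euclid_norm_ge0//.
have : 0 < euclid_norm (a - b).
  rewrite lt0r euclid_norm_ge0 andbT; apply: contra ab => /eqP /euclid_norm_eq0 /eqP.
  by rewrite subr_eq0.
have := euclid_parallelogram a b; rewrite -/s -/t -est => par ab0.
have := euclid_norm_ge0 (a + b) => ab1; nra.
Qed.

Lemma midpoint_defect_ge0 a b : 0 <= midpoint_defect a b.
Proof.
have [->|/midpoint_defect_gt0 /ltW//] := eqVneq a b.
rewrite /midpoint_defect scalerDr -scalerDl (_ : 2^-1 + 2^-1 = 1 :> R); last by field.
by rewrite scale1r (_ : _ - _ = 0)//; field.
Qed.

Lemma continuous_euclid_norm_powR (T : topologicalType) (f : T -> 'rV[R]_n) :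
  continuous f -> continuous (fun x => euclid_norm (f x) `^ q).
Proof.
move=> cf x; under eq_fun do rewrite -[X in X `^ _]ger0_norm ?euclid_norm_ge0//.
apply: (@continuous_comp _ _ _ (fun x => euclid_norm (f x)) (fun y => `|y| `^ q)).
  by apply: continuous_comp; [exact: cf|exact: continuous_euclid_norm].
exact: continuous_normr_powR.
Qed.

Let cfst : continuous (fun z : 'rV[R]_n * 'rV[R]_n => z.1).
Proof. by move=> z; exact: cvg_fst. Qed.
Let csnd : continuous (fun z : 'rV[R]_n * 'rV[R]_n => z.2).
Proof. by move=> z; exact: cvg_snd. Qed.

Let continuous_sum_powR : continuous (fun z : 'rV[R]_n * 'rV[R]_n =>
  euclid_norm z.1 `^ q + euclid_norm z.2 `^ q).
Proof. move=> z; apply: cvgD.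
  exact: (continuous_euclid_norm_powR cfst).
exact: (continuous_euclid_norm_powR csnd). Qed.

Let continuous_sub_powR : continuous (fun z : 'rV[R]_n * 'rV[R]_n =>
  euclid_norm (z.1 - z.2) `^ q).
Proof.
apply: (@continuous_euclid_norm_powR _ (fun z : 'rV[R]_n * 'rV[R]_n => z.1 - z.2)) => z.
by apply: cvgB; [exact: cfst|exact: csnd].
Qed.

Let continuous_defect :
  continuous (fun z : 'rV[R]_n * 'rV[R]_n => midpoint_defect z.1 z.2).
Proof.
move=> z; apply: cvgB; last first.
  apply: (@continuous_euclid_norm_powR _ (fun z : 'rV[R]_n * 'rV[R]_n => 2^-1 *: (z.1 + z.2))) => {}z.
  apply: cvgZr; apply: cvgD; [exact: cfst|exact: csnd].
by apply: cvgM; [exact: continuous_sum_powR|exact: cvg_cst].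
Qed.

Lemma euclid_norm_powR_double a b :
  euclid_norm (a + b) `^ q <= 2 `^ q * (euclid_norm a `^ q + euclid_norm b `^ q).
Proof.
apply: le_trans (powR_double (ltW q0) (euclid_norm_ge0 a) (euclid_norm_ge0 b)).
by rewrite ge0_ler_powR ?nnegrE ?addr_ge0 ?euclid_norm_ge0 ?(ltW q0) ?ler_euclid_normD.
Qed.

Lemma euclid_norm_powR_doubleB a b :
  euclid_norm (a - b) `^ q <= 2 `^ q * (euclid_norm a `^ q + euclid_norm b `^ q).
Proof. by rewrite -(euclid_normN b) euclid_norm_powR_double. Qed.

(* By homogeneity it suffices to treat the compact set |a|^q + |b|^q = 1,
   |a - b|^q >= e, on which the defect is bounded away from 0. *)
Lemma uniform_convexity (e : R) : 0 < e -> exists2 C, 0 <= C & forall a b,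
  euclid_norm (a - b) `^ q <=
  e * (euclid_norm a `^ q + euclid_norm b `^ q) + C * midpoint_defect a b.
Proof.
move=> e0; pose S := [set z : 'rV[R]_n * 'rV[R]_n |
  euclid_norm z.1 `^ q + euclid_norm z.2 `^ q = 1 /\ e <= euclid_norm (z.1 - z.2) `^ q].
suff [C C0 HC] : exists2 C, 0 <= C & forall z, S z ->
    euclid_norm (z.1 - z.2) `^ q <= C * midpoint_defect z.1 z.2.
  exists C => // a b; set M := euclid_norm a `^ q + euclid_norm b `^ q.
  have M0 : 0 <= M by rewrite addr_ge0// powR_ge0.
  have [M00|Mn0] := eqVneq M 0.
    rewrite M00 mulr0 add0r; apply: (@le_trans _ _ 0).
      by apply: le_trans (euclid_norm_powR_doubleB a b) _; rewrite -/M M00 mulr0.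
    by rewrite mulr_ge0// midpoint_defect_ge0.
  have Mgt0 : 0 < M by rewrite lt0r Mn0.
  (* Scaling by r multiplies q-th powers of norms, and hence the defect, by M^-1. *)
  pose r := (M^-1) `^ q^-1.
  have r0 : 0 <= r by exact: powR_ge0.
  have rq : r `^ q = M^-1 by rewrite -powRrM mulVf ?gt_eqF// powRr1// invr_ge0.
  have nZ (v : 'rV[R]_n) : euclid_norm (r *: v) `^ q = M^-1 * euclid_norm v `^ q.
    by rewrite euclid_normZ ger0_norm// powRM ?euclid_norm_ge0// rq.
  have dZ : midpoint_defect (r *: a) (r *: b) = M^-1 * midpoint_defect a b.
    rewrite /midpoint_defect -scalerDr scalerA (mulrC 2^-1) -scalerA !nZ.
    by rewrite [RHS]mulrBr mulrA mulrDr.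
  have [Sz|nSz] := pselect (S (r *: a, r *: b)).
    have := HC _ Sz; rewrite /= dZ -scalerBr nZ mulrCA ler_pM2l ?invr_gt0// => H.
    by apply: le_trans H _; rewrite lerDr mulr_ge0// ltW.
  have : euclid_norm (r *: a - r *: b) `^ q <= e.
    rewrite leNgt; apply/negP => H; apply: nSz; split => /=; last exact: ltW.
    by rewrite !nZ -mulrDr mulVf.
  rewrite -scalerBr nZ mulrC ler_pdivrMr// => H; apply: le_trans H _.
  by rewrite lerDl mulr_ge0// midpoint_defect_ge0.
have [[z0 Sz0]|nS] := pselect (S !=set0); last first.
  by exists 0 => // z Sz; exfalso; apply: nS; exists z.
have Sc : closed S.
  apply: closedI.
    apply: (@closed_comp _ _ (fun z : 'rV[R]_n * 'rV[R]_n =>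
      euclid_norm z.1 `^ q + euclid_norm z.2 `^ q) [set 1]); last exact: closed_eq.
    by move=> z _; exact: continuous_sum_powR.
  apply: (@closed_comp _ _ (fun z : 'rV[R]_n * 'rV[R]_n =>
    euclid_norm (z.1 - z.2) `^ q) [set y | e <= y]); last exact: closed_ge.
  by move=> z _; exact: continuous_sub_powR.
have Sco : compact S.
  pose B := [set v : 'rV[R]_n | forall i, `[(- 1 : R), 1]%classic (v ord0 i)].
  have cB : compact B.
    by apply: (@rV_compact _ _ (fun _ : 'I_n => `[(- 1 : R), 1]%classic)) => _; exact: segment_compact.
  apply: subclosed_compact Sc (compact_setX cB cB) _ => -[x y] [/= xy _].
  have aux (v : 'rV[R]_n) : euclid_norm v `^ q <= 1 -> B v.
    move=> v1 i; rewrite /= in_itv/= -ler_norml.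
    apply: le_trans (ler_coord_euclid_norm v i) _; rewrite leNgt; apply/negP => v2.
    have := gt0_ltr_powR q0 _ _ v2; rewrite powR1 !nnegrE euclid_norm_ge0 ler01.
    by move=> /(_ isT isT); rewrite ltNge v1.
  by split; apply: aux; rewrite -xy ?lerDl ?lerDr powR_ge0.
have [dm dm0 zmin] : exists2 dm, 0 < dm & forall z, S z -> dm <= midpoint_defect z.1 z.2.
  have [zm /set_mem [_ zm2] zmin] := compact_EVT_min (ex_intro _ z0 Sz0) Sco
    (continuous_subspaceT continuous_defect).
  (* [S] avoids the diagonal, as |a - b|^q >= e > 0 on it, so the defect is positive at its
     minimizer. *)
  exists (midpoint_defect zm.1 zm.2) => [|z Sz]; last exact: (zmin z (mem_set Sz)).
  apply: midpoint_defect_gt0; apply: contraTN zm2 => /eqP ->.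
  by rewrite subrr euclid_norm0 powR0 ?gt_eqF// -ltNge.
exists (2 `^ q / dm) => [|z Sz]; first by rewrite divr_ge0 ?powR_ge0// ltW.
apply: le_trans (euclid_norm_powR_doubleB z.1 z.2) _; rewrite Sz.1 mulr1.
have dz := zmin _ Sz; clear - dm0 dz.
rewrite -[leLHS](divfK (lt0r_neq0 dm0)); apply: ler_wpM2l => //.
by rewrite divr_ge0 ?powR_ge0// ltW.
Qed.

End uniform_convexity.

(** * The vector field |a|^(q-2) a *)

Section flux.
Context {R : realType} (n : nat) (q : R).
Hypothesis q1 : 1 < q.
Implicit Types a b h : 'rV[R]_n.

Let q0 : 0 < q. Proof. by rewrite (lt_trans _ q1). Qed.
Let q10 : 0 < q - 1. Proof. by rewrite subr_gt0. Qed.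

(** For a = 0 and q < 2 the power takes the default value 0; the flux is 0 at a = 0 in any case,
    because the dot product vanishes. *)
Definition flux a h : R := euclid_norm a `^ (q - 2) * euclid_dot a h.

Lemma flux_norm_bound a h : `|flux a h| <= euclid_norm a `^ (q - 1) * euclid_norm h.
Proof.
rewrite normrM [X in X * _]ger0_norm ?powR_ge0//.
apply: le_trans (ler_wpM2l (powR_ge0 _ _) (euclid_CS a h)) _.
rewrite mulrA ler_wpM2r ?euclid_norm_ge0//.
have [/eqP ->|a0] := boolP (euclid_norm a == 0); first by rewrite mulr0 powR_ge0.
rewrite -[X in _ * X](powRr1 (euclid_norm_ge0 a)) -powRD ?a0 ?implybT//.
by rewrite (_ : q - 2 + 1 = q - 1)//; ring.
Qed.

Lemma flux_self a : flux a a = euclid_norm a `^ q.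
Proof.
rewrite /flux -euclid_norm_sqr -powR_mulrn ?euclid_norm_ge0//.
have [->|a0] := eqVneq (euclid_norm a) 0.
  by rewrite (powR0 (lt0r_neq0 q0)) (@powR0 _ 2%:R) ?mulr0// pnatr_eq0.
by rewrite -powRD ?a0 ?implybT// subrK.
Qed.

Lemma fluxDr a h k : flux a (h + k) = flux a h + flux a k.
Proof. by rewrite /flux euclid_dotDr mulrDr. Qed.

Lemma fluxZr a c h : flux a (c *: h) = c * flux a h.
Proof. by rewrite /flux euclid_dotZr mulrCA. Qed.

Lemma fluxNr a h : flux a (- h) = - flux a h.
Proof. by rewrite -scaleN1r fluxZr mulN1r. Qed.

Lemma flux0r a : flux a 0 = 0.
Proof. by rewrite -(scale0r 0) fluxZr mul0r. Qed.

(** Convexity of |.|^q, whose differential at b is q times the flux of b; Cauchy-Schwarz reduces it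
    to [powR_tangent] at the two norms. *)
Lemma flux_tangent a b :
  q * flux b (a - b) <= euclid_norm a `^ q - euclid_norm b `^ q.
Proof.
apply: le_trans (powR_tangent q1 (euclid_norm_ge0 a) (euclid_norm_ge0 b)).
rewrite -mulrA ler_pM2l// fluxDr fluxNr flux_self mulrBr.
rewrite [X in _ <= _ - X]mulrC mulr_powRB1 ?euclid_norm_ge0// lerD2r.
exact: le_trans (ler_norm _) (flux_norm_bound _ _).
Qed.

(** Away from a = 0 both factors are continuous. At a = 0 the power with exponent q - 2 need not be,
    and the bound by |t h|^(q-1) |h| is used instead. *)
Lemma flux_cvg a h (t : R^nat) : (forall k, 0 < t k) -> t @ \oo --> 0 ->
  flux (a + t k *: h) h @[k --> \oo] --> flux a h.
Proof.
move=> tp t0; have [->|a0] := eqVneq a 0.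
  rewrite [X in _ --> X](_ : _ = 0); last first.
    by rewrite /flux euclid_dotC euclid_dot0r mulr0.
  apply/norm_cvg0P; apply: (@squeeze_cvgr _ _ _ _ (fun=> 0)
    (fun k => `|t k * euclid_norm h| `^ (q - 1) * euclid_norm h)).
  - near=> k; rewrite normr_ge0/= add0r.
    apply: le_trans (flux_norm_bound _ _) _.
    by rewrite euclid_normZ normrM (@ger0_norm _ (euclid_norm h)) ?euclid_norm_ge0.
  - exact: cvg_cst.
  - have : (t k * euclid_norm h) @[k --> \oo] --> 0 * euclid_norm h.
      by apply: cvgM => //; exact: cvg_cst.
    rewrite mul0r => th.
    have := cvg_comp _ _ th (@continuous_normr_powR _ _ q10 0).
    rewrite normr0 (powR0 (lt0r_neq0 q10)) => H.
    rewrite -[X in _ --> X](mul0r (euclid_norm h)).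
    by apply: cvgM => //; exact: cvg_cst.
have an : 0 < euclid_norm a.
  rewrite lt0r euclid_norm_ge0 andbT; apply: contra a0 => /eqP /euclid_norm_eq0 ->//.
have ta : a + t k *: h @[k --> \oo] --> a.
  rewrite -[X in _ --> X]addr0 -[X in a + X](scale0r h).
  by apply: cvgD; [exact: cvg_cst|apply: cvgZl].
apply: cvgM.
  apply: (@continuous_cvg _ _ _ _ _ (fun k => euclid_norm (a + t k *: h)) (fun y => y `^ (q - 2))).
    exact: powR_continuous_gt0.
  exact: (cvg_comp _ _ ta (@continuous_euclid_norm R n a)).
have e : (fun k => euclid_dot (a + t k *: h) h) =
    (fun k => euclid_dot a h + t k * euclid_dot h h).
  by apply/funext => k; rewrite euclid_dotDl euclid_dotZl.
rewrite e -[X in _ --> X]addr0 -[X in _ --> _ + X](mul0r (euclid_dot h h)).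
by apply: cvgD; [exact: cvg_cst|apply: cvgM => //; exact: cvg_cst].
Unshelve. all: by end_near. Qed.

End flux.

(** * Measurability and completeness of L^q *)

Section vector_measurability.
Context {R : realType} (n : nat) d (T : measurableType d) (D : set T).
Hypothesis mD : measurable D.
Implicit Types g h : T -> 'rV[R]_n.

Lemma measurable_fun_rVP g : measurable_fun D g <->
  (forall i, measurable_fun D (fun t => g t ord0 i)).
Proof.
split=> [mg i|mg].
  exact: (measurableT_comp (measurable_coord i) mg).
pose G := \big[setU/set0]_(i < n)
  preimage_set_system setT (fun x : 'rV[R]_n => x ord0 i) (@measurable _ R).
apply: (@measurability _ _ _ _ _ _ G) => // _ [A GA <-].
move: GA; rewrite /G -bigcup_seq/= => -[i _ [B mB <-]].
by have := mg i mD B mB; rewrite setTI.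
Qed.

Lemma measurable_rVD g h : measurable_fun D g -> measurable_fun D h ->
  measurable_fun D (fun x => g x + h x).
Proof.
move=> /measurable_fun_rVP mg /measurable_fun_rVP mh; apply/measurable_fun_rVP => i.
by under eq_fun do rewrite mxE; exact: measurable_funD.
Qed.

Lemma measurable_rVZ (c : R) g : measurable_fun D g ->
  measurable_fun D (fun x => c *: g x).
Proof.
move=> /measurable_fun_rVP mg; apply/measurable_fun_rVP => i.
by under eq_fun do rewrite mxE; exact: measurable_funM.
Qed.

Lemma measurable_rVZfun (c : T -> R) g : measurable_fun D c -> measurable_fun D g ->
  measurable_fun D (fun x => c x *: g x).
Proof.
move=> mc /measurable_fun_rVP mg; apply/measurable_fun_rVP => i.
by under eq_fun do rewrite mxE; exact: measurable_funM.
Qed.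

Lemma measurable_rVB g h : measurable_fun D g -> measurable_fun D h ->
  measurable_fun D (fun x => g x - h x).
Proof.
move=> mg mh; under eq_fun do rewrite -scaleN1r.
by apply: measurable_rVD => //; exact: measurable_rVZ.
Qed.

Lemma measurable_fun_ite d' (U : measurableType d') (b : T -> bool) (f g : T -> U) :
  measurable_fun D b -> measurable_fun D f -> measurable_fun D g ->
  measurable_fun D (fun x => if b x then f x else g x).
Proof.
move=> mb mf mg; have mbt c : measurable (D `&` b @^-1` [set c]) by exact: mb.
by apply: measurable_fun_if => //; apply: measurable_funS mD _ _ => // x [].
Qed.

Lemma measurable_euclid_dot g h : measurable_fun D g -> measurable_fun D h ->
  measurable_fun D (fun x => euclid_dot (g x) (h x)).
Proof.
move=> /measurable_fun_rVP mg /measurable_fun_rVP mh.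
by apply: measurable_sum => i; exact: measurable_funM.
Qed.

Lemma measurable_euclid_norm g : measurable_fun D g ->
  measurable_fun D (fun x => euclid_norm (g x)).
Proof.
move=> mg; have ms : measurable_fun setT (Num.sqrt : R -> R).
  by apply: continuous_measurable_fun; exact: sqrt_continuous.
exact: (measurableT_comp ms (measurable_euclid_dot mg mg)).
Qed.

Lemma measurable_fun_powR (f : T -> R) (r : R) : measurable_fun D f ->
  measurable_fun D (fun x => f x `^ r).
Proof. by move=> mf; exact: (measurableT_comp (measurable_powR r)). Qed.

Lemma measurable_fun_normr (f : T -> R) : measurable_fun D f ->
  measurable_fun D (fun x => `|f x|).
Proof. by move=> mf; exact: (measurableT_comp (@normr_measurable R setT)). Qed.

Lemma measurable_flux (q : R) g h : measurable_fun D g -> measurable_fun D h ->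
  measurable_fun D (fun x => flux q (g x) (h x)).
Proof.
move=> mg mh; apply: measurable_funM; last exact: measurable_euclid_dot.
by apply: measurable_fun_powR; exact: measurable_euclid_norm.
Qed.

End vector_measurability.

Section integral_toolbox.
Context {R : realType} d (T : measurableType d) (mu : {measure set T -> \bar R}) (D : set T).
Hypothesis mD : measurable D.
Local Notation intg f := (mu.-integrable D (EFin \o f)).
Implicit Types f g : T -> R.

Lemma intg_measurable f : intg f -> measurable_fun D f.
Proof. by move=> /measurable_int /measurable_EFinP. Qed.

Lemma intgD f g : intg f -> intg g -> intg (fun x => f x + g x).
Proof. by move=> fi gi; exact: (integrableD mD fi gi). Qed.

Lemma intgB f g : intg f -> intg g -> intg (fun x => f x - g x).
Proof. by move=> fi gi; exact: (integrableB mD fi gi). Qed.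

Lemma intgZ c f : intg f -> intg (fun x => c * f x).
Proof. by move=> fi; exact: (integrableZl mD c fi). Qed.

Lemma intg_le f g : measurable_fun D f -> intg g ->
  (forall x, D x -> `|f x| <= g x) -> intg f.
Proof.
move=> mf gi fg; apply: le_integrable gi => //; first exact/measurable_EFinP.
by move=> x Dx /=; rewrite lee_fin (le_trans (fg x Dx))// ler_norm.
Qed.

Lemma intg_norm f : intg f -> intg (fun x => `|f x|).
Proof.
move=> fi; have mf := intg_measurable fi; apply: le_integrable fi => //=.
  by apply/measurable_EFinP; exact: measurable_fun_normr.
by move=> x _; rewrite /= normr_id.
Qed.

Lemma intg_cst (c : R) : (mu D < +oo)%E -> intg (fun=> c).
Proof.
move=> Dfin; apply: measurable_bounded_integrable => //.
exists `|c|; split; first exact: num_real.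
by move=> y cy x _ /=; exact: ltW.
Qed.

Lemma intg_EFin f : intg f ->
  (\int[mu]_(x in D) (f x)%:E = (\int[mu]_(x in D) f x)%:E)%E.
Proof. by move=> fi; rewrite /Rintegral fineK//; exact: (integrable_fin_num mD fi). Qed.

Lemma ge0_intg_bounded f (C : R) : measurable_fun D f -> (forall x, D x -> 0 <= f x) ->
  (\int[mu]_(x in D) (f x)%:E <= C%:E)%E ->
  intg f /\ \int[mu]_(x in D) f x <= C.
Proof.
move=> mf f0 fC; have fi : intg f.
  apply/integrableP; split; first exact/measurable_EFinP.
  apply: le_lt_trans (ltry C); apply: le_trans fC; apply: ge0_le_integral => //=.
  - by apply/measurable_EFinP; exact: measurable_fun_normr.
  - exact/measurable_EFinP.
  - by move=> x Dx; rewrite lee_fin ger0_norm// f0.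
by split=> //; rewrite -lee_fin -intg_EFin.
Qed.

Lemma ae_eq_intg f g : measurable_fun D f -> intg g -> ae_eq mu D f g ->
  intg f /\ \int[mu]_(x in D) f x = \int[mu]_(x in D) g x.
Proof.
move=> mf gi fg; have mg := intg_measurable gi.
have fgE : ae_eq mu D (EFin \o g) (EFin \o f).
  by apply: filterS fg => x /= H Dx; rewrite H.
split; last first.
  rewrite /Rintegral; congr fine; apply: ae_eq_integral => //; [exact/measurable_EFinP| |].
    exact/measurable_EFinP.
  exact: ae_eq_sym.
apply/integrableP; split; first exact/measurable_EFinP.
have /integrableP[_] := gi; congr (_ < _)%E; apply: ae_eq_integral => //=.
- by apply/measurable_EFinP; exact: measurable_fun_normr.
- by apply/measurable_EFinP; exact: measurable_fun_normr.
- by apply: filterS fgE => x /= H Dx; have [->] := H Dx.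
Qed.

Lemma ge0_Rintegral_le0 f : intg f -> (forall x, D x -> 0 <= f x) ->
  \int[mu]_(x in D) f x <= 0 -> ae_eq mu D f (fun=> 0).
Proof.
move=> fi f0 int0; have mf := intg_measurable fi.
have : (\int[mu]_(x in D) `|(EFin \o f) x| = 0)%E.
  have : (\int[mu]_(x in D) (f x)%:E = 0)%E.
    rewrite intg_EFin//; congr EFin; apply/eqP; rewrite eq_le int0/=.
    by apply: Rintegral_ge0.
  by move=> <-; apply: eq_integral => x /[!inE] Dx /=; rewrite ger0_norm// f0.
have mfE : measurable_fun D (EFin \o f) by exact/measurable_EFinP.
by have [H _] := ae_eq_integral_abs mu mD mfE; move=> /H {}H; apply: filterS H => x /= H Dx; have [->] := H Dx.
Qed.

Lemma Rintegral_dominated_cvg (f_ : (T -> R)^nat) f g :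
  (forall n, measurable_fun D (f_ n)) -> measurable_fun D f ->
  (forall x, D x -> f_ ^~ x @ \oo --> f x) -> intg g ->
  (forall n x, D x -> `|f_ n x| <= g x) ->
  \int[mu]_(x in D) f_ n x @[n --> \oo] --> \int[mu]_(x in D) f x.
Proof.
move=> mf_ mf f_f gi fg.
have f_fE x : D x -> (fun n => (f_ n x)%:E) @ \oo --> (f x)%:E.
  by move=> Dx; apply: cvg_EFin; [exact: nearW|exact: f_f].
have fi : intg f.
  apply: (intg_le mf gi) => x Dx; 
  apply: (cvgr_to_le (cvg_norm (f_f x Dx))).
  by apply: nearW => n; exact: fg.
have /fine_cvgP[_] : (\int[mu]_(x in D) (f_ n x)%:E)%E @[n --> \oo] -->
    (fine (\int[mu]_(x in D) (f x)%:E))%:E.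
  rewrite fineK; last exact: (integrable_fin_num mD fi).
  apply: (dominated_cvg mD _ f_fE _ gi) => //.
  by move=> n; exact/measurable_EFinP.
by [].
Qed.

End integral_toolbox.

Lemma expr_lt_eps {R : realType} (c e : R) : 0 <= c -> c < 1 -> 0 < e ->
  exists n, forall m, (n <= m)%N -> c ^+ m <= e.
Proof.
move=> c0 c1 e0; have : c ^+ n @[n --> \oo] --> 0 by apply: cvg_expr; rewrite ger0_norm.
move=> /cvgrPdist_le /(_ _ e0) [n _ H]; exists n => m nm.
by have := H m nm; rewrite sub0r normrN ger0_norm// exprn_ge0.
Qed.

Lemma cvg_geometric_increments {R : realType} (u : R^nat) (M : R) :
  (forall j, 2 ^+ j * `|u j.+1 - u j| <= M) -> cvgn u.
Proof.
move=> uM; have M0 : 0 <= M by apply: le_trans (uM 0%N); rewrite mulr_ge0.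
have h : cvgn [normed series (telescope u)].
  apply: (@series_le_cvg _ _ (geometric M 2^-1)) => [n|n|n|].
  - by rewrite /= normr_ge0.
  - by rewrite /= mulr_ge0// exprn_ge0.
  - by rewrite /= exprVn ler_pdivlMr ?exprn_gt0// mulrC; exact: uM.
  - apply: is_cvg_geometric_series; rewrite ger0_norm//; lra.
have /cvg_ex[/= l hl] := normed_cvg h.
apply/cvg_ex; exists (u 0%N + l).
have : (fun n => u 0%N + series (telescope u) n) @ \oo --> u 0%N + l.
  by apply: cvgD => //; exact: cvg_cst.
rewrite (_ : (fun _ => _) = u)//.
by apply/funext => n; rewrite -eq_sum_telescope.
Qed.

(** * Completeness of L^q along rapidly Cauchy sequences *)

Section Lq_complete.
Context {R : realType} d (T : measurableType d) (mu : {measure set T -> \bar R}) (D : set T).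
Hypothesis mD : measurable D.
Local Notation intg f := (mu.-integrable D (EFin \o f)).
Variable q : R.
Hypothesis q1 : 1 < q.
Let q0 : 0 < q. Proof. by rewrite (lt_trans _ q1). Qed.

(** Chosen so that (2^j)^q c^j = 2^-j: the increments, even amplified by 2^j, have summable q-th
    power integrals. *)
Let c : R := (2 `^ (q + 1))^-1.
Let c0 : 0 < c. Proof. by rewrite invr_gt0 powR_gt0. Qed.

(** The sum [S] of the amplified q-th powers is integrable, hence finite almost everywhere; where it
    is finite, the j-th increment is at most 2^-j S^(1/q), so the sequence converges. Fatou gives
    the rate for the limit. *)
Lemma Lq_complete (f : (T -> R)^nat) :
  (forall k, measurable_fun D (f k)) ->
  (forall j k l, (j <= k)%N -> (j <= l)%N ->
    intg (fun x => `|f k x - f l x| `^ q) /\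
    \int[mu]_(x in D) `|f k x - f l x| `^ q <= c ^+ j) ->
  exists2 F : T -> R, measurable_fun D F & forall k,
    intg (fun x => `|f k x - F x| `^ q) /\ \int[mu]_(x in D) `|f k x - F x| `^ q <= c ^+ k.
Proof.
move=> mf fC.
pose h j x := (2 ^+ j * `|f j.+1 x - f j x|) `^ q.
have mh j : measurable_fun D (h j).
  apply: measurable_fun_powR => //; apply: measurable_funM => //.
  by apply: measurable_fun_normr => //; exact: measurable_funB.
have hE j x : h j x = (2 `^ q) ^+ j * `|f j.+1 x - f j x| `^ q.
  rewrite /h powRM ?exprn_ge0//; congr (_ * _).
  by rewrite -(powR_mulrn j (ler0n R 2)) -(powR_mulrn j (powR_ge0 _ _)) powRAC.
have h0 j x : 0 <= h j x by exact: powR_ge0.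
have h0' j x : (0 <= (h j x)%:E)%E by rewrite lee_fin.
have hint j : (\int[mu]_(x in D) (h j x)%:E <= (2^-1 ^+ j)%:E)%E.
  have [i1 i2] := fC j j.+1 j (leqnSn j) (leqnn j).
  under eq_integral do rewrite hE.
  rewrite (intg_EFin mD); last exact: intgZ.
  rewrite lee_fin RintegralZl//.
  have -> : (2^-1 : R) ^+ j = (2 `^ q) ^+ j * c ^+ j.
    rewrite -exprMn; congr (_ ^+ _); rewrite /c -powRN.
    by rewrite -powRD ?pnatr_eq0 ?implybT// opprD addNKr powR_inv1.
  by rewrite ler_wpM2l ?exprn_ge0 ?powR_ge0.
pose S x := (\sum_(0 <= j <oo) (h j x)%:E)%E.
have mS : measurable_fun D S.
  by apply: ge0_emeasurable_sum => // k _; exact/measurable_EFinP.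
have Sint : mu.-integrable D S.
  apply/integrableP; split => //.
  have -> : (\int[mu]_(x in D) `|S x| = \int[mu]_(x in D) S x)%E.
    apply: eq_integral => x Dx; rewrite gee0_abs//.
    by apply: nneseries_ge0 => n _ _; exact: h0'.
  rewrite integral_nneseries//; last by move=> n; exact/measurable_EFinP.
  apply: le_lt_trans (ltry 2).
  apply: (@le_trans _ _ (\sum_(0 <= j <oo) (2^-1 ^+ j)%:E)%E).
    apply: lee_nneseries => [n _|n _]; last exact: hint.
    by move=> _; apply: integral_ge0 => x _; exact: h0'.
  apply: lime_le; first by apply: is_cvg_nneseries => n _ _; rewrite lee_fin exprn_ge0.
  apply: nearW => n; rewrite sumEFin lee_fin.
  have := @geometric_le_lim R n 1 2^-1 ler01.
  rewrite (_ : 1 * (1 - 2^-1)^-1 = 2 :> R); last by field.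
  rewrite invr_gt0 ltr0n ger0_norm ?invr_ge0// invf_lt1 ?ltr1n// => /(_ isT isT).
  by apply: le_trans; rewrite /series/=; apply: ler_sum => i _; rewrite mul1r.
have aeE := integrable_ae mD Sint.
pose E := D `&` S @^-1` [set y | y \is a fin_num].
have mE : measurable E by exact: emeasurable_fin_num.
(* The sequence is set to 0 where [S] is infinite, so that it converges everywhere on [D] and the
   limit is measurable. *)
pose f' k x := \1_E x * f k x.
have f'cvg x : D x -> cvgn (f' ^~ x).
  move=> Dx; have [Ex|nEx] := pselect (E x); last first.
    rewrite /f' (_ : (fun k => _) = fun=> 0); first exact: is_cvg_cst.
    by apply/funext => k; rewrite indicE memNset// mul0r.
  rewrite /f' (_ : (fun k => _) = f ^~ x); last first.
    by apply/funext => k; rewrite indicE mem_set// mul1r.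
  apply: (@cvg_geometric_increments _ _ (fine (S x) `^ q^-1)) => j.
  have Sf : S x \is a fin_num by case: Ex.
  have hS : h j x <= fine (S x).
    rewrite -lee_fin fineK//.
    have := @nneseries_lim_ge _ (fun i => (h i x)%:E) xpredT 0%N j.+1
      (fun n _ _ => h0' n x); apply: le_trans.
    rewrite big_nat_recr//= leeDr//; apply: sume_ge0 => i _; exact: h0'.
  have a0 : 0 <= 2 ^+ j * `|f j.+1 x - f j x| by rewrite mulr_ge0.
  rewrite (_ : _ * _ = h j x `^ q^-1); last first.
    by rewrite /h -powRrM divff ?gt_eqF// powRr1.
  by apply: ge0_ler_powR; rewrite ?nnegrE ?invr_ge0 ?(ltW q0) ?h0// (le_trans (h0 j x)).
pose F x := limn (f' ^~ x).
have mf' k : measurable_fun D (f' k).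
  by apply: measurable_funM => //; exact: measurable_funS (measurable_indic mE).
have mF : measurable_fun D F by apply: (measurable_fun_cvg mf') => x Dx; exact: f'cvg.
exists F => // k.
have f'f m : ae_eq mu D (f' m) (f m).
  apply: filterS aeE => x /= H Dx; rewrite /f' indicE mem_set ?mul1r//.
  by split => //; exact: H.
have mkF m (G : T -> R) : measurable_fun D G -> measurable_fun D (fun x => `|f m x - G x| `^ q).
  move=> mG; apply: measurable_fun_powR => //; apply: measurable_fun_normr => //.
  exact: measurable_funB.
apply: (ge0_intg_bounded mD) => //; first exact: mkF.
(* Fatou along the indices l + k: the shift keeps both indices at least k, where the bound c^k is
   available. *)
have fat := @fatou _ _ _ mu D mD (fun l x => (`|f k x - f' (l + k)%N x| `^ q)%:E).
have -> : (\int[mu]_(x in D) (`|f k x - F x| `^ q)%:E =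
    \int[mu]_(x in D) limn_einf (fun l => (`|f k x - f' (l + k)%N x| `^ q)%:E))%E.
  apply: eq_integral => x /[!inE] Dx; apply/esym.
  have h1 : (fun l => (`|f k x - f' (l + k)%N x| `^ q)%:E) @ \oo --> (`|f k x - F x| `^ q)%:E.
    apply: cvg_EFin; first exact: nearW.
    have h2 : (fun l => f k x - f' (l + k)%N x) @ \oo --> f k x - F x.
      apply: cvgB; first exact: cvg_cst.
      by rewrite (cvg_shiftn k (f' ^~ x)); exact: f'cvg.
    exact: (cvg_comp _ _ h2 (@continuous_normr_powR _ _ q0 _)).
  by rewrite is_cvg_limn_einfE; [exact: cvg_lim|apply/cvg_ex; eexists; exact: h1].
apply: le_trans (fat _ _) _.
- by move=> n; apply/measurable_EFinP; exact: mkF.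
- by move=> n x _; rewrite lee_fin powR_ge0.
rewrite limn_einf_lim; apply: lime_le; first exact: is_cvg_einfs.
apply: nearW => n; apply: (@le_trans _ _ (\int[mu]_(x in D) (`|f k x - f' (n + k)%N x| `^ q)%:E)%E).
  by apply: ereal_inf_lbound; exists n => //=.
have [i1 i2] := fC k k (n + k)%N (leqnn k) (leq_addl n k).
rewrite -lee_fin -(intg_EFin mD i1) in i2; apply: le_trans i2.
rewrite le_eqVlt; apply/orP; left; apply/eqP; apply: ae_eq_integral => //.
- by apply/measurable_EFinP; exact: mkF.
- by apply/measurable_EFinP; exact: mkF.
- by apply: filterS (f'f (n + k)%N) => x /= H Dx; rewrite H.
Qed.

Lemma powR_sum_le n (a : 'I_n -> R) : (forall i, 0 <= a i) ->
  (\sum_i a i) `^ q <= (2 `^ q) ^+ n * \sum_i a i `^ q.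
Proof.
elim: n a => [|n ih] a a0; first by rewrite !big_ord0 mulr0 powR0// gt_eqF.
rewrite !big_ord_recl exprS -mulrA.
apply: le_trans (powR_double (ltW q0) (a0 _) _) _; first by rewrite sumr_ge0.
rewrite ler_wpM2l ?powR_ge0// mulrDr lerD//; last exact: ih.
rewrite ler_peMl ?powR_ge0// exprn_ege1// -[leLHS](powRr0 2).
by apply: ler_powR; rewrite ?ler1n// ltW.
Qed.

(** Completeness coordinate by coordinate; recombining the N limits into a Euclidean norm costs the
    factor C. *)
Lemma Lq_complete_rV N (g : (T -> 'rV[R]_N)^nat) :
  (forall k, measurable_fun D (g k)) ->
  (forall j k l, (j <= k)%N -> (j <= l)%N ->
    intg (fun x => euclid_norm (g k x - g l x) `^ q) /\
    \int[mu]_(x in D) euclid_norm (g k x - g l x) `^ q <= c ^+ j) ->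
  exists2 F : T -> 'rV[R]_N, measurable_fun D F & exists C : R, forall k,
    intg (fun x => euclid_norm (g k x - F x) `^ q) /\
    \int[mu]_(x in D) euclid_norm (g k x - F x) `^ q <= C * c ^+ k.
Proof.
move=> mg gC.
have comp_le (v : 'rV[R]_N) (i : 'I_N) : `|v ord0 i| `^ q <= euclid_norm v `^ q.
  by apply: ge0_ler_powR; rewrite ?nnegrE ?euclid_norm_ge0 ?(ltW q0) ?ler_coord_euclid_norm.
have mgi i k : measurable_fun D (fun x => g k x ord0 i).
  by move: i; apply/(measurable_fun_rVP mD).
have H i : exists2 F : T -> R, measurable_fun D F & forall k,
    intg (fun x => `|g k x ord0 i - F x| `^ q) /\
    \int[mu]_(x in D) `|g k x ord0 i - F x| `^ q <= c ^+ k.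
  apply: (@Lq_complete (fun k x => g k x ord0 i)); first exact: mgi.
  move=> j k l jk jl.
  have [i1 i2] := gC j k l jk jl.
  have le1 x : `|g k x ord0 i - g l x ord0 i| `^ q <= euclid_norm (g k x - g l x) `^ q.
    by have := comp_le (g k x - g l x) i; rewrite !mxE.
  have i3 : intg (fun x => `|g k x ord0 i - g l x ord0 i| `^ q).
    apply: (intg_le mD _ i1); last by move=> x _; rewrite ger0_norm ?powR_ge0.
    by apply: measurable_fun_powR => //; apply: measurable_fun_normr => //; apply: measurable_funB.
  split; first exact: i3.
  by apply: le_trans i2; exact: (le_Rintegral mD i3 i1 (fun x _ => le1 x)).
have /choice[F HF] : forall i, exists F : T -> R, measurable_fun D F /\ forall k,
    intg (fun x => `|g k x ord0 i - F x| `^ q) /\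
    \int[mu]_(x in D) `|g k x ord0 i - F x| `^ q <= c ^+ k.
  by move=> i; have [F mF hF] := H i; exists F.
exists (fun x => \row_i F i x).
  by apply/(measurable_fun_rVP mD) => i; under eq_fun do rewrite mxE; case: (HF i).
have sum_int k : intg (fun x => \sum_i `|g k x ord0 i - F i x| `^ q) /\
    \int[mu]_(x in D) (\sum_i `|g k x ord0 i - F i x| `^ q) <= (size (index_enum 'I_N))%:R * c ^+ k.
  have : forall s : seq 'I_N, intg (fun x => \sum_(i <- s) `|g k x ord0 i - F i x| `^ q) /\
    \int[mu]_(x in D) (\sum_(i <- s) `|g k x ord0 i - F i x| `^ q) <= (size s)%:R * c ^+ k.
    elim=> [|i s [ih1 ih2]].
      have e : (fun x => \sum_(i <- [::]) `|g k x ord0 i - F i x| `^ q) = (fun=> 0).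
        by apply/funext => x; rewrite big_nil.
      rewrite e; split; first exact: integrable0.
      by rewrite /Rintegral integral0 mul0r.
    have e : (fun x => \sum_(i <- i :: s) `|g k x ord0 i - F i x| `^ q) =
        (fun x => `|g k x ord0 i - F i x| `^ q + \sum_(i <- s) `|g k x ord0 i - F i x| `^ q).
      by apply/funext => x; rewrite big_cons.
    have [_ /(_ k)[i1 i2]] := HF i.
    rewrite e; split; first exact: intgD.
    by rewrite RintegralD// /= -natr1 mulrDl mul1r addrC lerD.
  by move=> /(_ (index_enum 'I_N)).
exists ((2 `^ q) ^+ N * (size (index_enum 'I_N))%:R) => k; have [s1 s2] := sum_int k.
have le1 x : euclid_norm (g k x - \row_i F i x) `^ q <=
    (2 `^ q) ^+ N * \sum_i `|g k x ord0 i - F i x| `^ q.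
  have := powR_sum_le (fun i => normr_ge0 ((g k x - \row_i F i x) ord0 i)).
  under [X in _ <= _ * X]eq_bigr do rewrite !mxE; apply: le_trans.
  by apply: ge0_ler_powR; rewrite ?nnegrE ?euclid_norm_ge0 ?(ltW q0) ?sumr_ge0 ?euclid_norm_le_sum.
have i3 : intg (fun x => (2 `^ q) ^+ N * \sum_i `|g k x ord0 i - F i x| `^ q) by exact: intgZ.
have i4 : intg (fun x => euclid_norm (g k x - \row_i F i x) `^ q).
  apply: (intg_le mD _ i3); last by move=> x _; rewrite ger0_norm ?powR_ge0.
  apply: measurable_fun_powR => //; apply: measurable_euclid_norm => //.
  apply: measurable_rVB => //; apply/(measurable_fun_rVP mD) => i.
  by under eq_fun do rewrite mxE; case: (HF i).
split => //; apply: (le_trans (le_Rintegral mD i4 i3 (fun x _ => le1 x))).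
by rewrite RintegralZl// -mulrA ler_wpM2l ?exprn_ge0 ?powR_ge0.
Qed.

End Lq_complete.

(** * The variational problem *)

Section real_max.
Context {R : realType}.
Implicit Types a b : R.

Lemma add_maxrB a b : b + Num.max (a - b) 0 = Num.max a b.
Proof.
by have [ab|/ltW ab] := leP a b; [rewrite max_r ?subr_le0// addr0|rewrite max_l ?subr_ge0// addrC subrK].
Qed.

Lemma sub_maxrB a b : a - Num.max (a - b) 0 = Num.min a b.
Proof.
by have [ab|/ltW ab] := leP a b; [rewrite max_r ?subr_le0// subr0|rewrite max_l ?subr_ge0// opprB addrC subrK].
Qed.

End real_max.

Fact rint_key : unit. Proof. exact: tt. Qed.

(* A locked copy of the real-valued integral: without the lock, unification
   unfolds integrals. *)
Definition rint {R : realType} d (T : measurableType d) (mu : {measure set T -> \bar R})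
  (D : set T) : (T -> R) -> R := locked_with rint_key (Rintegral mu D).

Section rint.
Context {R : realType} d (T : measurableType d) (mu : {measure set T -> \bar R}) (D : set T).
Hypothesis mD : measurable D.
Local Notation intg f := (mu.-integrable D (EFin \o f)).
Implicit Types f g : T -> R.

Lemma rintE f : rint mu D f = \int[mu]_(x in D) f x.
Proof. by rewrite /rint unlock. Qed.

Lemma rintD f g : intg f -> intg g ->
  rint mu D (fun x => f x + g x) = rint mu D f + rint mu D g.
Proof. by move=> fi gi; rewrite !rintE RintegralD. Qed.

Lemma rintB f g : intg f -> intg g ->
  rint mu D (fun x => f x - g x) = rint mu D f - rint mu D g.
Proof. by move=> fi gi; rewrite !rintE RintegralB. Qed.

Lemma rintZ c f : intg f -> rint mu D (fun x => c * f x) = c * rint mu D f.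
Proof. by move=> fi; rewrite !rintE RintegralZl. Qed.

Lemma rint_le f g : intg f -> intg g -> (forall x, D x -> f x <= g x) ->
  rint mu D f <= rint mu D g.
Proof. by move=> fi gi fg; rewrite !rintE; exact: (le_Rintegral mD fi gi fg). Qed.

Lemma rint_ge0 f : (forall x, D x -> 0 <= f x) -> 0 <= rint mu D f.
Proof. by move=> f0; rewrite rintE; exact: Rintegral_ge0. Qed.

Lemma eq_rint f g : (forall x, D x -> f x = g x) -> rint mu D f = rint mu D g.
Proof. by move=> fg; rewrite !rintE; apply: eq_Rintegral => x /[!inE]; exact: fg. Qed.

Lemma rint_cst (c : R) : rint mu D (fun=> c) = c * fine (mu D).
Proof. by rewrite rintE Rintegral_cst. Qed.

End rint.

(** Makes the tolerances of a Cauchy criterion nonincreasing, so that the j-th almost minimizer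
    meets every earlier tolerance as well. *)
Fixpoint running_min {R : realType} (r : R^nat) (j : nat) : R :=
  if j is i.+1 then Num.min (running_min r i) (r j) else r 0%N.

Lemma running_min_gt0 {R : realType} (r : R^nat) j : (forall i, 0 < r i) -> 0 < running_min r j.
Proof. by move=> r0; elim: j => //= j ih; rewrite lt_min ih r0. Qed.

Lemma running_min_le {R : realType} (r : R^nat) i j : (i <= j)%N -> running_min r j <= r i.
Proof.
elim: j => [|j ih]; first by rewrite leqn0 => /eqP ->.
rewrite leq_eqVlt => /predU1P[->|ij]; first by rewrite /= ge_min lexx orbT.
by rewrite /= ge_min ih.
Qed.

(** * Minimization in an abstract space of pairs (u, g) *)

Section variational.
Context {R : realType} d (T : measurableType d) (mu : {measure set T -> \bar R}) (D : set T).
Hypothesis mD : measurable D.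
Hypothesis finD : (mu D < +oo)%E.
Local Notation intg f := (mu.-integrable D (EFin \o f)).
Local Notation "'I' f" := (rint mu D f) (at level 10, f at level 9).
Variables (N : nat) (q : R).
Hypothesis q1 : 1 < q.
Implicit Types (u w psi : T -> R) (g k h : T -> 'rV[R]_N).

Let q0 : 0 < q. Proof. by rewrite (lt_trans _ q1). Qed.

Definition normq : (T -> 'rV[R]_N) -> T -> R :=
  locked_with rint_key (fun g x => euclid_norm (g x) `^ q).

Lemma normqE g x : normq g x = euclid_norm (g x) `^ q.
Proof. by rewrite /normq unlock. Qed.

Lemma normq_fun g : normq g = fun x => euclid_norm (g x) `^ q.
Proof. by apply/funext => x; exact: normqE. Qed.

Definition fluxq : (T -> 'rV[R]_N) -> (T -> 'rV[R]_N) -> T -> R :=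
  locked_with rint_key (fun g h x => flux q (g x) (h x)).

Lemma fluxqE g h x : fluxq g h x = flux q (g x) (h x).
Proof. by rewrite /fluxq unlock. Qed.

Lemma normq_ge0 g x : 0 <= normq g x. Proof. by rewrite normqE powR_ge0. Qed.

Lemma measurable_normq g : measurable_fun D g -> measurable_fun D (normq g).
Proof.
rewrite /normq unlock.
by move=> mg; apply: measurable_fun_powR => //; exact: measurable_euclid_norm.
Qed.

Lemma intg_flux g h : measurable_fun D g -> measurable_fun D h ->
  intg (normq g) -> intg (normq h) -> intg (fluxq g h).
Proof.
move=> mg mh ig ih; apply: (intg_le mD _ (intgD mD ig ih)) => [|x _].
  by rewrite /fluxq unlock; exact: measurable_flux.
rewrite fluxqE !normqE.
apply: le_trans (flux_norm_bound _ _ _) _.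
have := powR_young_split q1 (euclid_norm_ge0 (g x)) (euclid_norm_ge0 (h x)) ltr01.
by rewrite powR1 !mul1r.
Qed.

Lemma intg_powR1 u : measurable_fun D u -> intg (fun x => `|u x| `^ q) -> intg u.
Proof.
move=> mu_ iu; apply: (intg_le mD mu_ (intgD mD (intg_cst mD 1 finD) iu)) => x _.
have := powR_young_split q1 ler01 (normr_ge0 (u x)) ltr01.
by rewrite !powR1 !mul1r.
Qed.

Lemma intg_normqD g k : measurable_fun D g -> measurable_fun D k ->
  intg (normq g) -> intg (normq k) -> intg (normq (fun x => g x + k x)).
Proof.
move=> mg mk ig ik; apply: (intg_le mD _ (intgZ mD (2 `^ q) (intgD mD ig ik))) => [|x _].
  by apply: measurable_normq; exact: measurable_rVD.
by rewrite ger0_norm ?normq_ge0// !normqE; exact: euclid_norm_powR_double.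
Qed.

(* [W] plays the role of W_0^{1,q}, and [v], with gradient [gam], that of the
   supersolution. *)
Variable W : (T -> R) -> (T -> 'rV[R]_N) -> Prop.
Hypothesis Wmu : forall u g, W u g -> measurable_fun D u.
Hypothesis Wmg : forall u g, W u g -> measurable_fun D g.
Hypothesis Wiu : forall u g, W u g -> intg (fun x => `|u x| `^ q).
Hypothesis Wig : forall u g, W u g -> intg (normq g).
Hypothesis W0 : W (fun=> 0) (fun=> 0).
Hypothesis Wlin : forall a u g w k, W u g -> W w k ->
  W (fun x => u x + a * w x) (fun x => g x + a *: k x).
Hypothesis Wclosed : forall u g, measurable_fun D u -> measurable_fun D g ->
  (forall e, 0 < e -> exists w k, [/\ W w k,
    intg (fun x => `|w x - u x| `^ q), intg (normq (fun x => k x - g x)) &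
    I (fun x => `|w x - u x| `^ q) <= e /\ I (normq (fun x => k x - g x)) <= e]) ->
  W u g.
Hypothesis Wpos : forall u g, W u g ->
  W (fun x => Num.max (u x) 0) (fun x => if 0 < u x then g x else 0).

Variables (v : T -> R) (gam : T -> 'rV[R]_N) (L c : R).
Hypothesis mv : measurable_fun D v.
Hypothesis mgam : measurable_fun D gam.
Hypothesis igam : intg (normq gam).
Hypothesis L0 : 0 <= L.
Hypothesis v0 : forall x, D x -> 0 < v x.
Hypothesis vL : forall x, D x -> v x <= L.
Hypothesis Wtrunc : forall u g, W u g ->
  W (fun x => Num.max (u x - v x) 0) (fun x => if v x < u x then g x - gam x else 0).
(** Weak form of c <= - L_q v. The same c bounds f in [fc], so v is a supersolution whatever
    argument f is evaluated at. *)
Hypothesis supersol : forall psi h, W psi h -> (forall x, D x -> 0 <= psi x) ->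
  c * I psi <= I (fluxq gam h).

Variables (f F : R -> R).
Hypothesis mf : measurable_fun setT f.
Hypothesis mF : measurable_fun setT F.
Hypothesis F0 : F 0 = 0.
(** f is a subgradient of F. This stands in for F' = f, as F is not assumed differentiable. *)
Hypothesis Fsub : forall s t, f s * (t - s) <= F t - F s.
Hypothesis f1 : forall t, 1 <= f t.
Hypothesis fc : forall t, f t <= c.

(** Nonnegative elements of W that together reach every point of [D]. The family is countable so
    that statements holding almost everywhere for each of them can be combined. *)
Variables (eta : nat -> T -> R) (kap : nat -> T -> 'rV[R]_N).
Hypothesis Weta : forall i, W (eta i) (kap i).
Hypothesis eta0 : forall i x, D x -> 0 <= eta i x.
Hypothesis etaD : forall x, D x -> exists i, 0 < eta i x.

Let c0 : 0 < c. Proof. exact: lt_le_trans (le_trans (f1 0) (fc 0)). Qed.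

Let Wint u g : W u g -> intg u.
Proof. by move=> Wu; apply: intg_powR1; [exact: Wmu Wu|exact: Wiu Wu]. Qed.

Let F_lip s t : `|F t - F s| <= c * `|t - s|.
Proof.
have h := Fsub s t; have h' := Fsub t s; have fs := fc s; have ft := fc t.
have fs1 := f1 s; have ft1 := f1 t.
have [st|st] := leP s t.
  by rewrite (ger0_norm (_ : 0 <= t - s)) ?subr_ge0// ler_norml; apply/andP; split; nra.
by rewrite (ltr0_norm (_ : t - s < 0)) ?subr_lt0// ler_norml; apply/andP; split; nra.
Qed.

Let F_incr s t : s <= t -> t - s <= F t - F s.
Proof. by move=> st; have h := Fsub s t; have fs1 := f1 s; nra. Qed.

Let intgF u : measurable_fun D u -> intg u -> intg (fun x => F (u x)).
Proof.
move=> mu_ iu; apply: (intg_le mD _ (intgZ mD c (intg_norm mD iu))) => [|x _].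
  exact: (measurableT_comp mF mu_).
by have := F_lip 0 (u x); rewrite F0 !subr0.
Qed.

Let WintF u g : W u g -> intg (fun x => F (u x)).
Proof. by move=> Wu; apply: intgF; [exact: Wmu Wu|exact: Wint Wu]. Qed.

Definition energy u g : R := I (normq g) / q - I (fun x => F (u x)).

Let WD u g w k : W u g -> W w k -> W (fun x => u x + w x) (fun x => g x + k x).
Proof.
move=> Wu Ww; have := Wlin 1 Wu Ww; congr W.
  by apply/funext => x; rewrite mul1r.
by apply/funext => x; rewrite scale1r.
Qed.

Let WB u g w k : W u g -> W w k -> W (fun x => u x - w x) (fun x => g x - k x).
Proof.
move=> Wu Ww; have := Wlin (- 1) Wu Ww; congr W.
  by apply/funext => x; rewrite mulN1r.
by apply/funext => x; rewrite scaleN1r.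
Qed.

Let WZ a u g : W u g -> W (fun x => a * u x) (fun x => a *: g x).
Proof.
move=> Wu; have := Wlin a W0 Wu; congr W.
  by apply/funext => x; rewrite add0r.
by apply/funext => x; rewrite add0r.
Qed.

(** max(u, w) = w + (u - w)^+ and min(u, w) = u - (u - w)^+, so stability under linear combinations
    and positive parts gives both lattice operations. On the set u = w the maximum takes the
    gradient of w and the minimum that of u. *)
Let Wmax u g w k : W u g -> W w k ->
  W (fun x => Num.max (u x) (w x)) (fun x => if w x < u x then g x else k x).
Proof.
move=> Wu Ww; have := WD Ww (Wpos (WB Wu Ww)); congr W; apply/funext => x /=.
  exact: add_maxrB.
by rewrite subr_gt0; case: ifP => _; rewrite ?addr0// addrC subrK.
Qed.

Let Wmin u g w k : W u g -> W w k ->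
  W (fun x => Num.min (u x) (w x)) (fun x => if w x < u x then k x else g x).
Proof.
move=> Wu Ww; have := WB Wu (Wpos (WB Wu Ww)); congr W; apply/funext => x /=.
  exact: sub_maxrB.
by rewrite subr_gt0; case: ifP => _; rewrite ?subr0// opprB addrC subrK.
Qed.

Let Wmid u g w k : W u g -> W w k ->
  W (fun x => (u x + w x) / 2) (fun x => 2^-1 *: (g x + k x)).
Proof.
move=> Wu Ww; have := WZ 2^-1 (WD Wu Ww); congr W.
by apply/funext => x; rewrite mulrC.
Qed.

(** At each point the pairs of the maximum and of the minimum are the two given pairs in some
    order. *)
Let energy_maxmin u g w k : W u g -> W w k ->
  energy (fun x => Num.max (u x) (w x)) (fun x => if w x < u x then g x else k x) +
  energy (fun x => Num.min (u x) (w x)) (fun x => if w x < u x then k x else g x) =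
  energy u g + energy w k.
Proof.
move=> Wu Ww; have Wma := Wmax Wu Ww; have Wmi := Wmin Wu Ww; rewrite /energy.
have e1 : I (normq (fun x => if w x < u x then g x else k x)) +
    I (normq (fun x => if w x < u x then k x else g x)) = I (normq g) + I (normq k).
  rewrite -rintD; [|exact: mD|exact: Wig Wma|exact: Wig Wmi].
  rewrite -rintD; [|exact: mD|exact: Wig Wu|exact: Wig Ww].
  by apply: eq_rint => x _; rewrite !normqE; case: ifP => _; [by []|exact: addrC].
have e2 : I (fun x => F (Num.max (u x) (w x))) + I (fun x => F (Num.min (u x) (w x))) =
    I (fun x => F (u x)) + I (fun x => F (w x)).
  rewrite -rintD; [|exact: mD|exact: WintF Wma|exact: WintF Wmi].
  rewrite -rintD; [|exact: mD|exact: WintF Wu|exact: WintF Ww].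
  by apply: eq_rint => x _; rewrite /Order.max /Order.min; case: ifP => _; [exact: addrC|by []].
have -> : forall a b a' b' : R, a / q - b + (a' / q - b') = (a + a') / q - (b + b').
  by move=> *; ring.
by rewrite e1 e2; ring.
Qed.

Definition clipped u := forall x, D x -> 0 <= u x <= v x.

(** Taking the positive part erases gradient, and F is increasing because f >= 1. *)
Let energy_pos u g : W u g ->
  energy (fun x => Num.max (u x) 0) (fun x => if 0 < u x then g x else 0) <= energy u g.
Proof.
move=> Wu; have Wp := Wpos Wu; rewrite /energy; apply: lerB.
  rewrite ler_pM2r ?invr_gt0//; apply: (rint_le mD); [exact: Wig Wp|exact: Wig Wu|].
  move=> x _; rewrite !normqE; case: ifP => _//.
  by rewrite euclid_norm0 powR0 ?gt_eqF// powR_ge0.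
apply: (rint_le mD); [exact: WintF Wu|exact: WintF Wp|move=> x _].
have : u x <= Num.max (u x) 0 by rewrite le_max lexx.
by move=> H; have := F_incr H; lra.
Qed.

(** The test function is w = (u - v)^+. Where v < u the truncated gradient is that of v, so the
    tangent inequality at [gam] shows that the gradient term drops by at least the integral of the
    flux of [gam] against [k]. By [supersol] this is at least c times the integral of w, and F loses
    at most that much, being c-Lipschitz. *)
Let energy_trunc u g : W u g ->
  energy (fun x => u x - Num.max (u x - v x) 0)
         (fun x => g x - (if v x < u x then g x - gam x else 0)) <= energy u g.
Proof.
move=> Wu; have Wt := Wtrunc Wu; have Wd := WB Wu Wt.
set w := (fun x => Num.max (u x - v x) 0) in Wt Wd *.
set k := (fun x => if v x < u x then g x - gam x else 0) in Wt Wd *.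
have ss := supersol Wt; have /ss {}ss : forall x, D x -> 0 <= w x.
  by move=> x _; rewrite le_max lexx orbT.
have iflux : intg (fluxq gam k).
  by apply: intg_flux; [exact: mgam|exact: Wmg Wt|exact: igam|exact: Wig Wt].
have ha : q * I (fluxq gam k) <=
    I (normq g) - I (normq (fun x => g x - k x)).
  rewrite -rintB; [|exact: mD|exact: Wig Wu|exact: Wig Wd].
  rewrite -rintZ; [|exact: mD|exact: iflux].
  apply: (rint_le mD); [exact: intgZ| |].
    by apply: (intgB mD); [exact: Wig Wu|exact: Wig Wd].
  move=> x _; rewrite fluxqE !normqE /k; case: ifP => _; last by rewrite flux0r mulr0 !subr0 subrr.
  by rewrite subKr; exact: flux_tangent.
have hb : I (fun x => F (u x)) - I (fun x => F (u x - w x)) <= c * I w.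
  rewrite -rintB; [|exact: mD|exact: WintF Wu|exact: WintF Wd].
  rewrite -rintZ; [|exact: mD|exact: Wint Wt].
  apply: (rint_le mD); [ |by apply: (intgZ mD); exact: Wint Wt|].
    by apply: (intgB mD); [exact: WintF Wu|exact: WintF Wd].
  move=> x _; have := F_lip (u x - w x) (u x); have : 0 <= w x by rewrite le_max lexx orbT.
  move=> w0; rewrite subKr (ger0_norm w0) => H.
  exact: le_trans (ler_norm _) H.
have : I (fluxq gam k) <=
    (I (normq g) - I (normq (fun x => g x - k x))) / q.
  by rewrite ler_pdivlMr// mulrC.
by rewrite /energy -/w -/k mulrBl; lra.
Qed.

Let clip u g : W u g -> exists u' g', [/\ W u' g', clipped u' & energy u' g' <= energy u g].
Proof.
move=> Wu; have Wp := Wpos Wu; have Wt := Wtrunc Wp; have Wd := WB Wp Wt.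
do 2 eexists; split; [exact: Wd| |exact: le_trans (energy_trunc Wp) (energy_pos Wu)].
by move=> x Dx; rewrite sub_maxrB le_min le_max lexx orbT (ltW (v0 Dx)) ge_min lexx orbT.
Qed.

Let muD : R := fine (mu D).
Let muD0 : 0 <= muD. Proof. exact: fine_ge0. Qed.

Let clipped_bound u x : clipped u -> D x -> 0 <= u x <= L.
Proof. by move=> cu Dx; have /andP[-> /= h] := cu x Dx; exact: le_trans (vL Dx). Qed.

Let clipped_rint u g : W u g -> clipped u -> 0 <= I u <= L * muD.
Proof.
move=> Wu cu; apply/andP; split.
  by apply: rint_ge0 => x Dx; have /andP[] := clipped_bound cu Dx.
rewrite -(rint_cst mu mD); apply: (rint_le mD); [exact: Wint Wu|exact: (intg_cst mD)|].
by move=> x Dx; have /andP[] := clipped_bound cu Dx.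
Qed.

Let clipped_rintF u g : W u g -> clipped u -> I (fun x => F (u x)) <= c * L * muD.
Proof.
move=> Wu cu; rewrite -(rint_cst mu mD).
apply: (rint_le mD); [exact: WintF Wu|exact: (intg_cst mD)|].
move=> x Dx; have /andP[u0 uL] := clipped_bound cu Dx.
have := F_lip 0 (u x); rewrite F0 !subr0 (ger0_norm u0) => h.
apply: le_trans (le_trans (ler_norm _) h) _; by rewrite ler_pM2l.
Qed.

Let S : set R := [set e | exists u g, [/\ W u g, clipped u & e = energy u g]].

Let S_lb : lbound S (- (c * L * muD)).
Proof.
move=> _ [u [g [Wu cu ->]]]; rewrite /energy.
have := clipped_rintF Wu cu.
have : 0 <= I (normq g) / q.
  by rewrite divr_ge0 ?(ltW q0)//; apply: rint_ge0 => x _; exact: normq_ge0.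
lra.
Qed.

Let S_inf : has_inf S.
Proof.
split; last by exists (- (c * L * muD)); exact: S_lb.
exists (energy (fun=> 0) (fun=> 0)), (fun=> 0), (fun=> 0); split; [exact: W0| |by []].
by move=> x Dx; rewrite lexx ltW// v0.
Qed.

Let m : R := inf S.

(** The infimum is taken over clipped pairs, where boundedness of u bounds the energy from below; by
    [clip] it is a lower bound on all of W. *)
Let m_le u g : W u g -> m <= energy u g.
Proof.
move=> Wu; have [u' [g' [Wu' cu' le]]] := clip Wu; apply: le_trans le.
by apply: ge_inf; [exact: S_inf.2|exists u', g'].
Qed.

Let m_approx e : 0 < e -> exists u g, [/\ W u g, clipped u & energy u g <= m + e].
Proof.
move=> e0; have [_ [u [g [Wu cu ->]]] lt] := inf_adherent e0 S_inf.
by exists u, g; split => //; exact: ltW.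
Qed.

(** The supremum [s0] of this set is the limit, as e tends to 0, of the supremum of the integrals of
    clipped pairs with energy at most m + e. *)
Let P : set R := [set s | forall e, 0 < e -> exists u g,
  [/\ W u g, clipped u, energy u g <= m + e & s <= I u]].

Let P_sup : has_sup P.
Proof.
split.
  exists 0 => e e0; have [u [g [Wu cu le]]] := m_approx e0.
  by exists u, g; split => //; have /andP[] := clipped_rint Wu cu.
exists (L * muD) => s /(_ 1 ltr01)[u [g [Wu cu _ su]]].
by apply: le_trans su _; have /andP[] := clipped_rint Wu cu.
Qed.

Let s0 : R := sup P.

Definition good e u g := [/\ W u g, clipped u, energy u g <= m + e & s0 - e <= I u].

Let good_ex e : 0 < e -> exists u g, good e u g.
Proof.
move=> e0; have [s Ps lt] := sup_adherent e0 P_sup.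
have [u [g [Wu cu le su]]] := Ps _ e0.
by exists u, g; split => //; exact: le_trans (ltW lt) su.
Qed.

Let good_le e e' u g : e <= e' -> good e u g -> good e' u g.
Proof. by move=> ee' [Wu cu le si]; split => //; lra. Qed.

Let s0_upper e : 0 < e -> exists2 e', 0 < e' &
  forall u g, W u g -> clipped u -> energy u g <= m + e' -> I u <= s0 + e.
Proof.
move=> e0; apply: contrapT => H.
suff /(sup_upper_bound P_sup) : P (s0 + e) by rewrite -/s0; lra.
move=> e' e'0; apply: contrapT => H'; apply: H; exists e' => // u g Wu cu le.
rewrite leNgt; apply/negP => lt; apply: H'; exists u, g; split => //.
exact: ltW.
Qed.

Let rint_normq_bound u g : W u g -> clipped u -> energy u g <= m + 1 ->
  I (normq g) <= q * (m + 1 + c * L * muD).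
Proof.
move=> Wu cu; rewrite /energy => le; have := clipped_rintF Wu cu => Fle.
rewrite -[leLHS](divfK (lt0r_neq0 q0)) mulrC ler_pM2l//; lra.
Qed.

Let intg_powB u g w k : W u g -> W w k -> intg (fun x => `|u x - w x| `^ q).
Proof. by move=> Wu Ww; exact: Wiu (WB Wu Ww). Qed.

(* The maximum of two almost minimizers is one as well, by
   [energy_maxmin]; so its integral does not exceed s0 by much. *)
Let good_dist1 e : 0 < e -> exists2 e', 0 < e' <= e & forall u g w k,
  good e' u g -> good e' w k -> I (fun x => `|u x - w x|) <= 4 * e.
Proof.
(* The minimum of the two has energy at least m, so the maximum has energy at most m + 2 e'; hence
   e1 / 2. *)
move=> e0; have [e1 e10 H] := s0_upper e0; exists (Num.min e (e1 / 2)).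
  by rewrite lt_min e0 divr_gt0// ge_min lexx.
move=> u g w k [Wu cu uE us] [Ww cw wE ws].
set e' := Num.min e (e1 / 2) in uE us wE ws.
have e'e : e' <= e by rewrite ge_min lexx.
have e'1 : e' <= e1 / 2 by rewrite ge_min lexx orbT.
have Wma := Wmax Wu Ww; have Wmi := Wmin Wu Ww.
have := energy_maxmin Wu Ww; have := m_le Wmi => h1 h2.
have : I (fun x => Num.max (u x) (w x)) <= s0 + e.
  apply: (H _ _ Wma); last lra.
  move=> x Dx; have /andP[u1 u2] := cu x Dx; have /andP[w1 w2] := cw x Dx.
  by rewrite le_max u1 ge_max u2.
(* |u - w| = 2 max(u, w) - (u + w), whose integral is at most 2 (s0 + e) - 2 (s0 - e') <= 4 e. *)
have -> : I (fun x => `|u x - w x|) = 2 * I (fun x => Num.max (u x) (w x)) - (I u + I w).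
  rewrite -rintD; [|exact: mD|exact: Wint Wu|exact: Wint Ww].
  rewrite -rintZ; [|exact: mD|exact: Wint Wma].
  rewrite -rintB; [|exact: mD|by apply: (intgZ mD); exact: Wint Wma|].
    apply: eq_rint => x _; have [uw|/ltW uw] := leP (u x) (w x).
      by rewrite distrC ger0_norm ?subr_ge0//; ring.
    by rewrite ger0_norm ?subr_ge0//; ring.
  by apply: (intgD mD); [exact: Wint Wu|exact: Wint Ww].
lra.
Qed.

Let rint_defect u g w k : W u g -> W w k ->
  intg (fun x => midpoint_defect q (g x) (k x)) /\
  I (fun x => midpoint_defect q (g x) (k x)) =
  (I (normq g) + I (normq k)) / 2 - I (normq (fun x => 2^-1 *: (g x + k x))).
Proof.
move=> Wu Ww; have Wm := Wmid Wu Ww.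
have i1 : intg (fun x => 2^-1 * (normq g x + normq k x)).
  by apply: (intgZ mD); apply: (intgD mD); [exact: Wig Wu|exact: Wig Ww].
have e : (fun x => midpoint_defect q (g x) (k x)) = (fun x =>
    2^-1 * (normq g x + normq k x) - normq (fun x => 2^-1 *: (g x + k x)) x).
  by apply/funext => x; rewrite !normqE /midpoint_defect mulrC.
rewrite e; split; first by apply: (intgB mD) => //; exact: Wig Wm.
rewrite rintB; [|exact: mD|exact: i1|exact: Wig Wm].
rewrite rintZ; [|exact: mD|by apply: (intgD mD); [exact: Wig Wu|exact: Wig Ww]].
rewrite rintD; [|exact: mD|exact: Wig Wu|exact: Wig Ww].
by rewrite mulrC.
Qed.

(** The midpoint has energy at least m, which bounds the convexity defect of the gradients by q
    times the sum of e and of what F loses at the midpoint. The midpoint lies at distance |u - w| /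
    2 from both functions, and F is c-Lipschitz. *)
Let energy_defect e u g w k : good e u g -> good e w k ->
  I (fun x => midpoint_defect q (g x) (k x)) <= q * (e + c / 2 * I (fun x => `|u x - w x|)).
Proof.
move=> [Wu cu uE us] [Ww cw wE ws]; have [_ ->] := rint_defect Wu Ww.
have Wm := Wmid Wu Ww; have mm := m_le Wm.
have iuw : intg (fun x => `|u x - w x|) by apply: (intg_norm mD); exact: Wint (WB Wu Ww).
have Fle (u' : T -> R) g' : W u' g' -> (forall x, `|u' x - (u x + w x) / 2| = 2^-1 * `|u x - w x|) ->
    I (fun x => F (u' x)) - I (fun x => F ((u x + w x) / 2)) <= c / 2 * I (fun x => `|u x - w x|).
  move=> Wu' hu'; rewrite -rintB; [|exact: mD|exact: WintF Wu'|exact: WintF Wm].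
  rewrite -rintZ; [|exact: mD|exact: iuw].
  apply: (rint_le mD); [|exact: (intgZ mD)|].
    by apply: (intgB mD); [exact: WintF Wu'|exact: WintF Wm].
  move=> x _; apply: le_trans (ler_norm _) (le_trans (F_lip _ _) _).
  by rewrite hu' mulrA.
have half (a : R) : `|2^-1 * a| = 2^-1 * `|a| by rewrite normrM ger0_norm ?invr_ge0.
have /(Fle _ _ Wu) h1 : forall x, `|u x - (u x + w x) / 2| = 2^-1 * `|u x - w x|.
  by move=> x; rewrite -half; congr `|_|; field.
have /(Fle _ _ Ww) h2 : forall x, `|w x - (u x + w x) / 2| = 2^-1 * `|u x - w x|.
  by move=> x; rewrite distrC -half; congr `|_|; field.
move: uE wE mm; rewrite /energy => uE wE mm.
rewrite -ler_pdivrMl// mulrC mulrBl (_ : _ / 2 / q = (I (normq g) / q + I (normq k) / q) / 2).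
  lra.
by ring.
Qed.

Let good_cauchy e : 0 < e -> exists2 e', 0 < e' & forall u g w k,
  good e' u g -> good e' w k ->
  I (fun x => `|u x - w x| `^ q) <= e /\ I (normq (fun x => g x - k x)) <= e.
Proof.
move=> e0; pose B := `|q * (m + 1 + c * L * muD)|.
have B0 : 0 <= B by exact: normr_ge0.
(* [B] bounds both integrals of |g|^q, so the first term of [uniform_convexity] contributes at most
   2 B e1 <= e / 2. *)
pose e1 := e / (4 * B + 1).
have e10 : 0 < e1 by rewrite divr_gt0// ltr_wpDl// mulr_ge0.
have [C C0 HC] := uniform_convexity N q1 e10.
have X1 : 0 <= 4 * L `^ (q - 1) by rewrite mulr_ge0// powR_ge0.
have X2 : 0 <= 2 * C * q * (1 + 2 * c) by rewrite !mulr_ge0 ?(ltW q0)// addr_ge0// mulr_ge0// ltW.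
(* Collects the factors of e2, the L^1 distance being at most 4 e2: L^(q-1) for the values, since |u
   - w| <= L, and C q (1 + 2 c) for the gradients, doubled because only e / 2 is left for it. *)
pose X := 4 * L `^ (q - 1) + 2 * C * q * (1 + 2 * c) + 1.
have X0 : 0 < X by rewrite ltr_wpDl// addr_ge0.
pose e2 := e / X; have e20 : 0 < e2 by rewrite divr_gt0.
have e2X : e2 * X = e by rewrite divfK// gt_eqF.
have [e3 /andP[e30 e32] H] := good_dist1 e20.
exists (Num.min 1 e3) => [|u g w k gu gw]; first by rewrite lt_min ltr01.
have {H}H := H u g w k (good_le _ gu) (good_le _ gw).
have /H {}H : Num.min 1 e3 <= e3 by rewrite ge_min lexx orbT.
have /H {}H : Num.min 1 e3 <= e3 by rewrite ge_min lexx orbT.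
have dE := energy_defect gu gw.
have [Wu cu uE us] := gu; have [Ww cw wE ws] := gw.
have min1 : Num.min 1 e3 <= 1 by rewrite ge_min lexx.
have min2 : Num.min 1 e3 <= e2 by apply: le_trans e32; rewrite ge_min lexx orbT.
have iuw : intg (fun x => `|u x - w x|) by apply: (intg_norm mD); exact: Wint (WB Wu Ww).
split.
  apply: (@le_trans _ _ (L `^ (q - 1) * I (fun x => `|u x - w x|))).
    rewrite -rintZ; [|exact: mD|exact: iuw].
    apply: (rint_le mD); [exact: intg_powB Wu Ww|exact: (intgZ mD)|move=> x Dx].
    rewrite -(mulr_powRB1 (normr_ge0 _) q0) mulrC ler_wpM2r//.
    apply: ge0_ler_powR; rewrite ?nnegrE ?subr_ge0 ?(ltW q1)//.
    have /andP[u1 u2] := clipped_bound cu Dx; have /andP[w1 w2] := clipped_bound cw Dx.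
    by rewrite ler_norml; apply/andP; split; lra.
  apply: le_trans (ler_wpM2l (powR_ge0 _ _) H) _.
  rewrite -e2X /X; have : 0 <= e2 * (2 * C * q * (1 + 2 * c)) by rewrite mulr_ge0// ltW.
  lra.
have [id1 id2] := rint_defect Wu Ww.
have gb := rint_normq_bound Wu cu (le_trans uE (lerD (lexx m) min1)).
have wb := rint_normq_bound Ww cw (le_trans wE (lerD (lexx m) min1)).
have BB : q * (m + 1 + c * L * muD) <= B by exact: ler_norm.
have i1 : intg (fun x => normq g x + normq k x).
  by apply: (intgD mD); [exact: Wig Wu|exact: Wig Ww].
apply: (@le_trans _ _ (e1 * (I (normq g) + I (normq k)) +
    C * I (fun x => midpoint_defect q (g x) (k x)))).
  rewrite -rintD; [|exact: mD|exact: Wig Wu|exact: Wig Ww].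
  rewrite -rintZ; [|exact: mD|exact: i1].
  rewrite -rintZ; [|exact: mD|exact: id1].
  rewrite -rintD; [|exact: mD|exact: (intgZ mD)|exact: (intgZ mD)].
  apply: (rint_le mD); [exact: Wig (WB Wu Ww)| |].
    by apply: (intgD mD); exact: (intgZ mD).
  by move=> x _; rewrite !normqE; exact: HC.
have h1 : e1 * (I (normq g) + I (normq k)) <= e / 2.
  apply: (@le_trans _ _ (e1 * (2 * B))); first by rewrite ler_pM2l//; lra.
  have : e1 * (4 * B + 1) = e by rewrite divfK// gt_eqF// ltr_wpDl// mulr_ge0.
  lra.
have h2 : C * I (fun x => midpoint_defect q (g x) (k x)) <= C * (q * (e2 + c / 2 * (4 * e2))).
  apply: ler_wpM2l => //; apply: le_trans dE _.
  rewrite ler_pM2l//; apply: lerD => //.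
  by apply: ler_wpM2l => //; rewrite divr_ge0// ltW.
have h3 : C * (q * (e2 + c / 2 * (4 * e2))) <= e / 2.
  have : e2 * (2 * C * q * (1 + 2 * c)) <= e2 * X by rewrite ler_pM2l// /X; lra.
  rewrite e2X; lra.
lra.
Qed.

(** Lower semicontinuity in quantitative form: the tangent inequality at G bounds |g|^q below, and
    its linear term is split by [powR_young_split] with parameter h. The values are handled by the
    Lipschitz bound on F and the same splitting. *)
Let energy_lsc U G : W U G -> (forall e, 0 < e -> exists u g, [/\ W u g, energy u g <= m + e,
    I (fun x => `|u x - U x| `^ q) <= e & I (normq (fun x => g x - G x)) <= e]) ->
  energy U G <= m.
Proof.
move=> WU H; apply/ler_addgt0Pr => e0 e00.
have nG0 : 0 <= I (normq G) by apply: rint_ge0 => x _; exact: normq_ge0.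
pose X := I (normq G) + c * muD.
have X0 : 0 <= X by rewrite addr_ge0// mulr_ge0// ltW.
(* h is fixed before the accuracy e, because the coefficient [Y] = h^(1-q) of the error blows up as
   h decreases. The terms in h and the terms in e each take at most e0 / 2. *)
pose h := e0 / (2 * (X + 1)).
have X1 : 0 < 2 * (X + 1) by rewrite mulr_gt0// ltr_wpDl.
have h0 : 0 < h by rewrite divr_gt0.
have hX : h * (2 * (X + 1)) = e0 by rewrite divfK// gt_eqF.
pose Y := h `^ (1 - q); have Y0 : 0 <= Y by exact: powR_ge0.
pose e := e0 / (2 * (1 + Y * (1 + c))).
have Yc : 0 <= Y * (1 + c) by rewrite mulr_ge0// addr_ge0// ltW.
have Y1 : 0 < 2 * (1 + Y * (1 + c)) by rewrite mulr_gt0// ltr_pwDl.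
have ep : 0 < e by rewrite divr_gt0.
have eY : e * (2 * (1 + Y * (1 + c))) = e0 by rewrite divfK// gt_eqF.
have [u [g [Wu uE duU dgG]]] := H _ ep.
have Wd := WB Wu WU.
have iuU : intg (fun x => `|u x - U x|) by apply: (intg_norm mD); exact: Wint Wd.
have hF : I (fun x => F (u x)) - I (fun x => F (U x)) <= c * (h * muD + Y * e).
  apply: (@le_trans _ _ (c * I (fun x => `|u x - U x|))).
    rewrite -rintB; [|exact: mD|exact: WintF Wu|exact: WintF WU].
    rewrite -rintZ; [|exact: mD|exact: iuU].
    apply: (rint_le mD); [|exact: (intgZ mD)|].
      by apply: (intgB mD); [exact: WintF Wu|exact: WintF WU].
    by move=> x _; apply: le_trans (ler_norm _) (F_lip _ _).
  rewrite ler_pM2l//.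
  apply: (@le_trans _ _ (h * muD + Y * I (fun x => `|u x - U x| `^ q))); last first.
    by rewrite lerD2l ler_wpM2l.
  rewrite -(rint_cst mu mD) -rintZ; [|exact: mD|exact: Wiu Wd].
  have ic := intg_cst mD h finD.
  have iz : intg (fun x => Y * `|u x - U x| `^ q) by apply: (intgZ mD); exact: Wiu Wd.
  rewrite -rintD; [|exact: mD|exact: ic|exact: iz].
  apply: (rint_le mD); [exact: iuU|exact: (intgD mD ic iz)|move=> x _].
  have := powR_young_split q1 ler01 (normr_ge0 (u x - U x)) h0.
  by rewrite !powR1 mul1r mulr1.
have hG : I (normq G) - q * (h * I (normq G) + Y * e) <= I (normq g).
  apply: (@le_trans _ _ (I (normq G) - q * (h * I (normq G) + Y * I (normq (fun x => g x - G x))))).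
    by rewrite lerD2l lerN2 ler_pM2l// lerD2l ler_wpM2l.
  have i1 : intg (fun x => h * normq G x + Y * normq (fun x => g x - G x) x).
    by apply: (intgD mD); apply: (intgZ mD); [exact: Wig WU|exact: Wig Wd].
  have e1 : h * I (normq G) + Y * I (normq (fun x => g x - G x)) =
      I (fun x => h * normq G x + Y * normq (fun x => g x - G x) x).
    rewrite rintD; [|exact: mD|by apply: (intgZ mD); exact: Wig WU|by apply: (intgZ mD); exact: Wig Wd].
    by rewrite (rintZ mD h (Wig WU)) (rintZ mD Y (Wig Wd)).
  rewrite e1 -rintZ; [|exact: mD|exact: i1].
  rewrite -rintB; [|exact: mD|exact: Wig WU|exact: (intgZ mD)].
  apply: (rint_le mD); [by apply: (intgB mD); [exact: Wig WU|exact: (intgZ mD)]|exact: Wig Wu|].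
  move=> x _; rewrite !normqE lerBlDl -lerBlDr.
  have := flux_tangent q1 (g x) (G x).
  have := le_trans (ler_norm _) (flux_norm_bound q (G x) (- (g x - G x))).
  rewrite fluxNr euclid_normN.
  have := powR_young_split q1 (euclid_norm_ge0 (G x)) (euclid_norm_ge0 (g x - G x)) h0.
  rewrite -/Y => h1 h2 h3.
  have : q * - flux q (G x) (g x - G x) <= q * (h * euclid_norm (G x) `^ q + Y * euclid_norm (g x - G x) `^ q).
    by rewrite ler_pM2l//; exact: le_trans h2 h1.
  lra.
rewrite /energy in uE *.
have hG' : I (normq G) / q - (h * I (normq G) + Y * e) <= I (normq g) / q.
  by rewrite ler_pdivlMr// mulrBl divfK ?gt_eqF// [X in _ - X]mulrC.
rewrite /X in hX; nra.
Qed.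

Let minimizer : exists U G, [/\ W U G, clipped U & energy U G <= m].
Proof.
(* The ratio that [Lq_complete] requires; the j-th Cauchy tolerance is r^j. *)
pose r : R := (2 `^ (q + 1))^-1.
have r0 : 0 < r by rewrite invr_gt0 powR_gt0.
have r1 : r < 1.
  rewrite invf_lt1 ?powR_gt0//; have := gt0_ltr_powR (_ : 0 < q + 1) _ _ (_ : 1 < 2 :> R).
  by rewrite powR1; apply; rewrite ?nnegrE ?addr_gt0 ?ltr1n.
have /choice[dl Hdl] : forall j, exists e', 0 < e' /\ forall u g w k,
    good e' u g -> good e' w k ->
    I (fun x => `|u x - w x| `^ q) <= r ^+ j /\ I (normq (fun x => g x - k x)) <= r ^+ j.
  by move=> j; have [e' e'0 H] := good_cauchy (exprn_gt0 j r0); exists e'.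
have dl0 j : 0 < running_min dl j by apply: running_min_gt0 => i; have [] := Hdl i.
have /choice[ug Hug] : forall j, exists ug : (T -> R) * (T -> 'rV[R]_N),
    good (Num.min (running_min dl j) (r ^+ j)) ug.1 ug.2.
  move=> j; have [|u [g gug]] := @good_ex (Num.min (running_min dl j) (r ^+ j)).
    by rewrite lt_min dl0 exprn_gt0.
  by exists (u, g).
have gug i j : (i <= j)%N -> good (dl i) (ug j).1 (ug j).2.
  by move=> ij; apply: good_le (Hug j); rewrite ge_min running_min_le.
have Wug j : W (ug j).1 (ug j).2 by have [] := Hug j.
have ugE j : energy (ug j).1 (ug j).2 <= m + r ^+ j.
  by have [_ _ le _] := Hug j; apply: le_trans le _; rewrite lerD2l ge_min lexx orbT.
have [U mU HU] : exists2 U : T -> R, measurable_fun D U & forall k : nat,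
    intg (fun x => `|(ug k).1 x - U x| `^ q) /\ I (fun x => `|(ug k).1 x - U x| `^ q) <= r ^+ k.
  have [|j k l jk jl|U mU HU] := @Lq_complete _ _ _ mu D mD q q1 (fun j => (ug j).1).
  - by move=> j; exact: Wmu (Wug j).
  - split; first exact: intg_powB (Wug k) (Wug l).
    by have [+ _] := (Hdl j).2 _ _ _ _ (gug _ _ jk) (gug _ _ jl); rewrite rintE.
  - by exists U => // k; rewrite rintE.
have [G mG [C HG]] : exists2 G : T -> 'rV[R]_N, measurable_fun D G & exists C : R, forall k : nat,
    intg (normq (fun x => (ug k).2 x - G x)) /\ I (normq (fun x => (ug k).2 x - G x)) <= C * r ^+ k.
  have [|j k l jk jl|G mG [C HG]] := @Lq_complete_rV _ _ _ mu D mD q q1 N (fun j => (ug j).2).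
  - by move=> j; exact: Wmg (Wug j).
  - have := Wig (WB (Wug k) (Wug l)).
    have [_] := (Hdl j).2 _ _ _ _ (gug _ _ jk) (gug _ _ jl).
    by rewrite rintE normq_fun.
  - by exists G => //; exists C => k; rewrite rintE normq_fun; exact: HG.
have small e : 0 < e -> exists j, [/\ r ^+ j <= e & C * r ^+ j <= e].
  move=> e0; have Cp : 0 < `|C| + 1 by rewrite ltr_wpDl.
  have [n Hn] := expr_lt_eps (ltW r0) r1 (divr_gt0 e0 Cp).
  exists n; have := Hn n (leqnn n); rewrite ler_pdivlMr// => h.
  have := exprn_gt0 n r0; have := ler_norm C; have := normr_ge0 C.
  split; nra.
have WUG : W U G.
  apply: (Wclosed mU mG) => e e0; have [j [j1 j2]] := small e e0.
  have [HU1 HU2] := HU j; have [HG1 HG2] := HG j.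
  by exists (ug j).1, (ug j).2; split => //; split; [exact: le_trans j1|exact: le_trans j2].
have UGE : energy U G <= m.
  apply: (energy_lsc WUG) => e e0; have [j [j1 j2]] := small e e0.
  have [HU1 HU2] := HU j; have [HG1 HG2] := HG j.
  exists (ug j).1, (ug j).2; split; [exact: Wug| |exact: le_trans j1|exact: le_trans j2].
  by apply: le_trans (ugE j) _; rewrite lerD2l.
(* An L^q limit respects the bounds 0 <= u <= v only almost everywhere; clipping once more restores
   them at every point of [D]. *)
have [U' [G' [WU' cU' le]]] := clip WUG.
by exists U', G'; split => //; exact: le_trans le UGE.
Qed.

(* Comparison of [U] with the competitor max(U, t eta_i). *)
Let minimizer_gt0 U G : W U G -> clipped U -> energy U G <= m ->
  {ae mu, forall x, D x -> 0 < U x}.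
Proof.
move=> WU cU UE.
pose z i x := if U x <= 0 then eta i x else 0.
have mz i : measurable_fun D (z i).
  apply: measurable_fun_ite => //; last exact: Wmu (Weta i).
  by apply: measurable_fun_ler => //; exact: Wmu WU.
have iz i : intg (z i).
  apply: (intg_le mD (mz i) (intg_norm mD (Wint (Weta i)))) => x _.
  by rewrite /z; case: ifP => _ //; rewrite normr0.
have z0 i x : D x -> 0 <= z i x by move=> Dx; rewrite /z; case: ifP => // _; exact: eta0.
have key i : I (z i) <= 0.
  rewrite leNgt; apply/negP => zp.
  pose B := I (normq (kap i)) / q.
  have B0 : 0 <= B.
    by rewrite divr_ge0 ?(ltW q0)//; apply: rint_ge0 => x _; exact: normq_ge0.
  (* Lifting gains at least t z in F pointwise, because f >= 1 and U <= 0 where z is not 0, and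
     costs at most t^q |kap|^q / q in the gradient term. *)
  have tz t : 0 < t -> I (z i) <= t `^ (q - 1) * B.
    move=> t0; have Wt := WZ t (Weta i); have Wm := Wmax Wt WU.
    have mm := m_le Wm.
    have h1 : t * I (z i) <= I (fun x => F (Num.max (t * eta i x) (U x))) - I (fun x => F (U x)).
      rewrite -rintZ; [|exact: mD|exact: iz].
      rewrite -rintB; [|exact: mD|exact: WintF Wm|exact: WintF WU].
      apply: (rint_le mD); [exact: (intgZ mD)| |].
        by apply: (intgB mD); [exact: WintF Wm|exact: WintF WU].
      move=> x Dx; apply: (@le_trans _ _ (Num.max (t * eta i x) (U x) - U x)); last first.
        by apply: F_incr; rewrite le_max lexx orbT.
      rewrite /z; case: ifPn => [U0|_]; last by rewrite mulr0 subr_ge0 le_max lexx orbT.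
      by rewrite lerBrDr le_max; apply/orP; left; rewrite gerDl.
    have h2 : I (normq (fun x => if U x < t * eta i x then t *: kap i x else G x)) <=
        I (normq G) + t `^ q * I (normq (kap i)).
      rewrite -rintZ; [|exact: mD|exact: Wig (Weta i)].
      have it : intg (fun x => t `^ q * normq (kap i) x) by apply: (intgZ mD); exact: Wig (Weta i).
      rewrite -rintD; [|exact: mD|exact: Wig WU|exact: it].
      apply: (rint_le mD); [exact: Wig Wm|by apply: (intgD mD) => //; exact: Wig WU|].
      move=> x _; rewrite !normqE; case: ifP => _.
        by rewrite euclid_normZ (gtr0_norm t0) powRM ?euclid_norm_ge0 ?(ltW t0)// lerDr powR_ge0.
      by rewrite lerDl mulr_ge0// powR_ge0.
    have h3 : t * I (z i) <= t `^ q * B.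
      have := le_trans UE mm; rewrite /energy => h4.
      have : I (normq (fun x => if U x < t * eta i x then t *: kap i x else G x)) / q <=
          I (normq G) / q + t `^ q * B.
        by rewrite /B mulrA -mulrDl ler_pM2r ?invr_gt0.
      lra.
    by move: h3; rewrite -(mulr_powRB1 (ltW t0) q0) -mulrA ler_pM2l.
  (* With t^(q-1) = y the bound reads: the integral of z is at most y B, whereas y B is less than
     half of it by the choice of y. *)
  pose y := I (z i) / (2 * (B + 1)).
  have B1 : 0 < 2 * (B + 1) by rewrite mulr_gt0// ltr_wpDl.
  have y0 : 0 < y by rewrite divr_gt0.
  have := tz (y `^ (q - 1)^-1) (powR_gt0 _ y0).
  rewrite -powRrM mulVf ?gt_eqF ?subr_gt0// powRr1 ?(ltW y0)//.
  have : y * (2 * (B + 1)) = I (z i) by rewrite divfK// gt_eqF.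
  nra.
have aez i : {ae mu, forall x, D x -> z i x = 0}.
  apply: (@ge0_Rintegral_le0 _ _ _ mu D mD (z i) (iz i) (z0 i)).
  by rewrite -rintE.
have /ae_foralln := aez; apply: filterS => x Hx Dx.
rewrite ltNge; apply/negP => Ux; have [i] := etaD Dx.
by have := Hx i Dx; rewrite /z Ux => ->; rewrite ltxx.
Qed.

Let f_bound u psi x : `|f (u x) * psi x| <= c * `|psi x|.
Proof.
rewrite normrM ler_wpM2r//; have := f1 (u x); have := fc (u x) => h h'.
by rewrite ger0_norm//; lra.
Qed.

Lemma intg_reaction u psi : measurable_fun D u -> intg psi -> intg (fun x => f (u x) * psi x).
Proof.
move=> mu_ ipsi; apply: (intg_le mD _ (intgZ mD c (intg_norm mD ipsi))) => [|x _]; last exact: f_bound.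
apply: measurable_funM; last exact: intg_measurable ipsi.
exact: (measurableT_comp mf mu_).
Qed.

(** Comparison with U + t psi. The tangent inequality for |.|^q is taken at the perturbed gradient G
    + t h and the one for F at U; both then point the right way, and division by t leaves only a
    limit of fluxes. The converse inequality comes from - psi. *)
Let euler_lagrange_le U G psi h : W U G -> energy U G <= m -> W psi h ->
  I (fun x => f (U x) * psi x) <= I (fluxq G h).
Proof.
move=> WU UE Wp.
have Wt t := Wlin t WU Wp.
have ifp : intg (fun x => f (U x) * psi x).
  by apply: intg_reaction; [exact: Wmu WU|exact: Wint Wp].
have iflux t : intg (fluxq (fun x => G x + t *: h x) h).
  by apply: intg_flux; [exact: Wmg (Wt t)|exact: Wmg Wp|exact: Wig (Wt t)|exact: Wig Wp].
have key t : 0 < t -> I (fun x => f (U x) * psi x) <= I (fluxq (fun x => G x + t *: h x) h).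
  move=> t0; have := le_trans UE (m_le (Wt t)); rewrite /energy => h1.
  have h2 : t * I (fun x => f (U x) * psi x) <=
      I (fun x => F (U x + t * psi x)) - I (fun x => F (U x)).
    rewrite -rintZ; [|exact: mD|exact: ifp].
    rewrite -rintB; [|exact: mD|exact: WintF (Wt t)|exact: WintF WU].
    apply: (rint_le mD); [exact: (intgZ mD)| |].
      by apply: (intgB mD); [exact: WintF (Wt t)|exact: WintF WU].
    move=> x _; have := Fsub (U x) (U x + t * psi x).
    by rewrite addrAC subrr add0r mulrCA.
  have h3 : I (normq (fun x => G x + t *: h x)) - I (normq G) <=
      (q * t) * I (fluxq (fun x => G x + t *: h x) h).
    rewrite -rintZ; [|exact: mD|exact: iflux].
    rewrite -rintB; [|exact: mD|exact: Wig (Wt t)|exact: Wig WU].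
    apply: (rint_le mD); [|exact: (intgZ mD)|].
      by apply: (intgB mD); [exact: Wig (Wt t)|exact: Wig WU].
    move=> x _; rewrite !normqE fluxqE.
    have := flux_tangent q1 (G x) (G x + t *: h x).
    by rewrite opprD addrA subrr add0r fluxNr fluxZr; lra.
  have h4 : (I (normq (fun x => G x + t *: h x)) - I (normq G)) / q <=
      t * I (fluxq (fun x => G x + t *: h x) h).
    by rewrite ler_pdivrMr// mulrC mulrA.
  rewrite -(ler_pM2l t0); move: h4; rewrite mulrBl; lra.
pose t (k : nat) : R := k.+1%:R^-1.
have t0 (k : nat) : 0 < t k by rewrite invr_gt0.
have tcvg : t @ \oo --> 0 by exact: cvg_harmonic.
have : I (fluxq (fun x => G x + t k *: h x) h) @[k --> \oo] --> I (fluxq G h).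
  rewrite rintE; under eq_cvg do rewrite rintE.
  (* Since t <= 1, |G + t h|^q <= 2^q (|G|^q + |h|^q); the last term comes from Young's inequality
     for the flux. *)
  pose dom x := 2 `^ q * (normq G x + normq h x) + normq h x.
  have idom : intg dom.
    apply: (intgD mD); last exact: Wig Wp.
    by apply: (intgZ mD); apply: (intgD mD); [exact: Wig WU|exact: Wig Wp].
  apply: (Rintegral_dominated_cvg mD _ _ _ idom) => [n||x Dx|n x Dx].
  - exact: intg_measurable (iflux (t n)).
  - by apply: intg_measurable; apply: intg_flux; [exact: Wmg WU|exact: Wmg Wp|exact: Wig WU|exact: Wig Wp].
  - by rewrite fluxqE; under eq_cvg do rewrite fluxqE; exact: flux_cvg.
  - rewrite fluxqE; apply: le_trans (flux_norm_bound _ _ _) _.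
    have := powR_young_split q1 (euclid_norm_ge0 (G x + t n *: h x)) (euclid_norm_ge0 (h x)) ltr01.
    rewrite powR1 !mul1r => /le_trans; apply; rewrite /dom !normqE lerD2r.
    apply: le_trans (euclid_norm_powR_double q1 _ _) _.
    rewrite ler_pM2l ?powR_gt0// lerD2l.
    apply: ge0_ler_powR; rewrite ?nnegrE ?euclid_norm_ge0 ?(ltW q0)//.
    rewrite euclid_normZ gtr0_norm// ler_piMl ?euclid_norm_ge0//.
    by rewrite invf_le1 ?ler1n.
move=> /cvgr_to_ge; apply; apply: nearW => k; exact: key.
Qed.

Lemma variational_solution : exists U G, [/\ W U G, forall x, D x -> 0 < U x <= v x &
  forall psi h, W psi h -> I (fluxq G h) = I (fun x => f (U x) * psi x)].
Proof.
have [U [G [WU cU UE]]] := minimizer; have Upos := minimizer_gt0 WU cU UE.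
(* The minimizer is positive only almost everywhere. Replacing it by v on the exceptional null set
   stays in W by [Wclosed] and changes no integral. *)
pose U' x := if 0 < U x then U x else v x.
have mU' : measurable_fun D U'.
  apply: measurable_fun_ite => //; last exact: Wmu WU.
  by apply: measurable_fun_ltr => //; exact: Wmu WU.
have aeU : {ae mu, forall x, D x -> U' x = U x}.
  by apply: filterS Upos => x Ux Dx; rewrite /U' Ux.
have i0 : intg (fun=> 0 : R) by exact: (intg_cst mD).
have I0 : I (fun=> 0) = 0 by rewrite (rint_cst mu mD) mul0r.
exists U', G; split.
- apply: Wclosed => //; first exact: Wmg WU.
  move=> e e0; exists U, G.
  have mUU : measurable_fun D (fun x => `|U x - U' x| `^ q).
    apply: measurable_fun_powR => //; apply: measurable_fun_normr => //.
    by apply: measurable_funB => //; exact: Wmu WU.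
  have [j1 j2] : intg (fun x => `|U x - U' x| `^ q) /\ I (fun x => `|U x - U' x| `^ q) = 0.
    have := ae_eq_intg mD mUU i0; rewrite -!rintE I0; apply.
    by apply: filterS aeU => x UU Dx; rewrite UU// subrr normr0 powR0 ?gt_eqF.
  have n0 : normq (fun x => G x - G x) = fun=> 0.
    by apply/funext => x; rewrite normqE subrr euclid_norm0 powR0 ?gt_eqF.
  rewrite n0; split => //.
  by rewrite j2 I0; split; exact: ltW.
- move=> x Dx; rewrite /U'; case: ifPn => [-> /=|_]; last by rewrite v0 ?lexx.
  by have /andP[] := cU x Dx.
move=> psi h Wp; have -> : I (fun x => f (U' x) * psi x) = I (fun x => f (U x) * psi x).
  rewrite !rintE; apply: (ae_eq_intg mD _ _ _).2.
  - apply: measurable_funM; last exact: Wmu Wp.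
    exact: (measurableT_comp mf mU').
  - by apply: intg_reaction; [exact: Wmu WU|exact: Wint Wp].
  - by apply: filterS aeU => x UU Dx; rewrite UU.
apply/eqP; rewrite eq_le (euler_lagrange_le WU UE Wp) andbT.
have := euler_lagrange_le WU UE (WZ (- 1) Wp).
have ifl : intg (fluxq G h).
  by apply: intg_flux; [exact: Wmg WU|exact: Wmg Wp|exact: Wig WU|exact: Wig Wp].
have ifp : intg (fun x => f (U x) * psi x).
  by apply: intg_reaction; [exact: Wmu WU|exact: Wint Wp].
have -> : fluxq G (fun x => - 1 *: h x) = fun x => - 1 * fluxq G h x.
  by apply/funext => x; rewrite !fluxqE fluxZr.
have -> : (fun x => f (U x) * (- 1 * psi x)) = fun x => - 1 * (f (U x) * psi x).
  by apply/funext => x; rewrite mulrCA.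
rewrite rintZ; [|exact: mD|exact: ifp].
by rewrite rintZ; [|exact: mD|exact: ifl]; lra.
Qed.

End variational.

(** * Lebesgue measure on R^n *)

Section borel_rV.
Context {R : realType}.

Lemma measurable_rV_box n (I : 'I_n -> set R) : (forall i, measurable (I i)) ->
  measurable [set x : 'rV[R]_n | forall i, I i (x ord0 i)].
Proof.
move=> mI; rewrite (_ : [set _ | _] = \bigcap_(i in [set: 'I_n])
    ((fun y : 'rV[R]_n => y ord0 i) @^-1` I i)).
  apply: fin_bigcap_measurable; first exact: finite_finset.
  by move=> i _; have := measurable_coord i measurableT (mI i); rewrite setTI.
by apply/seteqP; split => [y yI i _|y yI i]; [exact: yI|exact: (yI i)].
Qed.

(** The sigma-algebra is the one generated by the coordinates; an open set is a countable union of
    cubes with rational centers and radii 1/(k+1). *)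
Lemma open_measurable_rV n (U : set 'rV[R]_n) : open U -> measurable U.
Proof.
move=> oU.
pose B (z : 'rV[rat]_n) (r : R) := [set x : 'rV[R]_n | forall i, ball (ratr (z ord0 i) : R) r (x ord0 i)].
have mB z r : measurable (B z r).
  by apply: (measurable_rV_box (I := fun i => ball (ratr (z ord0 i) : R) r)) => i; exact: measurable_ball.
pose r (k : nat) : R := k.+1%:R^-1.
have r0 k : 0 < r k by rewrite invr_gt0.
pose C (m : nat) := if unpickle m is Some (z, k) then
  (if `[< B z (r k) `<=` U >] then B z (r k) else set0) else set0.
have -> : U = \bigcup_m C m.
  apply/seteqP; split => [x Ux|x [m _]]; last first.
    by rewrite /C; case: (unpickle m) => // -[z k]; case: ifPn => // /asboolP; exact.
  have /nbhs_ballP[e /= e0 xU] : nbhs x U by exact: open_nbhs_nbhs.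
  have [k rk] : exists k, r k < e / 2.
    have e20 : 0 < e / 2 by rewrite divr_gt0.
    have /cvgrPdist_lt /(_ _ e20) [k _ Hk] := @cvg_harmonic R.
    by exists k; have := Hk k (leqnn k); rewrite sub0r normrN (ger0_norm (ltW (r0 k))).
  have /choice[z Hz] : forall i, exists z : rat, ball (ratr z : R) (r k) (x ord0 i).
    move=> i; have lt : x ord0 i - r k < x ord0 i + r k by have := r0 k; lra.
    have [y] := rat_in_itvoo lt; rewrite in_itv/= => /andP[y1 y2].
    by exists y; rewrite /ball/= ltr_norml; apply/andP; split; lra.
  exists (pickle (\row_i z i, k)) => //; rewrite /C pickleK.
  have xB : B (\row_i z i) (r k) x by move=> i; rewrite mxE.
  case: ifPn => // /asboolPn nB; exfalso; apply: nB => y By; apply: xU; split => // i j.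
  rewrite (ord1 i); have := By j; have := xB j.
  rewrite /ball/= => h1 h2; have -> : x ord0 j - y ord0 j =
    (ratr ((\row_i z i) ord0 j) - y ord0 j) - (ratr ((\row_i z i) ord0 j) - x ord0 j) by ring.
  by apply: le_lt_trans (ler_normB _ _) _; lra.
apply: bigcup_measurable => m _; rewrite /C; case: (unpickle m) => // -[z k].
by case: ifPn.
Qed.

Lemma continuous_measurable_rV n (f : 'rV[R]_n -> R) : continuous f -> measurable_fun setT f.
Proof.
move=> cf; apply: (measurability _ (RGenOInfty.measurableE R)) => // _ [_ [a ->] <-].
rewrite setTI; apply: open_measurable_rV; apply: open_comp; last exact: interval_open.
by move=> x _; exact: cf.
Qed.

End borel_rV.

(** * Integrals of partial derivatives *)

Section integral_partial.
Context {R : realType}.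

(** A directional derivative only sees one line: if [a] carries the line x + h w to a(x) + h v, the
    difference quotients are the same. This moves derivatives through slices and embeddings without
    a chain rule. *)
Lemma is_derive_line (U V W : normedModType R) (f : V -> W) (a : U -> V) (x w : U) (v : V) (df : W) :
  (forall h : R, a (h *: w + x) = h *: v + a x) ->
  is_derive (a x) v f df -> is_derive x w (f \o a) df.
Proof.
move=> aE [fd <-].
have e : (fun h : R => h^-1 *: (((f \o a) \o shift x) (h *: w) - (f \o a) x)) =
    (fun h : R => h^-1 *: ((f \o shift (a x)) (h *: v) - f (a x))).
  by apply/funext => h /=; rewrite aE.
by split; [rewrite /derivable e|rewrite /derive e].
Qed.

(** Bounded support expressed through coordinates, a form that passes to the slices in Fubini's
    theorem. *)
Definition box_support n (M : R) (g : 'rV[R]_n -> R) :=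
  forall x : 'rV[R]_n, (exists i, M < `|x ord0 i|) -> g x = 0.

Definition cube n (M : R) := [set x : 'rV[R]_n | forall i, `[(- M), M]%classic (x ord0 i)].

Lemma measurable_cube n (M : R) : measurable (@cube n M).
Proof. by apply: (measurable_rV_box (I := fun=> `[(- M), M]%classic)). Qed.

Lemma lebesgue_rV_cube_lty n (M : R) : (lebesgue_rV n (@cube n M) < +oo)%E.
Proof.
pose J : set R := `[(- M), M]%classic.
have KE : lebesgue_rV n (@cube n M) = (\prod_(i < n) lebesgue_measure J)%E.
  by apply: (lebesgue_rV_box (I := fun _ : 'I_n => J)) => _; exact: measurable_itv.
apply: (eq_ind_r (fun z : \bar R => (z < +oo)%E) _ KE).
have : (\prod_(i < n) lebesgue_measure J)%E \is a fin_num.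
  elim/big_ind : _ => // [a b|i _]; first exact: fin_numM.
  by rewrite lebesgue_measure_itv/=; case: ifP.
by rewrite ltey_eq => ->.
Qed.

Lemma integrable_box_support n (M : R) (g : 'rV[R]_n -> R) : 0 <= M ->
  continuous g -> box_support M g -> (lebesgue_rV n).-integrable setT (EFin \o g).
Proof.
move=> M0 cg gM.
set K := @cube n M; have mK : measurable K := @measurable_cube n M.
have cK : compact K by apply: (@rV_compact _ _ (fun _ : 'I_n => `[(- M), M]%classic)) => i; exact: segment_compact.
have K0 : K !=set0 by exists 0 => i /=; rewrite mxE in_itv/= oppr_le0 M0.
have cng : continuous (fun x => `|g x|) by move=> x; exact: (cvg_norm (cg x)).
have [z _ zmax] := EVT_max_rV K0 cK (continuous_subspaceT cng).
have -> : EFin \o g = (EFin \o g) \_ K.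
  apply/funext => x; rewrite /patch; case: ifPn => // /negP xK /=.
  rewrite gM//; apply: contrapT => H; apply: xK; rewrite inE => i /=.
  by rewrite in_itv/= -ler_norml leNgt; apply/negP => Mi; apply: H; exists i.
apply/(integrable_mkcond (EFin \o g) mK); apply: measurable_bounded_integrable => //.
- exact: lebesgue_rV_cube_lty.
- by apply: measurable_funTS; exact: continuous_measurable_rV.
exists `|g z|; split; first exact: num_real.
by move=> y gy x Kx /=; apply: le_trans (ltW gy); apply: zmax; rewrite inE.
Qed.

Lemma integral_derive_line (M : R) (f g : R -> R) : 0 <= M ->
  (forall t : R, is_derive t 1 f (g t)) -> continuous g ->
  (forall t, M < `|t| -> f t = 0 /\ g t = 0) ->
  (\int[lebesgue_measure]_t (g t)%:E = 0)%E.
Proof.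
(* One more than M, since f is known to vanish only for |t| > M and has to vanish at the
   endpoints. *)
move=> M0 fg cg fM; pose B := M + 1.
have B0 : 0 < B by rewrite ltr_pwDr.
pose J : set R := `[(- B), B]%classic.
have -> : (\int[lebesgue_measure]_t (g t)%:E = \int[lebesgue_measure]_(t in J) (g t)%:E)%E.
  rewrite [RHS]integral_mkcond; apply: eq_integral => t _; rewrite /patch; case: ifPn => // /negP tB.
  rewrite (fM t _).2// ltNge; apply/negP => tM; apply: tB; apply/mem_set; rewrite /J/= in_itv/= -ler_norml.
  by apply: le_trans tM _; rewrite lerDl.
have fder t : derivable f t 1 by exact: (@ex_derive _ _ _ _ _ _ _ (fg t)).
have cf : continuous f.
  by move=> t; apply: differentiable_continuous; apply/derivable1_diffP.
rewrite (@continuous_FTC2 _ g f).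
- by rewrite (fM B _).1 ?(fM (- B) _).1 ?normrN ?(gtr0_norm B0) ?ltrDl ?sube0.
- by rewrite gtrN.
- exact: continuous_subspaceT.
- split; first by move=> t _; exact: fder.
    by apply: cvg_at_right_filter; exact: cf.
  by apply: cvg_at_left_filter; exact: cf.
- by move=> t _; rewrite derive1E; exact: (@derive_val _ _ _ _ _ _ _ (fg t)).
Qed.

Lemma continuous_rVP (T : topologicalType) n (f : T -> 'rV[R]_n) :
  (forall i, continuous (fun x => f x ord0 i)) -> continuous f.
Proof.
move=> cf x; apply/cvg_ballP => e e0.
have : \forall y \near x, forall j, ball (f x ord0 j) e (f y ord0 j).
  by apply: filter_forall => j; have /cvg_ballP /(_ e e0) := cf j x.
by apply: filterS => y H; split => // i j; rewrite (ord1 i).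
Qed.

Lemma add_scale_rVE n (h : R) (v w : 'rV[R]_n) i :
  (h *: v + w) ord0 i = h * v ord0 i + w ord0 i.
Proof. by rewrite !mxE. Qed.

Lemma delta_rVE n (k i : 'I_n) : (delta_mx ord0 k : 'rV[R]_n) ord0 i = (i == k)%:R.
Proof. by rewrite mxE eqxx. Qed.

(** Induction on the dimension, splitting off the first coordinate by Fubini: a derivative along
    that coordinate is integrated first and vanishes by the fundamental theorem of calculus; any
    other one vanishes on each slice by induction. *)
Lemma integral_partial n (k : 'I_n) (M : R) (f g : 'rV[R]_n -> R) : 0 <= M ->
  (forall x, is_derive x (delta_mx ord0 k) f (g x)) -> continuous g ->
  box_support M f -> box_support M g ->
  (\int[lebesgue_rV n]_x (g x)%:E = 0)%E.
Proof.
move=> M0; elim: n k f g => [[]//|n ih] k f g fg cg fM gM.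
have mg := continuous_measurable_rV cg.
have mgE : measurable_fun setT (EFin \o g) by exact/measurable_EFinP.
have ig := integrable_box_support M0 cg gM.
have cons_lin0 (t : R) (y : 'rV[R]_n) (h : R) :
    cons_rV (h *: 1 + t, y) = h *: delta_mx ord0 ord0 + cons_rV (t, y).
  apply/rowP => i; rewrite add_scale_rVE delta_rVE.
  case: (unliftP ord0 i) => [j ->|->]; first by rewrite !cons_rVS mulr0 add0r.
  by rewrite !cons_rV0.
have cons_linS (t : R) (j : 'I_n) (y : 'rV[R]_n) (h : R) :
    cons_rV (t, h *: delta_mx ord0 j + y) = h *: delta_mx ord0 (lift ord0 j) + cons_rV (t, y).
  apply/rowP => i; rewrite add_scale_rVE delta_rVE.
  case: (unliftP ord0 i) => [i' ->|->].
    by rewrite !cons_rVS/= add_scale_rVE delta_rVE (inj_eq (@lift_inj _ _)).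
  by rewrite !cons_rV0/= mulr0 add0r.
have mgc : measurable_fun setT ((EFin \o g) \o @cons_rV R n).
  exact: (measurableT_comp mgE (@measurable_cons_rV R n)).
have igc : (lebesgue_measure \x lebesgue_rV n)%E.-integrable setT ((EFin \o g) \o @cons_rV R n).
  apply/integrableP; split => //; have /integrableP[_] := ig.
  rewrite /= /cons_measure ge0_integral_pushforward//.
  - exact: measurable_cons_rV.
  - by apply/measurable_EFinP; exact: measurable_fun_normr.
rewrite (eq_measure_integral (pushforward (@lebesgue_measure R \x lebesgue_rV n)%E (@cons_rV R n)))//.
  exact: measurable_cons_rV.
move=> mcons'; have mcons : measurable_fun [set: (measurableTypeR R * 'rV[R]_n)%type] (@cons_rV R n).
  exact: measurable_cons_rV.
rewrite (integral_pushforward mcons mgE igc measurableT).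
case: (unliftP ord0 k) => [j|] kE.
  rewrite preimage_setT -(integral12_prod_meas1 igc).
  apply: integral0_eq => t _; rewrite /fubini_F.
  apply: (ih j (fun y => f (cons_rV (t, y))) (fun y => g (cons_rV (t, y)))).
  - move=> y; apply: (@is_derive_line _ _ _ f (fun y => cons_rV (t, y)) y _ (delta_mx ord0 k)).
    by move=> h; rewrite kE cons_linS.
  - move=> y; apply: continuous_comp; last exact: cg.
    move: y; apply: continuous_rVP => i; case: (unliftP ord0 i) => [i' ->|->].
      by under eq_fun do rewrite cons_rVS; exact: coord_continuous.
    by under eq_fun do rewrite cons_rV0; exact: cst_continuous.
  - by move=> y [i yi]; apply: fM; exists (lift ord0 i); rewrite cons_rVS.
  - by move=> y [i yi]; apply: gM; exists (lift ord0 i); rewrite cons_rVS.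
rewrite preimage_setT -(integral21_prod_meas1 igc).
apply: integral0_eq => y _; rewrite /fubini_G.
apply: (@integral_derive_line M (fun t => f (cons_rV (t, y))) (fun t => g (cons_rV (t, y)))) => //.
- move=> t; apply: (@is_derive_line _ _ _ f (fun t => cons_rV (t, y)) t _ (delta_mx ord0 k)).
  by move=> h; rewrite kE cons_lin0.
- move=> t; apply: continuous_comp; last exact: cg.
  move: t; apply: continuous_rVP => i; case: (unliftP ord0 i) => [i' ->|->].
    by under eq_fun do rewrite cons_rVS; exact: cst_continuous.
  by under eq_fun do rewrite cons_rV0; move=> t; exact: cvg_id.
- by move=> t tM; split; [apply: fM|apply: gM]; exists ord0; rewrite cons_rV0.
Qed.

End integral_partial.

(** * Left-invariant vector fields *)

Section derivatives.
Context {R : realType}.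

Lemma is_derive_differentiable (f : R -> R) (t df : R) : is_derive t 1 f df -> differentiable f t.
Proof. by move=> h; apply/derivable1_diffP; exact: (@ex_derive _ _ _ _ _ _ _ h). Qed.

Lemma is_derive_continuous (f f' : R -> R) :
  (forall t : R, is_derive t 1 f (f' t)) -> continuous f.
Proof. by move=> h t; exact/differentiable_continuous/(is_derive_differentiable (h t)). Qed.

Lemma is_derive_coord (V : normedModType R) m n (F : V -> 'M[R]_(m, n)) x v dF i j :
  is_derive x v F dF -> is_derive x v (fun y => F y i j) (dF i j).
Proof.
move=> [Fd <-]; have Fij := (derivable_mxP F x v).1 Fd i j.
by rewrite derive_mx// mxE; exact: derivableP.
Qed.

Lemma is_derive_line1 (V W : normedModType R) (F : V -> W) (x v : V) dF :
  is_derive x v F dF -> is_derive (0 : R) 1 (fun t : R => F (t *: v + x)) dF.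
Proof.
move=> Fd; apply: (@is_derive_line _ R V W F (fun t => t *: v + x) 0 1 v).
  by move=> h; rewrite scale0r add0r addr0 [_ *: 1]mulr1.
by rewrite scale0r add0r.
Qed.

Lemma is_derive_unique (V W : normedModType R) (F : V -> W) (x v : V) d1 d2 :
  is_derive x v F d1 -> is_derive x v F d2 -> d1 = d2.
Proof. by move=> [_ <-] [_ <-]. Qed.

Lemma derive_scale (V W : normedModType R) (F : V -> W) (x v : V) (a : R) :
  differentiable F x -> 'D_(a *: v) F x = a *: 'D_v F x.
Proof. by move=> dF; rewrite !deriveE// linearZ. Qed.

Lemma is_derive_diff (V W : normedModType R) (F : V -> W) (x v : V) :
  differentiable F x -> is_derive x v F ('D_v F x).
Proof. by move=> dF; apply: derivableP; exact: diff_derivable. Qed.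

Lemma derive_rV_sum (W : normedModType R) n (F : 'rV[R]_n -> W) x v :
  differentiable F x -> 'D_v F x = \sum_k v ord0 k *: 'D_(delta_mx ord0 k) F x.
Proof.
move=> dF; rewrite deriveE// [in LHS](row_sum_delta v) linear_sum.
by apply: eq_bigr => k _; rewrite linearZ/= deriveE.
Qed.

End derivatives.

Section box_support.
Context {R : realType} (n : nat).
Implicit Types (phi : 'rV[R]_n -> R).

Lemma box_support_derive (M : R) phi v :
  box_support M phi -> box_support M (fun x => 'D_v phi x).
Proof.
move=> phiM x [i Mxi].
have : \forall y \near x, phi y = cst 0 y.
  have /cvgr_norm_gt /(_ _ Mxi) : (fun y : 'rV[R]_n => y ord0 i) @ x --> x ord0 i.
    exact: coord_continuous.
  by apply: filterS => y My; apply: phiM; exists i.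
by move=> /near_eq_derive ->; rewrite derive_cst.
Qed.

End box_support.

Section continuity.
Context {R : realType} (T : topologicalType).
Implicit Types f g : T -> R.

Lemma continuous_funM f g : continuous f -> continuous g -> continuous (fun x => f x * g x).
Proof. by move=> cf cg x; apply: cvgM; [exact: cf|exact: cg]. Qed.

Lemma continuous_funD f g : continuous f -> continuous g -> continuous (fun x => f x + g x).
Proof. by move=> cf cg x; apply: cvgD; [exact: cf|exact: cg]. Qed.

End continuity.

(** * Homogeneity of the horizontal fields *)

Section carnot_fields.
Context {R : realType} (G : stratified_group R).
Local Notation n := (gdim G).
Local Notation V := 'rV[R]_(gdim G).
Local Notation mul := (@gmul R G).
Local Notation N1 := (layer (ord0 : 'I_(last_layer G).+1)).
Local Notation delta := (@dilation R (last_layer G) (layer (s := G))).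
Implicit Types (x y v : V) (i k : 'I_n) (j : 'I_N1) (lam : R).

Definition weight k : nat := (tagnat.sig1 k).+1.

Lemma dilationE lam x k : delta lam x ord0 k = lam ^+ weight k * x ord0 k.
Proof. by rewrite /dilation /mxrow !mxE /weight tagnat.sig2K. Qed.

Lemma dilation_line lam (h : R) x y :
  delta lam (h *: x + y) = h *: delta lam x + delta lam y.
Proof.
by apply/rowP => i; rewrite add_scale_rVE !dilationE add_scale_rVE mulrDr mulrCA.
Qed.

Lemma dilation_delta lam k :
  delta lam (delta_mx ord0 k : V) = lam ^+ weight k *: (delta_mx ord0 k : V).
Proof.
apply/rowP => i; rewrite dilationE [in RHS]mxE delta_rVE.
by case: eqP => [->//|_]; rewrite !mulr0.
Qed.

Definition first_coord j : 'I_n := tagnat.Rank ord0 j.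

Lemma weight_first j : weight (first_coord j) = 1%N.
Proof. by rewrite /weight /first_coord tagnat.Rank1K. Qed.

(** The field is the derivative of the multiplication at (x, 0) in the direction (0, v), so it is
    C^1 because the multiplication is C^2. *)
Lemma Ck1_left_field v : Ck 1 (left_field mul v).
Proof.
have [_ /(_ (0, v))] := @gmul_smooth R G 2%N.
set M := (fun z : V * V => _); set DM := (fun z : V * V => 'D_(0, v) M z) => -[DMd DMc].
have e : left_field mul v = DM \o (fun x => (x, 0)).
  apply/funext => x; rewrite /left_field /DM /=.
  have Md : differentiable M (x, 0) by have [+ _] := @gmul_smooth R G 1%N; exact.
  have := @is_derive_line _ _ _ _ M (fun y : V => (x, y)) 0 v (0, v) _ _ (is_derive_diff (0, v) Md).
  case=> [|_ ->//].
  by move=> h; congr pair => /=; rewrite ?scaler0 ?add0r.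
rewrite e; split => [x|w].
  apply: differentiable_comp; last exact: DMd.
  by apply: differentiable_pair.
rewrite (_ : (fun x => _) = (fun x => 'D_(w, 0) DM (x, 0))); last first.
  apply/funext => x.
  have := @is_derive_line _ _ _ _ DM (fun y : V => (y, 0)) x w (w, 0) _ _ (is_derive_diff (w, 0) (DMd (x, 0))).
  case=> [|_ ->//].
  by move=> h; congr pair => /=; rewrite ?scaler0 ?add0r.
move=> x; apply: (@continuous_comp _ _ _ (fun x : V => (x, 0 : V)) (fun z => 'D_(w, 0) DM z)).
  by apply: differentiable_continuous; apply: differentiable_pair.
exact: DMc.
Qed.

Lemma continuous_derive_hfield j v : continuous (fun x => 'D_v (@hfield R G j) x).
Proof. exact: (Ck1_left_field (delta_mx ord0 (first_coord j))).2. Qed.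

Definition hcoef j k x : R := @hfield R G j x ord0 k.

Lemma differentiable_hfield j x : differentiable (@hfield R G j) x.
Proof. by have [+ _] := Ck1_left_field (delta_mx ord0 (first_coord j)); exact. Qed.

Lemma is_derive_hcoef j k x v :
  is_derive x v (hcoef j k) ('D_v (@hfield R G j) x ord0 k).
Proof. by apply: is_derive_coord; apply: is_derive_diff; exact: differentiable_hfield. Qed.

Lemma continuous_hcoef j k : continuous (hcoef j k).
Proof.
move=> x; apply: (@continuous_comp _ _ _ (@hfield R G j) (fun y => y ord0 k)).
  exact/differentiable_continuous/differentiable_hfield.
exact: coord_continuous.
Qed.

(** The dilation is an automorphism and multiplies the first-layer vector e by lam; differentiating
    the dilated product of x and t e at t = 0 in two ways gives the identity. So the coefficient of
    d/dx_k in X_j is homogeneous of degree [weight k] - 1. *)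
Lemma hcoef_dilation lam j k x : 0 < lam ->
  lam * hcoef j k (delta lam x) = lam ^+ weight k * hcoef j k x.
Proof.
move=> lam0; pose e : V := delta_mx ord0 (first_coord j).
have h1 y : is_derive (0 : R) 1 (fun t : R => mul y (t *: e) ord0 k) (hcoef j k y).
  have := is_derive_line1 (is_derive_diff e (differentiable_gmul y 0)).
  by move/(is_derive_coord ord0 k); under eq_fun do rewrite addr0.
have h2 : is_derive (0 : R) 1 (fun t : R => mul (delta lam x) ((lam * t) *: e) ord0 k)
    (lam * hcoef j k (delta lam x)).
  have hl : is_derive (0 : R) 1 (fun t : R => lam * t) lam.
    have : is_derive (0 : R) 1 (lam \*: (@id R)) (lam *: (1 : R)) by apply: is_deriveZ.
    by rewrite [lam *: 1]mulr1.
  rewrite mulrC; apply: (is_derive1_comp (f := fun t : R => mul (delta lam x) (t *: e) ord0 k) _ hl).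
  by rewrite mulr0.
have h3 : is_derive (0 : R) 1 (fun t : R => lam ^+ weight k * mul x (t *: e) ord0 k)
    (lam ^+ weight k * hcoef j k x).
  exact: (@is_deriveZ _ _ _ _ (lam ^+ weight k) _ _ _ (h1 x)).
apply: is_derive_unique h2 _; move: h3; congr is_derive.
apply/funext => t; rewrite -dilationE dilation_gmul//; congr (mul _ _ ord0 k).
apply/rowP => i; rewrite dilationE !mxE eqxx /=.
case: eqP => [->|_]; last by rewrite !mulr0.
by rewrite weight_first expr1 !mulr1.
Qed.

Lemma harmonic_dilation_cvg x :
  (fun k : nat => delta k.+1%:R^-1 x) @ \oo --> (0 : V).
Proof.
apply/cvg_ballP => e e0.
have : \forall m \near \oo, forall k, ball ((0 : V) ord0 k) e (delta m.+1%:R^-1 x ord0 k).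
  apply: filter_forall => k.
  have : (fun m : nat => m.+1%:R^-1 ^+ weight k * x ord0 k) @ \oo --> (0 : R) ^+ weight k * x ord0 k.
    apply: cvgM; last exact: cvg_cst.
    exact: (cvg_comp _ _ cvg_harmonic (@exprn_continuous R (weight k) 0)).
  rewrite /weight expr0n mul0r => /cvg_ballP /(_ e e0).
  by apply: filterS => m; rewrite dilationE mxE.
by apply: filterS => m H; split => // i j; rewrite (ord1 i).
Qed.

(** Degree 0: the coefficient is invariant under dilations, and letting them shrink x to 0
    identifies it, by continuity, with its value at the identity. *)
Lemma hcoef_first j j' x : hcoef j (first_coord j') x = (j' == j)%:R.
Proof.
have hc lam : 0 < lam -> hcoef j (first_coord j') (delta lam x) = hcoef j (first_coord j') x.
  move=> lam0; have := hcoef_dilation j (first_coord j') x lam0.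
  by rewrite weight_first expr1 => /(mulfI (lt0r_neq0 lam0)).
have h1 : (fun k : nat => hcoef j (first_coord j') (delta k.+1%:R^-1 x)) @ \oo -->
    hcoef j (first_coord j') 0.
  exact: (cvg_comp _ _ (harmonic_dilation_cvg x) (@continuous_hcoef j (first_coord j') 0)).
have h2 : (fun k : nat => hcoef j (first_coord j') (delta k.+1%:R^-1 x)) =
    fun=> hcoef j (first_coord j') x.
  by apply/funext => k; rewrite hc// invr_gt0.
rewrite h2 in h1; have -> := cvg_unique (@Rhausdorff R) (cvg_cst _) h1.
rewrite /hcoef (_ : @hfield R G j 0 = delta_mx ord0 (first_coord j)); last exact: left_field0.
by rewrite delta_rVE -val_eqE /first_coord tagnat.eq_Rank eqxx.
Qed.

(** The derivative along x_k is homogeneous of degree -1 and continuous at 0: b(x) = lam b(delta_lam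
    x) tends to 0 with lam. Hence X_j has no divergence. *)
Lemma hcoef_partial0 j k x : is_derive x (delta_mx ord0 k) (hcoef j k) 0.
Proof.
pose b y := 'D_(delta_mx ord0 k) (@hfield R G j) y ord0 k.
have bc : continuous b.
  move=> y; exact: (cvg_comp _ _ (@continuous_derive_hfield j (delta_mx ord0 k) y)
    (@coord_continuous R 1 n ord0 k _)).
have hd y v : is_derive y v (hcoef j k) ('D_v (@hfield R G j) y ord0 k) by exact: is_derive_hcoef.
have bE lam : 0 < lam -> b x = lam * b (delta lam x).
  move=> lam0; have lamk : lam ^+ weight k != 0 by rewrite expf_neq0// gt_eqF.
  have h1 : is_derive (0 : R) 1 (fun t : R => lam * hcoef j k (delta lam (t *: delta_mx ord0 k + x)))
      (lam ^+ weight k * b x).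
    have := is_derive_line1 (hd x (delta_mx ord0 k)).
    move/(@is_deriveZ _ _ _ _ (lam ^+ weight k)); congr is_derive.
    by apply/funext => t; rewrite hcoef_dilation.
  have h2 : is_derive (0 : R) 1 (fun t : R => lam * hcoef j k (delta lam (t *: delta_mx ord0 k + x)))
      (lam * (lam ^+ weight k * b (delta lam x))).
    have := is_derive_line1 (hd (delta lam x) (lam ^+ weight k *: delta_mx ord0 k)).
    move/(@is_deriveZ _ _ _ _ lam); congr is_derive.
      by apply/funext => t; rewrite (dilation_line lam t (delta_mx ord0 k) x) dilation_delta.
    by rewrite derive_scale ?mxE//; exact: differentiable_hfield.
  have := is_derive_unique h1 h2; rewrite mulrCA => /(mulfI lamk)//.
have h1 : (fun m : nat => m.+1%:R^-1 * b (delta m.+1%:R^-1 x)) @ \oo --> 0 * b 0.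
  apply: cvgM; first exact: cvg_harmonic.
  exact: (cvg_comp _ _ (harmonic_dilation_cvg x) (@bc 0)).
have h2 : (fun m : nat => m.+1%:R^-1 * b (delta m.+1%:R^-1 x)) = fun=> b x.
  by apply/funext => m; rewrite -bE// invr_gt0.
rewrite h2 mul0r in h1; have b0 := cvg_unique (@Rhausdorff R) (cvg_cst _) h1.
by have := hd x (delta_mx ord0 k); rewrite -/(b x) b0.
Qed.

Lemma derive_hfield j (phi : V -> R) x : differentiable phi x ->
  'D_(@hfield R G j x) phi x = \sum_k hcoef j k x * 'D_(delta_mx ord0 k) phi x.
Proof. exact: derive_rV_sum. Qed.

Lemma continuous_derive_hfield_fun j (phi : V -> R) : Ck 1 phi ->
  continuous (fun x => 'D_(@hfield R G j x) phi x).
Proof.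
move=> [dphi cphi].
rewrite (_ : (fun x => _) = fun x => \sum_k hcoef j k x * 'D_(delta_mx ord0 k) phi x); last first.
  by apply/funext => x; rewrite derive_hfield.
apply: continuous_big => [|k _ x]; first exact: add_continuous.
exact: (cvgM (@continuous_hcoef j k x) (cphi (delta_mx ord0 k) x)).
Qed.

(* Each [X_j] is divergence free; integrate by parts coordinate by coordinate. *)
Lemma integral_hfield j (phi : V -> R) (A A' : R -> R) (M : R) : 0 <= M ->
  Ck 1 phi -> box_support M phi ->
  (forall s : R, is_derive s 1 A (A' s)) -> continuous A' ->
  (\int[lebesgue_rV n]_x (A (x ord0 (first_coord j)) * 'D_(@hfield R G j x) phi x +
    A' (x ord0 (first_coord j)) * phi x)%:E = 0)%E.
Proof.
move=> M0 [dphi cphi] phiM dA cA'; set k0 := first_coord j.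
have cA := is_derive_continuous dA.
have cphi0 : continuous phi by move=> x; exact: differentiable_continuous.
pose co (x : V) : R := x ord0 k0.
have cco : continuous co by exact: coord_continuous.
(* [g k] is the k-th partial derivative of [f k]: the coefficient contributes nothing by
   [hcoef_partial0], and A depends on the coordinate k0 only. Summed over k, the [g k] give the
   integrand, the coefficient at k0 being 1. *)
pose f k x := hcoef j k x * phi x * A (co x).
pose g k x := A (co x) * (hcoef j k x * 'D_(delta_mx ord0 k) phi x) +
  (k == k0)%:R * (A' (co x) * (hcoef j k x * phi x)).
have cAco : continuous (fun x => A (co x)) by move=> x; exact: (cvg_comp _ _ (cco x) (cA _)).
have cA'co : continuous (fun x => A' (co x)) by move=> x; exact: (cvg_comp _ _ (cco x) (cA' _)).
have dAco k x : is_derive x (delta_mx ord0 k) (fun x => A (co x)) ((k == k0)%:R * A' (co x)).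
  have h : is_derive (co x) ((k0 == k)%:R : R) A ((k == k0)%:R * A' (co x)).
    have dAx := is_derive_differentiable (dA (co x)).
    have := is_derive_diff ((k0 == k)%:R : R) dAx.
    have -> : 'D_((k0 == k)%:R : R) A (co x) = (k == k0)%:R * A' (co x).
      rewrite -[(k0 == k)%:R]mulr1 (_ : _ * 1 = (k0 == k)%:R *: (1 : R))// derive_scale//.
      by rewrite (@derive_val _ _ _ _ _ _ _ (dA (co x))) eq_sym.
    by [].
  apply: (@is_derive_line _ _ _ _ A co x (delta_mx ord0 k) ((k0 == k)%:R) _ _ h).
  by move=> s; rewrite /co add_scale_rVE delta_rVE.
have df k x : is_derive x (delta_mx ord0 k) (f k) (g k x).
  have h1 := is_deriveM (hcoef_partial0 j k x) (is_derive_diff (delta_mx ord0 k) (dphi x)).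
  have h2 := is_deriveM h1 (dAco k x).
  apply: (is_derive_eq h2); rewrite /g /GRing.scale/= mulr0 addr0.
  by rewrite [X in X = _]addrC; congr (_ + _); rewrite mulrCA [X in _ * X]mulrC.
have cg k : continuous (g k).
  have ch := @continuous_hcoef j k.
  apply: continuous_funD.
    exact: (continuous_funM cAco (continuous_funM ch (cphi (delta_mx ord0 k)))).
  apply: continuous_funM; first exact: cst_continuous.
  exact: (continuous_funM cA'co (continuous_funM ch cphi0)).
have fM k : box_support M (f k) by move=> x Mx; rewrite /f phiM// mulr0 mul0r.
have gM k : box_support M (g k).
  by move=> x Mx; rewrite /g phiM// (box_support_derive _ phiM)// !mulr0 addr0.
have gi k := integral_partial M0 (df k) (cg k) (fM k) (gM k).
have -> : (fun x => (A (x ord0 k0) * 'D_(@hfield R G j x) phi x + A' (x ord0 k0) * phi x)%:E) =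
    (fun x => \sum_(k <- index_enum 'I_n | true) (g k x)%:E)%E.
  apply/funext => x; rewrite sumEFin; congr EFin; rewrite derive_hfield// big_split/=.
  rewrite -mulr_sumr; congr (_ + _).
  rewrite (bigD1 k0)//= eqxx mul1r hcoef_first eqxx mul1r big1 ?addr0// => k /negPf ->.
  by rewrite mul0r.
rewrite integral_sum//; first by rewrite big1.
by move=> k; exact: (integrable_box_support M0 (cg k) (gM k)).
Qed.

End carnot_fields.

(** * C^1 functions and truncation *)

Section positive_part.
Context {R : realType}.
Implicit Types (s t e : R).

(** Lets the derivative of a piecewise quadratic function be checked by polynomial inequalities,
    even where the pieces meet. *)
Lemma is_derive_quadratic (f : R -> R) t d C :
  (forall h : R, `|f (h + t) - f t - h * d| <= C * h ^+ 2) -> is_derive t 1 f d.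
Proof.
move=> fC.
have cv : h^-1 *: (f (h *: 1 + t) - f t) @[h --> (0 : R)^'] --> d.
  apply/cvgrPdist_le => e e0.
  have C1 : 0 < `|C| + 1 by rewrite ltr_wpDl.
  near=> h.
  have h0 : h != 0 by near: h; exact: nbhs_dnbhs_neq.
  have hn : 0 < `|h| by rewrite normr_gt0.
  have he : `|h| <= e / (`|C| + 1).
    near: h; apply: dnbhs0_le; exact: divr_gt0.
  rewrite -(ler_pM2l hn) -normrM [h *: 1]mulr1 /GRing.scale /= mulrBr mulrA mulfV// mul1r.
  rewrite distrC; apply: le_trans (fC h) _; rewrite -[h ^+ 2]real_normK ?num_real//.
  rewrite expr2 mulrCA ler_pM2l//.
  move: he; rewrite ler_pdivlMr// => he; apply: le_trans he.
  by rewrite mulrC ler_pM2l//; have := ler_norm C; lra.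
split; last exact: cvg_lim cv.
by apply/cvg_ex; exists d.
Unshelve. all: by end_near. Qed.

Definition sqpos t : R := Num.max t 0 ^+ 2.

Lemma is_derive_sqpos t : is_derive t 1 sqpos (2 * Num.max t 0).
Proof.
apply: (@is_derive_quadratic _ _ _ 1) => h; rewrite /sqpos mul1r ler_norml.
by case: (leP (h + t) 0) => ht; case: (leP t 0) => t0; apply/andP; split; nra.
Qed.

Lemma continuous_maxr0 : continuous (fun t : R => Num.max t 0).
Proof.
by move=> t; apply: (@continuous_max R R (fun x => x) (fun=> 0) t); [exact: cvg_id|exact: cvg_cst].
Qed.

(* Huber's C^1 approximation of the positive part. *)
Definition huber e t : R := (sqpos t - sqpos (t - e)) / (2 * e).
(** Equal to 0, t / e and 1 on t <= 0, 0 <= t <= e and t >= e. *)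
Definition dhuber e t : R := (Num.max t 0 - Num.max (t - e) 0) / e.

Lemma is_derive_huber e t : 0 < e -> is_derive t 1 (huber e) (dhuber e t).
Proof.
move=> e0.
have h1 : is_derive t 1 (fun x => sqpos (x - e)) (2 * Num.max (t - e) 0).
  have h : is_derive t 1 (fun x : R => x - e) 1 by apply: is_derive_eq; rewrite ?subr0.
  by have := @is_derive1_comp _ sqpos (fun x : R => x - e) t _ _ (is_derive_sqpos (t - e)) h; rewrite mulr1.
have h2 := is_deriveB (is_derive_sqpos t) h1.
have h3 := is_deriveZ (2 * e)^-1 h2.
rewrite (_ : huber e = (2 * e)^-1 \*: (sqpos - (fun x => sqpos (x - e)))); last first.
  by apply/funext => x; rewrite /huber mulrC.
apply: (is_derive_eq h3); rewrite /dhuber /GRing.scale /=; field.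
by rewrite gt_eqF.
Qed.

Lemma continuous_dhuber e : continuous (dhuber e).
Proof.
move=> t; apply: cvgM; last exact: cvg_cst.
apply: cvgB; first exact: continuous_maxr0.
apply: (@continuous_comp _ _ _ (fun x => x - e) (fun t : R => Num.max t 0)).
  by apply: cvgB; [exact: cvg_id|exact: cvg_cst].
exact: continuous_maxr0.
Qed.

Lemma huber_le0 e t : 0 < e -> t <= 0 -> huber e t = 0.
Proof.
move=> e0 t0; rewrite /huber /sqpos !max_r//; first by rewrite expr0n/= subr0 mul0r.
by rewrite subr_le0 (le_trans t0)// ltW.
Qed.

Lemma dhuber_le0 e t : 0 < e -> t <= 0 -> dhuber e t = 0.
Proof.
move=> e0 t0; rewrite /dhuber !max_r//; first by rewrite subr0 mul0r.
by rewrite subr_le0 (le_trans t0)// ltW.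
Qed.

Lemma dhuber_ge e t : 0 < e -> e <= t -> dhuber e t = 1.
Proof.
move=> e0 et; rewrite /dhuber !max_l ?subr_ge0//; last by rewrite (le_trans _ et)// ltW.
by rewrite opprB addrCA subrr addr0 divff// gt_eqF.
Qed.

Lemma dhuber_bound e t : 0 < e -> 0 <= dhuber e t <= 1.
Proof.
move=> e0; rewrite /dhuber ler_pdivrMr// mul1r.
apply/andP; split; first (apply: mulr_ge0; last by rewrite invr_ge0 ltW);
  by case: (leP t 0) => t0; case: (leP (t - e) 0) => te; lra.
Qed.

Lemma huber_lip e s t : 0 < e -> `|huber e s - huber e t| <= `|s - t|.
Proof.
move=> e0; have e2 : 0 < 2 * e by rewrite mulr_gt0.
wlog st : s t / t <= s.
  by move=> h; have [|/ltW] := leP t s; [exact: h|rewrite distrC (distrC s); exact: h].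
rewrite (ger0_norm (_ : 0 <= s - t)) ?subr_ge0// /huber -mulrBl normrM.
rewrite (gtr0_norm (_ : 0 < (2 * e)^-1)) ?invr_gt0// ler_pdivrMr// ler_norml /sqpos.
case: (leP s 0) => s0; case: (leP t 0) => t0; case: (leP (s - e) 0) => se;
  case: (leP (t - e) 0) => te; apply/andP; split; nra.
Qed.

Lemma dhuber_lip e s t : 0 < e -> `|dhuber e s - dhuber e t| <= e^-1 * `|s - t|.
Proof.
move=> e0; rewrite /dhuber -mulrBl normrM (gtr0_norm (_ : 0 < e^-1)) ?invr_gt0//.
rewrite mulrC ler_pM2l ?invr_gt0//.
wlog st : s t / t <= s.
  by move=> h; have [|/ltW] := leP t s; [exact: h|rewrite distrC (distrC s); exact: h].
rewrite (ger0_norm (_ : 0 <= s - t)) ?subr_ge0// ler_norml.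
case: (leP s 0) => s0; case: (leP t 0) => t0; case: (leP (s - e) 0) => se;
  case: (leP (t - e) 0) => te; apply/andP; split; lra.
Qed.

Lemma huber_near e t : 0 < e -> `|huber e t - Num.max t 0| <= e.
Proof.
move=> e0; have e2 : 0 < 2 * e by rewrite mulr_gt0.
have -> : huber e t - Num.max t 0 = (sqpos t - sqpos (t - e) - Num.max t 0 * (2 * e)) / (2 * e).
  by rewrite /huber; field; rewrite gt_eqF.
rewrite normrM (gtr0_norm (_ : 0 < (2 * e)^-1)) ?invr_gt0// ler_pdivrMr// ler_norml /sqpos.
case: (leP t 0) => t0; case: (leP (t - e) 0) => te; apply/andP; split; nra.
Qed.

End positive_part.

Section C1_functions.
Context {R : realType} (V : normedModType R).
Implicit Types f g : V -> R.

Lemma derive_lin a f g x v : differentiable f x -> differentiable g x ->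
  'D_v (fun x => f x + a * g x) x = 'D_v f x + a * 'D_v g x.
Proof.
move=> df dg; rewrite (_ : (fun x => f x + a * g x) = f + a \*: g)//.
have df' := diff_derivable (v := v) df; have dg' := diff_derivable (v := v) dg.
by rewrite (deriveD df' (derivableZ dg')) (deriveZ _ dg').
Qed.

Lemma Ck1_lin a f g : Ck 1 f -> Ck 1 g -> Ck 1 (fun x => f x + a * g x).
Proof.
move=> [df cf] [dg cg].
have e : (fun x => f x + a * g x) = f + a \*: g by apply/funext.
rewrite e; split => [x|v].
  by apply: differentiableD => //; exact: differentiableZ.
rewrite (_ : (fun x => _) = fun x => 'D_v f x + a * 'D_v g x).
  apply: continuous_funD; first exact: cf.
  by apply: continuous_funM; [exact: cst_continuous|exact: cg].
by apply/funext => x; rewrite -derive_lin.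
Qed.

Lemma derive_comp1 (th th' : R -> R) f x v : (forall s : R, is_derive s 1 th (th' s)) ->
  differentiable f x -> 'D_v (fun x => th (f x)) x = th' (f x) * 'D_v f x.
Proof.
move=> dth df.
have dthx := is_derive_differentiable (dth (f x)).
rewrite (_ : (fun x => th (f x)) = th \o f)// derive_chain//.
rewrite -['D_v f x]mulr1 (_ : _ * 1 = 'D_v f x *: (1 : R))// derive_scale//.
by rewrite (@derive_val _ _ _ _ _ _ _ (dth (f x))) mulrC [_ *: 1]mulr1.
Qed.

Lemma Ck1_comp (th th' : R -> R) f : (forall s : R, is_derive s 1 th (th' s)) ->
  continuous th' -> Ck 1 f -> Ck 1 (fun x => th (f x)).
Proof.
move=> dth cth [df cf]; split => [x|v].
  apply: (@differentiable_comp _ _ _ _ f th) => //.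
  exact: is_derive_differentiable (dth (f x)).
rewrite (_ : (fun x => _) = fun x => th' (f x) * 'D_v f x).
  apply: continuous_funM; last exact: cf.
  move=> x; apply: (@continuous_comp _ _ _ f th'); last exact: cth.
  exact: differentiable_continuous.
by apply/funext => x; exact: derive_comp1.
Qed.

Lemma Ck1_continuous f : Ck 1 f -> continuous f.
Proof. by move=> [df _] x; exact: differentiable_continuous. Qed.

Lemma Ck1_cst (a : R) : Ck 1 (fun _ : V => a).
Proof.
split=> [x|v]; first exact: differentiable_cst.
have -> : 'D_v (fun _ : V => a) = fun=> 0 by apply/funext => x; rewrite derive_cst.
exact: cst_continuous.
Qed.

End C1_functions.

Lemma Ck1_coord {R : realType} n (i : 'I_n) : Ck 1 (fun x : 'rV[R]_n => x ord0 i).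
Proof.
split=> [x|v]; first exact: differentiable_coord.
rewrite (_ : (fun x => _) = fun=> v ord0 i); first exact: cst_continuous.
apply/funext => x.
by have := is_derive_coord ord0 i (is_derive_id x v) => -[].
Qed.

(** * Horizontal gradients and C^1 functions with compact support *)

Section horizontal_gradient.
Context {R : realType} (G : stratified_group R).
Local Notation V := 'rV[R]_(gdim G).
Local Notation N1 := (layer (ord0 : 'I_(last_layer G).+1)).
Implicit Types (f phi : V -> R) (x : V).

Lemma hgrad_lin a f phi x : Ck 1 f -> Ck 1 phi ->
  hgrad (fun x => f x + a * phi x) x = hgrad f x + a *: hgrad phi x.
Proof. by move=> [df _] [dp _]; apply/rowP => j; rewrite !mxE derive_lin. Qed.

Lemma hgrad_comp (th th' : R -> R) f x : (forall s : R, is_derive s 1 th (th' s)) ->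
  Ck 1 f -> hgrad (fun x => th (f x)) x = th' (f x) *: hgrad f x.
Proof.
by move=> dth [df _]; apply/rowP => j; rewrite !mxE (derive_comp1 _ dth).
Qed.

Lemma continuous_hgrad f : Ck 1 f -> continuous (hgrad f).
Proof.
move=> f1; apply: continuous_rVP => j.
rewrite (_ : (fun x => _) = fun x => 'D_(@hfield R G j x) f x).
  exact: continuous_derive_hfield_fun.
by apply/funext => x; rewrite mxE.
Qed.

Lemma box_support_hgrad M phi x : box_support M phi ->
  (exists i, M < `|x ord0 i|) -> hgrad phi x = 0.
Proof. by move=> phiM xM; apply/rowP => j; rewrite !mxE (box_support_derive _ phiM). Qed.

Lemma hgrad_first_coord (j : 'I_N1) x : hgrad (fun x => x ord0 (first_coord j)) x = delta_mx ord0 j.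
Proof.
apply/rowP => i; rewrite mxE delta_rVE.
have := is_derive_coord ord0 (first_coord j) (is_derive_id x (hfield i x)) => -[_ ->].
by rewrite -/(hcoef i (first_coord j) x) hcoef_first eq_sym.
Qed.

Variable Omega : set V.

Lemma C01_Ck1 phi : C01 Omega phi -> Ck 1 phi. Proof. by case. Qed.

Lemma C01_sub f phi : Ck 1 f -> C01 Omega phi -> (forall x, phi x = 0 -> f x = 0) ->
  C01 Omega f.
Proof.
move=> f1 [_ cphi phiO] fphi.
have sub : closure [set x | f x != 0] `<=` closure [set x | phi x != 0].
  apply: closure_subset => x /=; apply: contra => /eqP /fphi ->.
  by rewrite eqxx.
split=> //; last exact: subset_trans phiO.
by apply: subclosed_compact cphi sub; exact: closed_closure.
Qed.

Lemma C01_lin a f phi : C01 Omega f -> C01 Omega phi ->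
  C01 Omega (fun x => f x + a * phi x).
Proof.
move=> [f1 cf fO] [p1 cp pO].
have sub : closure [set x | f x + a * phi x != 0] `<=`
    closure [set x | f x != 0] `|` closure [set x | phi x != 0].
  rewrite -closureU; apply: closure_subset => x /= h.
  have [fx|fx] := eqVneq (f x) 0; [right|by left].
  by apply: contra h => /eqP px; rewrite fx px mulr0 addr0.
split; first exact: Ck1_lin.
  apply: subclosed_compact sub; first exact: closed_closure.
  exact: compactU.
by apply: subset_trans sub _ => x [/fO|/pO].
Qed.

Lemma C01_cst0 : C01 Omega (fun=> 0).
Proof.
have e : [set x : V | (0 : R) != 0] = set0.
  by apply/seteqP; split => x //=; rewrite eqxx.
split; first exact: Ck1_cst.
  by rewrite e closure0; exact: compact0.
by rewrite e closure0.
Qed.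

Lemma C01_supp phi x : C01 Omega phi -> phi x != 0 -> Omega x.
Proof. by move=> [_ _ phiO] px; apply/phiO/subset_closure. Qed.

Lemma bounded_box : bounded_set Omega ->
  exists2 M, 0 <= M & forall x, Omega x -> forall i, `|x ord0 i| <= M.
Proof.
move=> [M [_ /(_ (`|M| + 1))]]; have -> : M < `|M| + 1 by have := ler_norm M; lra.
move=> /(_ isT) bO; exists (`|M| + 1); first by rewrite addr_ge0.
move=> x Ox i; apply: le_trans (bO x Ox).
by rewrite [leRHS]/Num.Def.normr /= mx_normrE; exact: (le_bigmax _ (fun ij => `|x ij.1 ij.2|) (ord0, i)).
Qed.

End horizontal_gradient.

(** * Truncation is stable in L^q *)

Section Lq_near.
Context {R : realType} d (T : measurableType d) (mu : {measure set T -> \bar R}) (D : set T).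
Hypothesis mD : measurable D.
Local Notation intg f := (mu.-integrable D (EFin \o f)).
Local Notation "'I' f" := (rint mu D f) (at level 10, f at level 9).
Variables (N : nat) (q : R).
Hypothesis q1 : 1 < q.
Implicit Types (u w z v : T -> R) (g k l gam : T -> 'rV[R]_N) (e : R).

Let q0 : 0 < q. Proof. by rewrite (lt_trans _ q1). Qed.
Let K0 : 0 < 2 `^ q :> R. Proof. by rewrite powR_gt0. Qed.

Let normr_powR_le1 (a : R) : `|a| <= 1 -> `|a| `^ q <= 1.
Proof.
move=> a1; have : `|a| `^ q <= 1 `^ q by apply: ge0_ler_powR; rewrite ?nnegrE ?(ltW q0).
by rewrite powR1.
Qed.

(** Closeness of pairs is measured by integrals of q-th powers, without roots; the triangle
    inequality [Lq_near_trans] therefore has the factor 2^q. *)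
Definition Lq_near u g w k e := [/\ intg (fun x => `|w x - u x| `^ q),
  intg (normq q (fun x => k x - g x)) &
  I (fun x => `|w x - u x| `^ q) <= e /\ I (normq q (fun x => k x - g x)) <= e].

Lemma measurable_normr_powR u : measurable_fun D u -> measurable_fun D (fun x => `|u x| `^ q).
Proof. by move=> mu_; apply: measurable_fun_powR => //; exact: measurable_fun_normr. Qed.

Lemma normr_powR_double (a b : R) : `|a + b| `^ q <= 2 `^ q * (`|a| `^ q + `|b| `^ q).
Proof.
apply: le_trans (powR_double (ltW q0) (normr_ge0 a) (normr_ge0 b)).
by apply: ge0_ler_powR; rewrite ?nnegrE ?(ltW q0) ?addr_ge0// ler_normD.
Qed.

Lemma rint_dom_sum (a b c : T -> R) C : measurable_fun D a -> intg b -> intg c ->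
  (forall x, D x -> 0 <= a x) -> (forall x, D x -> a x <= C * (b x + c x)) ->
  intg a /\ I a <= C * (I b + I c).
Proof.
move=> ma ib ic a0 aC; have ibc := intgZ mD C (intgD mD ib ic).
have ia : intg a by apply: (intg_le mD ma ibc) => x Dx; rewrite ger0_norm ?aC ?a0.
by split => //; rewrite -(rintD mD ib ic) -(rintZ mD _ (intgD mD ib ic)); exact: rint_le.
Qed.

Lemma Lq_near_trans u g w k z l e1 e2 :
  measurable_fun D u -> measurable_fun D g -> measurable_fun D z -> measurable_fun D l ->
  Lq_near u g w k e1 -> Lq_near w k z l e2 -> Lq_near u g z l (2 `^ q * (e1 + e2)).
Proof.
move=> mu_ mg mz ml [i1 i2 [h1 h2]] [i3 i4 [h3 h4]].
have [j1 H1] : intg (fun x => `|z x - u x| `^ q) /\ I (fun x => `|z x - u x| `^ q) <=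
    2 `^ q * (I (fun x => `|w x - u x| `^ q) + I (fun x => `|z x - w x| `^ q)).
  apply: rint_dom_sum => // [|x _].
  - by apply: measurable_normr_powR; apply: measurable_funB.
  - rewrite (_ : z x - u x = (w x - u x) + (z x - w x)); first exact: normr_powR_double.
    by ring.
have [j2 H2] : intg (normq q (fun x => l x - g x)) /\ I (normq q (fun x => l x - g x)) <=
    2 `^ q * (I (normq q (fun x => k x - g x)) + I (normq q (fun x => l x - k x))).
  apply: rint_dom_sum => // [|x _|x _].
  - by apply: measurable_normq => //; exact: measurable_rVB.
  - exact: normq_ge0.
  - rewrite !normqE (_ : l x - g x = (k x - g x) + (l x - k x)); first exact: euclid_norm_powR_double.
    by rewrite [RHS]addrC addrA subrK.
split=> //; split; [apply: le_trans H1 _|apply: le_trans H2 _];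
  by rewrite ler_pM2l// lerD.
Qed.

Lemma Lq_near_lin a u g u' g' w k w' k' e :
  measurable_fun D u -> measurable_fun D g -> measurable_fun D w -> measurable_fun D k ->
  measurable_fun D u' -> measurable_fun D g' -> measurable_fun D w' -> measurable_fun D k' ->
  Lq_near u g u' g' e -> Lq_near w k w' k' e ->
  Lq_near (fun x => u x + a * w x) (fun x => g x + a *: k x)
    (fun x => u' x + a * w' x) (fun x => g' x + a *: k' x) (2 `^ q * (e + `|a| `^ q * e)).
Proof.
move=> m1 m2 m3 m4 m5 m6 m7 m8 [i1 i2 [h1 h2]] [i3 i4 [h3 h4]].
have aq : 0 <= `|a| `^ q by exact: powR_ge0.
have [j1 H1] : intg (fun x => `|u' x + a * w' x - (u x + a * w x)| `^ q) /\
    I (fun x => `|u' x + a * w' x - (u x + a * w x)| `^ q) <=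
    2 `^ q * (I (fun x => `|u' x - u x| `^ q) + I (fun x => `|a| `^ q * `|w' x - w x| `^ q)).
  apply: rint_dom_sum => // [| |x _].
  - apply: measurable_normr_powR; apply: measurable_funB; apply: measurable_funD => //;
      by apply: measurable_funM.
  - exact: intgZ.
  - rewrite (_ : _ - _ = (u' x - u x) + a * (w' x - w x)); last by ring.
    by rewrite -powRM// -normrM; exact: normr_powR_double.
have [j2 H2] : intg (normq q (fun x => g' x + a *: k' x - (g x + a *: k x))) /\
    I (normq q (fun x => g' x + a *: k' x - (g x + a *: k x))) <=
    2 `^ q * (I (normq q (fun x => g' x - g x)) + I (fun x => `|a| `^ q * normq q (fun x => k' x - k x) x)).
  apply: rint_dom_sum => // [| |x _|x _].
  - by apply: measurable_normq => //; apply: measurable_rVB => //; apply: measurable_rVD => //; exact: measurable_rVZ.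
  - exact: intgZ.
  - exact: normq_ge0.
  - rewrite !normqE (_ : _ + _ - _ = (g' x - g x) + a *: (k' x - k x)); last first.
      by rewrite scalerBr opprD !addrA; congr (_ - _); rewrite addrAC.
    by rewrite -powRM ?euclid_norm_ge0// -euclid_normZ; exact: euclid_norm_powR_double.
rewrite (rintZ mD _ i3) in H1; rewrite (rintZ mD _ i4) in H2.
split=> //; split; [apply: le_trans H1 _|apply: le_trans H2 _];
  by rewrite ler_pM2l// lerD// ler_wpM2l.
Qed.

Lemma Lq_near_intg u g w k e :
  measurable_fun D u -> measurable_fun D g -> measurable_fun D w -> measurable_fun D k ->
  intg (fun x => `|w x| `^ q) -> intg (normq q k) -> Lq_near u g w k e ->
  intg (fun x => `|u x| `^ q) /\ intg (normq q g).
Proof.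
move=> mu_ mg mw mk iw ik [i1 i2 _]; split.
  have [//] : intg (fun x => `|u x| `^ q) /\ I (fun x => `|u x| `^ q) <=
      2 `^ q * (I (fun x => `|w x| `^ q) + I (fun x => `|w x - u x| `^ q)).
  apply: rint_dom_sum => // [|x _].
  - exact: measurable_normr_powR.
  - rewrite -[in leRHS](normrN (w x - u x)) -[in leLHS](subKr (w x) (u x)).
    exact: normr_powR_double.
have [//] : intg (normq q g) /\ I (normq q g) <=
    2 `^ q * (I (normq q k) + I (normq q (fun x => k x - g x))).
apply: rint_dom_sum => // [|x _|x _].
- exact: measurable_normq.
- exact: normq_ge0.
- rewrite !normqE -[in leRHS](euclid_normN (k x - g x)) -[in leLHS](subKr (k x) (g x)).
  exact: euclid_norm_powR_double.
Qed.

Let rint_small (f_ : (T -> R)^nat) f e : (forall n, measurable_fun D (f_ n)) ->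
  (forall x, D x -> f_ ^~ x @ \oo --> (0 : R)) -> intg f ->
  (forall n x, D x -> `|f_ n x| <= f x) -> 0 < e ->
  \forall n \near \oo, I (f_ n) <= e.
Proof.
move=> mf cf if_ ff e0.
have := @Rintegral_dominated_cvg _ _ _ mu D mD f_ (fun=> 0) f mf (measurable_cst _) cf if_ ff.
rewrite Rintegral_cst// mul0r => /(@cvgr_le _ _ _ _ _ 0)/(_ _ e0).
by apply: filterS => n; rewrite rintE.
Qed.

Let Gtail u : measurable_fun D u -> intg u -> (forall x, D x -> 0 <= u x) -> forall e, 0 < e ->
  exists H : nat, I (fun x => Num.max (u x - H%:R) 0) <= e.
Proof.
move=> mu_ iu u0 e e0; apply: (filter_ex (F := \oo)).
apply: (@rint_small (fun n x => Num.max (u x - n%:R) 0) u) => //.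
- by move=> n; apply: measurable_maxr => //; apply: measurable_funB.
- move=> x Dx; apply: cvg_near_cst.
  have um := archi_boundP (u0 x Dx); exists (Num.bound (u x)) => // n /= mn.
  apply/max_idPr; rewrite subr_le0.
  by apply: le_trans (ltW um) _; rewrite ler_nat.
- move=> n x Dx; rewrite ger0_norm ?le_max ?lexx ?orbT// ge_max u0// andbT.
  by rewrite gerBl.
Qed.

(** With a and b the two values of the derivative, the difference of the gradients is a (k - g) + (a
    - b) (g - gam). In the second term |a - b| is at most 1 and at most |w - u| / eps: the first
    bound is used on the part of |g - gam|^q above a level H, whose integral is small, and the
    second one below H, which produces the constant [B]. *)
Lemma Lq_near_huber eps u g v gam e : 0 < eps ->
  measurable_fun D u -> measurable_fun D g -> measurable_fun D v -> measurable_fun D gam ->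
  intg (normq q (fun x => g x - gam x)) -> 0 < e -> exists2 dlt, 0 < dlt & forall w k,
  measurable_fun D w -> measurable_fun D k -> Lq_near u g w k dlt ->
  Lq_near (fun x => huber eps (u x - v x)) (fun x => dhuber eps (u x - v x) *: (g x - gam x))
    (fun x => huber eps (w x - v x)) (fun x => dhuber eps (w x - v x) *: (k x - gam x)) e.
Proof.
move=> eps0 mu_ mg mv mgam iG e0; have := K0; set K := 2 `^ q => K0'.
pose Gf := normq q (fun x => g x - gam x).
have mGf : measurable_fun D Gf by apply: measurable_normq => //; exact: measurable_rVB.
have G0 x : D x -> 0 <= Gf x by move=> _; exact: normq_ge0.
have e1 : 0 < e / (2 * K) by rewrite divr_gt0// mulr_gt0.
have [H HG] := Gtail mGf iG G0 e1.
set B := H%:R * eps^-1 `^ q.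
have B0 : 0 <= B by rewrite mulr_ge0// powR_ge0.
pose dlt := Num.min e (e / (2 * K) / (1 + B)).
have mhub : measurable_fun setT (huber eps).
  apply: continuous_measurable_fun.
  exact: (is_derive_continuous (fun t => is_derive_huber t eps0)).
have mdhub : measurable_fun setT (dhuber eps).
  by apply: continuous_measurable_fun; exact: continuous_dhuber.
exists dlt; first by rewrite lt_min e0 divr_gt0// ltr_pwDl.
move=> w k mw mk [i1 i2 [h1 h2]].
have [d1 d2] : dlt <= e /\ dlt * (1 + B) <= e / (2 * K).
  by rewrite -ler_pdivlMr ?ltr_pwDl// /dlt; split; rewrite ge_min lexx ?orbT.
have muv : measurable_fun D (fun x => u x - v x) by exact: measurable_funB.
have mwv : measurable_fun D (fun x => w x - v x) by exact: measurable_funB.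
have mh s : measurable_fun D s -> measurable_fun D (fun x => huber eps (s x)).
  by move=> ms; exact: (measurableT_comp mhub ms).
have mdh s : measurable_fun D s -> measurable_fun D (fun x => dhuber eps (s x)).
  by move=> ms; exact: (measurableT_comp mdhub ms).
have hle x : `|huber eps (w x - v x) - huber eps (u x - v x)| <= `|w x - u x|.
  by have := huber_lip (w x - v x) (u x - v x) eps0; rewrite opprB addrA subrK.
have dle x : `|dhuber eps (w x - v x) - dhuber eps (u x - v x)| <= eps^-1 * `|w x - u x|.
  by have := dhuber_lip (w x - v x) (u x - v x) eps0; rewrite opprB addrA subrK.
have d01 x : `|dhuber eps (w x - v x) - dhuber eps (u x - v x)| <= 1.
  have /andP[] := dhuber_bound (w x - v x) eps0; have /andP[] := dhuber_bound (u x - v x) eps0.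
  by move=> *; rewrite ler_norml; apply/andP; split; lra.
have [j1 H1] : intg (fun x => `|huber eps (w x - v x) - huber eps (u x - v x)| `^ q) /\
    I (fun x => `|huber eps (w x - v x) - huber eps (u x - v x)| `^ q) <= e.
  have mm : measurable_fun D (fun x => `|huber eps (w x - v x) - huber eps (u x - v x)| `^ q).
    by apply: measurable_normr_powR; apply: measurable_funB; exact: mh.
  have pw x : `|huber eps (w x - v x) - huber eps (u x - v x)| `^ q <= `|w x - u x| `^ q.
    by apply: ge0_ler_powR; rewrite ?nnegrE ?(ltW q0).
  have ii : intg (fun x => `|huber eps (w x - v x) - huber eps (u x - v x)| `^ q).
    by apply: (intg_le mD mm i1) => x _; rewrite ger0_norm ?powR_ge0.
  split=> //; apply: le_trans (le_trans h1 d1); exact: rint_le.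
pose r x := `|dhuber eps (w x - v x) - dhuber eps (u x - v x)| `^ q * Gf x.
have r0 x : 0 <= r x by apply: mulr_ge0; [exact: powR_ge0|exact: normq_ge0].
have rG x : `|dhuber eps (w x - v x) - dhuber eps (u x - v x)| `^ q <= 1.
  exact: normr_powR_le1.
have mr : measurable_fun D r.
  by apply: measurable_funM => //; apply: measurable_normr_powR; apply: measurable_funB; exact: mdh.
have ir : intg r.
  apply: (intg_le mD mr iG) => x _; rewrite (ger0_norm (r0 x)) /r.
  by rewrite -[leRHS]mul1r ler_wpM2r// normq_ge0.
have iGH : intg (fun x => Num.max (Gf x - H%:R) 0).
  apply: (intg_le mD _ iG); first by apply: measurable_maxr => //; apply: measurable_funB.
  move=> x Dx; rewrite ger0_norm ?le_max ?lexx ?orbT// ge_max G0// andbT.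
  by rewrite gerBl.
have Ir : I r <= e / (2 * K) + B * dlt.
  have iB := intgZ mD B i1.
  apply: le_trans (_ : I (fun x => Num.max (Gf x - H%:R) 0 + B * `|w x - u x| `^ q) <= _).
    apply: rint_le => // [|x Dx]; first exact: intgD.
    have HM : Gf x <= Num.max (Gf x - H%:R) 0 + H%:R by rewrite -lerBlDr le_max lexx.
    have M0 : 0 <= Num.max (Gf x - H%:R) 0 by rewrite le_max lexx orbT.
    apply: le_trans (ler_wpM2l (powR_ge0 _ _) HM) _; rewrite mulrDr; apply: lerD.
      by rewrite -[leRHS]mul1r ler_wpM2r.
    rewrite mulrC /B -mulrA ler_wpM2l// -powRM ?invr_ge0 ?(ltW eps0)//.
    by apply: ge0_ler_powR; rewrite ?nnegrE ?(ltW q0)// mulr_ge0// invr_ge0 ltW.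
  by rewrite rintD// (rintZ mD _ i1) lerD// ler_wpM2l.
have [j2 H2] : intg (normq q (fun x => dhuber eps (w x - v x) *: (k x - gam x) -
      dhuber eps (u x - v x) *: (g x - gam x))) /\
    I (normq q (fun x => dhuber eps (w x - v x) *: (k x - gam x) -
      dhuber eps (u x - v x) *: (g x - gam x))) <=
    K * (I (normq q (fun x => k x - g x)) + I r).
  apply: rint_dom_sum => // [|x _|x _].
  - apply: measurable_normq => //; apply: measurable_rVB => //; apply: measurable_rVZfun => //;
      by [exact: mdh|exact: measurable_rVB].
  - exact: normq_ge0.
  - rewrite !normqE; set a := dhuber _ (w x - v x); set b := dhuber _ (u x - v x).
    rewrite (_ : a *: _ - _ = a *: (k x - g x) + (a - b) *: (g x - gam x)); last first.
      rewrite scalerBl addrA -scalerDr; congr (a *: _ - _).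
      by rewrite addrA subrK.
    apply: le_trans (euclid_norm_powR_double q1 _ _) _; rewrite ler_pM2l// lerD//.
      have /andP[a0 a1] := dhuber_bound (w x - v x) eps0.
      rewrite euclid_normZ ger0_norm//; have n0 := euclid_norm_ge0 (k x - g x).
      by apply: ge0_ler_powR; rewrite ?nnegrE ?(ltW q0)//; [exact: mulr_ge0|rewrite ler_piMl].
    by rewrite euclid_normZ powRM ?euclid_norm_ge0// /r /Gf normqE.
split=> //; split => //; apply: le_trans H2 _.
have : K * (dlt + (e / (2 * K) + B * dlt)) <= e.
  have -> : K * (dlt + (e / (2 * K) + B * dlt)) = K * (dlt * (1 + B)) + e / 2.
    by field; rewrite gt_eqF.
  have : K * (dlt * (1 + B)) <= K * (e / (2 * K)) by rewrite ler_pM2l.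
  have -> : K * (e / (2 * K)) = e / 2 by field; rewrite gt_eqF.
  lra.
by apply: le_trans; rewrite ler_pM2l// lerD.
Qed.

(** Dominated convergence as eps tends to 0. The derivative of the Huber function vanishes at 0 for
    every eps, which is why the limit gradient is 0 on the set u = v. *)
Lemma Lq_near_huber0 u g v gam e : (mu D < +oo)%E ->
  measurable_fun D u -> measurable_fun D g -> measurable_fun D v -> measurable_fun D gam ->
  intg (normq q (fun x => g x - gam x)) -> 0 < e -> exists2 eps, 0 < eps &
  Lq_near (fun x => Num.max (u x - v x) 0) (fun x => if v x < u x then g x - gam x else 0)
    (fun x => huber eps (u x - v x)) (fun x => dhuber eps (u x - v x) *: (g x - gam x)) e.
Proof.
move=> finD mu_ mg mv mgam iG e0.
pose ep (n : nat) : R := n.+1%:R^-1.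
have ep0 n : 0 < ep n by rewrite invr_gt0.
have ep1 n : ep n <= 1 by rewrite invf_le1// ler1n.
have muv : measurable_fun D (fun x => u x - v x) by exact: measurable_funB.
have mh n : measurable_fun D (fun x => huber (ep n) (u x - v x)).
  apply: (measurableT_comp _ muv); apply: continuous_measurable_fun.
  exact: (is_derive_continuous (fun t => is_derive_huber t (ep0 n))).
have mdh n : measurable_fun D (fun x => dhuber (ep n) (u x - v x)).
  by apply: (measurableT_comp _ muv); apply: continuous_measurable_fun; exact: continuous_dhuber.
have mgg : measurable_fun D (fun x => g x - gam x) by exact: measurable_rVB.
pose a n x := `|huber (ep n) (u x - v x) - Num.max (u x - v x) 0| `^ q.
pose b n := normq q (fun x => dhuber (ep n) (u x - v x) *: (g x - gam x) -
  (if v x < u x then g x - gam x else 0)).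
have ma n : measurable_fun D (a n).
  by apply: measurable_normr_powR; apply: measurable_funB => //; apply: measurable_maxr.
have mb n : measurable_fun D (b n).
  apply: measurable_normq => //; apply: measurable_rVB => //; first exact: measurable_rVZfun.
  by apply: measurable_fun_ite => //; exact: measurable_fun_ltr.
have epc : ep @ \oo --> (0 : R) by exact: cvg_harmonic.
have ale n x : D x -> `|a n x| <= 1.
  move=> _; rewrite ger0_norm ?powR_ge0//; apply: normr_powR_le1.
  exact: le_trans (huber_near _ (ep0 n)) (ep1 n).
have i1 : intg (fun=> 1 : R) by exact: intg_cst.
have ac x : D x -> a ^~ x @ \oo --> (0 : R).
  move=> _; have epq : (fun n => `|ep n| `^ q) @ \oo --> (0 : R).
    rewrite -[X in _ --> X](@powR0 _ q) ?gt_eqF// -[X in X `^ q](@normr0 _ R).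
    exact: (cvg_comp _ _ epc (@continuous_normr_powR R q q0 0)).
  apply: (squeeze_cvgr _ (cvg_cst 0) epq); apply: nearW => n; rewrite powR_ge0/=.
  apply: ge0_ler_powR; rewrite ?nnegrE ?(ltW q0)// (gtr0_norm (ep0 n)).
  exact: huber_near.
have bE n x : b n x = `|dhuber (ep n) (u x - v x) - (v x < u x)%R%:R| `^ q * normq q (fun x => g x - gam x) x.
  rewrite /b !normqE -powRM ?euclid_norm_ge0// -euclid_normZ; congr (euclid_norm _ `^ q).
  by rewrite scalerBl; case: ltP; rewrite ?scale1r ?scale0r.
have ble n x : D x -> `|b n x| <= normq q (fun x => g x - gam x) x.
  move=> _; rewrite bE normrM (ger0_norm (normq_ge0 _ _ _)) (ger0_norm (powR_ge0 _ _)).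
  rewrite -[leRHS]mul1r ler_wpM2r ?normq_ge0//; apply: normr_powR_le1.
  have /andP[d0 d1] := dhuber_bound (u x - v x) (ep0 n).
  by rewrite ler_norml; case: (v x < u x) => /=; apply/andP; split; lra.
have bc x : D x -> b ^~ x @ \oo --> (0 : R).
  move=> _; apply: cvg_near_cst; have [vu|uv] := ltP (v x) (u x).
    have uv0 : 0 < u x - v x by rewrite subr_gt0.
    near=> n; rewrite bE vu dhuber_ge ?subrr ?normr0 ?powR0 ?mul0r ?gt_eqF//.
    by near: n; apply: (cvgr_le _ epc).
  apply: nearW => n; rewrite bE dhuber_le0 ?subr_le0// ltNge uv/= subr0 normr0 powR0 ?mul0r//.
  by rewrite gt_eqF.
have [n [an bn]] : exists n, I (a n) <= e /\ I (b n) <= e.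
  apply: (filter_ex (F := \oo)); apply: filterI.
    exact: (rint_small ma ac i1 ale e0).
  exact: (rint_small mb bc iG ble e0).
exists (ep n) => //; split => //.
- exact: (intg_le mD (ma n) i1 (ale n)).
- exact: (intg_le mD (mb n) iG (ble n)).
Unshelve. all: by end_near. Qed.

End Lq_near.

(** * The space W_0^{1,q} *)

Lemma cvge0P {R : realType} (a : (\bar R)^nat) : (forall k, (0 <= a k)%E) ->
  (a @ \oo --> 0%E <-> forall e : R, 0 < e -> \forall k \near \oo, (a k <= e%:E)%E).
Proof.
move=> a0; split=> [/fine_cvgP[afin ca] e e0|H].
  apply: filterS (filterI afin (cvgr_le _ ca _ e0)) => k [ak].
  by rewrite -{1}(fineK ak) lee_fin.
have afin : \forall k \near \oo, a k \is a fin_num.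
  apply: filterS (H 1 ltr01) => k ak.
  by rewrite ge0_fin_numE ?(le_lt_trans ak) ?ltry.
apply/fine_cvgP; split => //; apply/cvgrPdist_le => e e0.
apply: filterS (filterI afin (H e e0)) => k [ak]; rewrite -{1}(fineK ak) lee_fin => h.
by rewrite sub0r normrN /= ger0_norm// fine_ge0.
Qed.

Section W01_space.
Context {R : realType} (G : stratified_group R).
Local Notation V := 'rV[R]_(gdim G).
Local Notation N1 := (layer (ord0 : 'I_(last_layer G).+1)).
Local Notation mu := (lebesgue_rV (gdim G)).
Variables (q : R) (Omega : set V).
Hypothesis q1 : 1 < q.
Hypothesis oO : open Omega.
Hypothesis bO : bounded_set Omega.
Local Notation intg f := (mu.-integrable Omega (EFin \o f)).
Local Notation "'I' f" := (rint mu Omega f) (at level 10, f at level 9).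
Local Notation near_ u g w k e := (@Lq_near R _ _ mu Omega N1 q u g w k e).
Implicit Types (u w psi phi v : V -> R) (g k h : V -> 'rV[R]_N1).

Let q0 : 0 < q. Proof. by rewrite (lt_trans _ q1). Qed.
Let mO : measurable Omega. Proof. exact: open_measurable_rV. Qed.

Lemma bounded_lebesgue_lty : (mu Omega < +oo)%E.
Proof.
have [M M0 OM] := bounded_box bO.
apply: le_lt_trans (lebesgue_rV_cube_lty (gdim G) M).
apply: le_measure; rewrite ?inE//; first exact: measurable_cube.
by move=> x Ox i; rewrite /= in_itv/= -ler_norml OM.
Qed.

Lemma C01_box_support phi : C01 Omega phi -> exists2 M, 0 <= M & box_support M phi.
Proof.
move=> Cphi; have [M M0 OM] := bounded_box bO; exists M => // x [i xi].
apply/eqP; apply: contraTT xi => px; rewrite -leNgt; apply: OM.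
exact: C01_supp Cphi px.
Qed.

Lemma continuous_measurable_hgrad f : Ck 1 f -> measurable_fun Omega (@hgrad R G f).
Proof.
move=> f1; apply/measurable_fun_rVP => // i; apply: measurable_funTS.
apply: continuous_measurable_rV => x.
exact: (cvg_comp _ _ (continuous_hgrad f1 (x:=x)) (@coord_continuous R 1 N1 ord0 i _)).
Qed.

Lemma continuous_measurable_Ck1 f : Ck 1 f -> measurable_fun Omega (f : V -> R).
Proof.
by move=> f1; apply: measurable_funTS; apply: continuous_measurable_rV; exact: Ck1_continuous.
Qed.

Lemma intg_box_support f M : 0 <= M -> continuous f -> box_support M f ->
  intg (f : V -> R).
Proof.
move=> M0 cf fM; apply: (@integrableS _ _ _ mu setT) => //.
exact: integrable_box_support fM.
Qed.

Lemma C01_intg phi : C01 Omega phi -> intg (fun x => `|phi x| `^ q) /\ intg (normq q (hgrad phi)).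
Proof.
move=> Cphi; have [M M0 pM] := C01_box_support Cphi; have p1 := C01_Ck1 Cphi.
split; apply: (intg_box_support M0).
- move=> x; exact: (cvg_comp _ _ (Ck1_continuous p1 (x:=x)) (continuous_normr_powR q0 (x:=phi x))).
- by move=> x xM; rewrite pM// normr0 powR0// gt_eqF.
- by rewrite normq_fun; apply: continuous_euclid_norm_powR => //; exact: continuous_hgrad.
- by move=> x xM; rewrite normqE (box_support_hgrad pM)// euclid_norm0 powR0// gt_eqF.
Qed.

(** The approximating sequence in epsilon form; accuracies 1/(k+1) give a sequence back. *)
Lemma W01P u g : W01 q Omega u g <-> [/\ measurable_fun Omega u, measurable_fun Omega g &
  forall e : R, 0 < e -> exists2 phi, C01 Omega phi & near_ u g phi (hgrad phi) e].
Proof.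
have a0 (f : V -> R) : (0 <= \int[mu]_(x in Omega) (`|f x| `^ q)%:E)%E.
  by apply: integral_ge0 => x _; rewrite lee_fin powR_ge0.
have b0 (f : V -> 'rV[R]_N1) : (0 <= \int[mu]_(x in Omega) (euclid_norm (f x) `^ q)%:E)%E.
  by apply: integral_ge0 => x _; rewrite lee_fin powR_ge0.
split=> [[mu_ mg [phi [Cphi c1 c2]]]|[mu_ mg H]]; split => //.
  move=> e e0; move/(cvge0P (fun i => a0 (fun x => phi i x - u x))) : c1 => /(_ e e0) c1.
  move/(cvge0P (fun i => b0 (fun x => hgrad (phi i) x - g x))) : c2 => /(_ e e0) c2.
  have [k [ak bk]] := filter_ex (filterI c1 c2); exists (phi k) => //.
  have p1 := C01_Ck1 (Cphi k).
  have ma : measurable_fun Omega (fun x => `|phi k x - u x| `^ q).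
    by apply: measurable_normr_powR; apply: measurable_funB => //; exact: continuous_measurable_Ck1.
  have [i1 h1] := ge0_intg_bounded mO ma (fun x _ => powR_ge0 _ _) ak.
  have mb : measurable_fun Omega (fun x => euclid_norm (hgrad (phi k) x - g x) `^ q).
    rewrite -(normq_fun q (fun x => hgrad (phi k) x - g x)); apply: measurable_normq => //.
    by apply: measurable_rVB => //; exact: continuous_measurable_hgrad.
  have [i2 h2] := ge0_intg_bounded mO mb (fun x _ => powR_ge0 _ _) bk.
  by split; rewrite ?rintE ?normq_fun.
have /choice[phi Hphi] : forall k : nat, exists phi, C01 Omega phi /\ near_ u g phi (hgrad phi) (k.+1%:R^-1).
  by move=> k; have [|phi ? ?] := H (k.+1%:R^-1); [rewrite invr_gt0|exists phi].
have small (a : (\bar R)^nat) : (forall i, (0 <= a i)%E) -> (forall i, (a i <= (i.+1%:R^-1)%:E)%E) ->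
    a @ \oo --> 0%E.
  move=> aa0 aa; apply/(cvge0P aa0) => e e0.
  apply: filterS (cvgr_le _ (@cvg_harmonic R) _ e0) => i ie.
  by apply: le_trans (aa i) _; rewrite lee_fin.
exists phi; split => [k||]; first by case: (Hphi k).
  apply: small => k; first exact: (a0 (fun x => phi k x - u x)).
  by have [_ [i1 _ [h1 _]]] := Hphi k; rewrite intg_EFin// lee_fin -rintE.
apply: small => k; first exact: (b0 (fun x => hgrad (phi k) x - g x)).
have [_ [_ i1 [_ h1]]] := Hphi k; rewrite normq_fun in i1 h1.
by rewrite intg_EFin// lee_fin -rintE.
Qed.

Lemma W01_measurable u g : W01 q Omega u g -> measurable_fun Omega u.
Proof. by case. Qed.

Lemma W01_measurable_grad u g : W01 q Omega u g -> measurable_fun Omega g.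
Proof. by case. Qed.

Let W01_intg2 u g : W01 q Omega u g -> intg (fun x => `|u x| `^ q) /\ intg (normq q g).
Proof.
move=> /W01P[mu_ mg /(_ 1 ltr01)[phi Cphi h]]; have [i1 i2] := C01_intg Cphi.
have p1 := C01_Ck1 Cphi.
by apply: (Lq_near_intg mO q1 mu_ mg _ _ i1 i2 h);
  [exact: continuous_measurable_Ck1|exact: continuous_measurable_hgrad].
Qed.

Lemma W01_intg u g : W01 q Omega u g -> intg (fun x => `|u x| `^ q).
Proof. by move/W01_intg2 => []. Qed.

Lemma W01_intg_grad u g : W01 q Omega u g -> intg (normq q g).
Proof. by move/W01_intg2 => []. Qed.

Lemma C01_W01 phi : C01 Omega phi -> W01 q Omega phi (hgrad phi).
Proof.
move=> Cphi; have p1 := C01_Ck1 Cphi; apply/W01P; split.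
- exact: continuous_measurable_Ck1.
- exact: continuous_measurable_hgrad.
- move=> e e0; exists phi => //.
  have i0 : intg (fun=> 0 : R) by exact: (intg_cst mO _ bounded_lebesgue_lty).
  have I0 : I (fun=> 0) = 0 by rewrite (rint_cst mu mO) mul0r.
  have z1 : (fun x => `|phi x - phi x| `^ q) = fun=> 0.
    by apply/funext => x; rewrite subrr normr0 powR0// gt_eqF.
  have z2 : normq q (fun x => hgrad phi x - hgrad phi x) = fun=> 0.
    by apply/funext => x; rewrite normqE subrr euclid_norm0 powR0// gt_eqF.
  by split; rewrite ?z1 ?z2 ?I0 // ltW.
Qed.

Lemma W01_0 : W01 q Omega (fun=> 0) (fun=> 0).
Proof.
have := C01_W01 (@C01_cst0 R G Omega); congr W01.
by apply/funext => x; apply/rowP => j; rewrite !mxE derive_cst.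
Qed.

Let K0 : 0 < 2 `^ q :> R. Proof. by rewrite powR_gt0. Qed.

Lemma W01_lin a u g w k : W01 q Omega u g -> W01 q Omega w k ->
  W01 q Omega (fun x => u x + a * w x) (fun x => g x + a *: k x).
Proof.
move=> /W01P[mu_ mg Hu] /W01P[mw mk Hw]; apply/W01P; split.
- by apply: measurable_funD => //; apply: measurable_funM.
- by apply: measurable_rVD => //; exact: measurable_rVZ.
- move=> e e0; have a1 : 0 < 1 + `|a| `^ q by rewrite ltr_pwDl// powR_ge0.
  pose d := e / (2 `^ q * (1 + `|a| `^ q)); have d0 : 0 < d by rewrite divr_gt0// mulr_gt0.
  have [phi Cphi hu] := Hu d d0; have [chi Cchi hw] := Hw d d0.
  exists (fun x => phi x + a * chi x); first exact: C01_lin.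
  have p1 := C01_Ck1 Cphi; have c1 := C01_Ck1 Cchi.
  have -> : hgrad (fun x => phi x + a * chi x) = fun x => hgrad phi x + a *: hgrad chi x.
    by apply/funext => x; exact: hgrad_lin.
  have -> : e = 2 `^ q * (d + `|a| `^ q * d).
    by rewrite /d; field; rewrite !gt_eqF.
  by apply: (Lq_near_lin mO q1) => //;
    [exact: continuous_measurable_Ck1|exact: continuous_measurable_hgrad
    |exact: continuous_measurable_Ck1|exact: continuous_measurable_hgrad].
Qed.

Lemma W01_closed u g : measurable_fun Omega u -> measurable_fun Omega g ->
  (forall e : R, 0 < e -> exists w k, [/\ W01 q Omega w k,
    intg (fun x => `|w x - u x| `^ q), intg (normq q (fun x => k x - g x)) &
    I (fun x => `|w x - u x| `^ q) <= e /\ I (normq q (fun x => k x - g x)) <= e]) ->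
  W01 q Omega u g.
Proof.
move=> mu_ mg H; apply/W01P; split => // e e0.
pose d := e / (2 `^ q * 2); have d0 : 0 < d by rewrite divr_gt0// mulr_gt0.
have [w [k [Ww i1 i2 h]]] := H d d0.
have /W01P[mw mk /(_ d d0)[phi Cphi hw]] := Ww; have p1 := C01_Ck1 Cphi.
exists phi => //; have -> : e = 2 `^ q * (d + d) by rewrite /d; field; rewrite gt_eqF.
apply: (Lq_near_trans mO q1 mu_ mg _ _ _ hw); [exact: continuous_measurable_Ck1
  |exact: continuous_measurable_hgrad|by split].
Qed.

(** v is not in W in general. But v >= 0, so [huber eps] of phi - v vanishes wherever phi does and
    is again in C_0^1. It is close to the Huber function of u - v once phi is close to u, and the
    latter is close to the truncation once eps is small; eps is chosen first. *)
Lemma W01_trunc v u g : Ck 1 v -> (forall x, 0 <= v x) -> intg (normq q (hgrad v)) ->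
  W01 q Omega u g ->
  W01 q Omega (fun x => Num.max (u x - v x) 0) (fun x => if v x < u x then g x - hgrad v x else 0).
Proof.
move=> v1 v0 iv Wu; have ig := W01_intg_grad Wu.
have /W01P[mu_ mg Hu] := Wu.
have mv := continuous_measurable_Ck1 v1; have mgam := continuous_measurable_hgrad v1.
have igv : intg (normq q (fun x => g x - hgrad v x)).
  have -> : (fun x => g x - hgrad v x) = fun x => g x + (-1) *: hgrad v x.
    by apply/funext => x; rewrite scaleN1r.
  apply: intg_normqD => //; first exact: measurable_rVZ.
  have -> : normq q (fun x => -1 *: hgrad v x) = normq q (hgrad v) => //.
  by apply/funext => x; rewrite !normqE scaleN1r euclid_normN.
have mt : measurable_fun Omega (fun x => Num.max (u x - v x) 0).
  by apply: measurable_maxr => //; apply: measurable_funB.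
have mtg : measurable_fun Omega (fun x => if v x < u x then g x - hgrad v x else 0).
  apply: measurable_fun_ite => //; first exact: measurable_fun_ltr.
  exact: measurable_rVB.
apply/W01P; split => // e e0.
pose d := e / (2 `^ q * 2); have d0 : 0 < d by rewrite divr_gt0// mulr_gt0.
have -> : e = 2 `^ q * (d + d) by rewrite /d; field; rewrite gt_eqF.
have [eps eps0 near1] := Lq_near_huber0 mO q1 bounded_lebesgue_lty mu_ mg mv mgam igv d0.
have [dlt dlt0 near2] := Lq_near_huber mO q1 eps0 mu_ mg mv mgam igv d0.
have [phi Cphi hu] := Hu dlt dlt0; have p1 := C01_Ck1 Cphi.
have f1 : Ck 1 (fun x => phi x + (-1) * v x) by exact: Ck1_lin.
have fE : (fun x => phi x + (-1) * v x) = fun x => phi x - v x.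
  by apply/funext => x; rewrite mulN1r.
have h1 : Ck 1 (fun x => huber eps (phi x - v x)).
  by rewrite fE in f1; exact: (@Ck1_comp _ _ _ (dhuber eps) (fun x => phi x - v x)
    (fun s => is_derive_huber s eps0) (@continuous_dhuber R eps) f1).
have hE : hgrad (fun x => huber eps (phi x - v x)) =
    fun x => dhuber eps (phi x - v x) *: (hgrad phi x - hgrad v x).
  apply/funext => x; have := f1; rewrite fE => f1'.
  by rewrite (hgrad_comp x (fun s => is_derive_huber s eps0) f1') -fE hgrad_lin// scaleN1r.
exists (fun x => huber eps (phi x - v x)).
  by apply: C01_sub h1 Cphi _ => x ->; rewrite huber_le0// sub0r oppr_le0.
rewrite hE; apply: (Lq_near_trans mO q1 mt mtg _ _ near1).
- exact: continuous_measurable_Ck1.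
- by rewrite -hE; exact: continuous_measurable_hgrad.
- by apply: near2 hu; [exact: continuous_measurable_Ck1|exact: continuous_measurable_hgrad].
Qed.

Lemma W01_pos u g : W01 q Omega u g ->
  W01 q Omega (fun x => Num.max (u x) 0) (fun x => if 0 < u x then g x else 0).
Proof.
have g0 : hgrad (fun _ : V => 0) = fun=> 0.
  by apply/funext => x; apply/rowP => j; rewrite !mxE derive_cst.
move=> /(@W01_trunc (fun=> 0) u g (Ck1_cst _ 0) (fun=> lexx 0)); rewrite g0.
have -> : (fun x => Num.max (u x - 0) 0) = fun x => Num.max (u x) 0.
  by apply/funext => x; rewrite subr0.
have -> : (fun x => if 0 < u x then g x - 0 else 0) = fun x => if 0 < u x then g x else 0.
  by apply/funext => x; rewrite subr0.
apply; have -> : normq q (fun _ : V => (0 : 'rV[R]_N1)) = fun=> 0.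
  by apply/funext => x; rewrite normqE euclid_norm0 powR0// gt_eqF.
exact: (intg_cst mO _ bounded_lebesgue_lty).
Qed.

End W01_space.

(** * The supersolution *)

Lemma continuous_bounded_segment {R : realType} (f : R -> R) M : 0 <= M -> continuous f ->
  exists C, forall s, `|s| <= M -> `|f s| <= C.
Proof.
move=> M0 cf; have MM : - M <= M by lra.
have cf' : {within `[(- M), M], continuous (fun x => `|f x|)}.
  by apply: continuous_subspaceT => x; exact: (cvg_norm (cf x)).
have [z _ zmax] := EVT_max MM cf'; exists `|f z| => s sM.
by apply: zmax; rewrite in_itv/= -ler_norml.
Qed.

Section first_layer.
Context {R : realType} (G : stratified_group R).
Local Notation N1 := (layer (ord0 : 'I_(last_layer G).+1)).

(** Without horizontal fields the Lie algebra they generate is 0. It contains every left-invariant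
    field, hence one for each vector of R^n, so n = 0 and then Q = 0. *)
Lemma first_layer_gt0 : (0 < hom_dim G)%N -> (0 < N1)%N.
Proof.
move=> Q0; rewrite lt0n; apply/eqP => N10.
have span0 X : lie_span (range (@hfield R G)) X -> X = fun=> 0.
  elim=> {X} [X [j _ _]||a X Y _ -> _ ->|X Y _ -> _ ->].
  - by case: j => j; rewrite N10.
  - by [].
  - by apply/funext => x; rewrite scaler0 addr0.
  - by apply/funext => x; rewrite /lie_bracket derive_cst subrr.
have v0 (v : 'rV[R]_(gdim G)) : v = 0.
  have li : left_invariant (@gmul R G) (left_field (@gmul R G) v).
    by apply/left_invariantP; rewrite left_field0.
  by have := congr1 (fun X => X 0) (span0 _ (hfield_generating li)); rewrite left_field0.
have n0 : gdim G = 0%N.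
  case: (posnP (gdim G)) => // n0.
  have := congr1 (fun v : 'rV_(gdim G) => v ord0 (Ordinal n0)) (v0 (const_mx 1)).
  by rewrite !mxE => /eqP; rewrite oner_eq0.
move: Q0; rewrite /hom_dim big1// => k _; apply/eqP; rewrite muln_eq0 /=.
have /eqP := n0; rewrite /gdim sum_nat_eq0 => /forallP/(_ k); exact.
Qed.

End first_layer.

(** * Integration by parts against functions of a first-layer coordinate *)

Section parts.
Context {R : realType} (G : stratified_group R).
Local Notation V := 'rV[R]_(gdim G).
Local Notation N1 := (layer (ord0 : 'I_(last_layer G).+1)).
Local Notation mu := (lebesgue_rV (gdim G)).
Variables (q : R) (Omega : set V).
Hypothesis q1 : 1 < q.
Hypothesis oO : open Omega.
Hypothesis bO : bounded_set Omega.
Local Notation intg f := (mu.-integrable Omega (EFin \o f)).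
Local Notation "'I' f" := (rint mu Omega f) (at level 10, f at level 9).
Implicit Types (u w psi phi v : V -> R) (g k h : V -> 'rV[R]_N1).

Let mO : measurable Omega. Proof. exact: open_measurable_rV. Qed.
Let finO : (mu Omega < +oo)%E. Proof. exact: bounded_lebesgue_lty. Qed.

Lemma coord_bounded_intg (f : R -> R) i : continuous f ->
  (exists C, forall x, Omega x -> `|f (x ord0 i)| <= C) /\ measurable_fun Omega (fun x => f (x ord0 i)).
Proof.
move=> cf; have [M M0 OM] := bounded_box bO; split.
  by have [C fC] := continuous_bounded_segment M0 cf; exists C => x Ox; exact/fC/OM.
apply: measurable_funTS; apply: continuous_measurable_rV => x.
exact: (cvg_comp _ _ (@coord_continuous R 1 _ ord0 i x) (cf (x ord0 i))).
Qed.

Lemma C01_outside phi x : C01 Omega phi -> ~ Omega x -> phi x = 0 /\ hgrad phi x = 0.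
Proof.
move=> [_ _ pO] nOx.
have : \forall y \near x, phi y = cst 0 y.
  have /open_nbhs_nbhs : open_nbhs x (~` closure [set x | phi x != 0]).
    by split; [exact/closed_openC/closed_closure|move=> /pO].
  apply: filterS => y ny; apply/eqP; apply: contrapT => /negP py.
  exact/ny/subset_closure.
move=> H; split; first exact: (nbhs_singleton H).
by apply/rowP => j; rewrite !mxE (near_eq_derive _ H) derive_cst.
Qed.

Lemma intg_boundedM (f u : V -> R) C : measurable_fun Omega f -> intg u ->
  (forall x, Omega x -> `|f x| <= C) -> intg (fun x => f x * u x).
Proof.
move=> mf iu fC; have ic := intgZ mO C (intg_norm mO iu).
apply: (intg_le mO _ ic) => [|x Ox].
  by apply: measurable_funM => //; exact: intg_measurable iu.
by rewrite normrM ler_wpM2r// fC.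
Qed.

Lemma W01_grad_coord_intg j psi h : W01 q Omega psi h -> intg (fun x => h x ord0 j).
Proof.
move=> Wh; have mh := (measurable_fun_rVP mO h).1 (W01_measurable_grad Wh) j.
apply: (intg_powR1 mO finO q1 mh); apply: (intg_le mO _ (W01_intg_grad q1 oO bO Wh)) => [|x Ox].
  exact: measurable_normr_powR.
rewrite ger0_norm ?powR_ge0// normqE; have q0 := ltW (lt_trans ltr01 q1).
by apply: ge0_ler_powR; rewrite ?nnegrE ?euclid_norm_ge0// ler_coord_euclid_norm.
Qed.

Lemma W01_fun_intg psi h : W01 q Omega psi h -> intg psi.
Proof.
move=> Wh; exact: (intg_powR1 mO finO q1 (W01_measurable Wh) (W01_intg q1 oO bO Wh)).
Qed.

Lemma W01_approx_L1 psi h (e : R) : W01 q Omega psi h -> 0 < e -> exists2 phi, C01 Omega phi &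
  I (fun x => `|phi x - psi x|) <= e /\ forall j, I (fun x => `|hgrad phi x ord0 j - h x ord0 j|) <= e.
Proof.
move=> Wh e0; have q0 := ltW (lt_trans ltr01 q1).
set m := fine (mu Omega); have m0 : 0 <= m by exact: fine_ge0.
(* The integral of |f| is at most s m + s^(1-q) times that of |f|^q: s makes the first term at most
   e / 2, and then t the second. *)
pose s := e / (2 * (m + 1)); have s0 : 0 < s by rewrite divr_gt0// mulr_gt0// ltr_wpDl.
pose t := e / 2 / s `^ (1 - q); have t0 : 0 < t by rewrite !divr_gt0// powR_gt0.
have sm : s * m <= e / 2.
  rewrite /s mulrAC ler_pdivrMr ?mulr_gt0 ?ltr_wpDl//; nra.
have st : s `^ (1 - q) * t = e / 2 by rewrite /t mulrC divfK// gt_eqF// powR_gt0.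
have key (f F : V -> R) : measurable_fun Omega f -> intg F ->
    (forall x, Omega x -> `|f x| `^ q <= F x) -> I F <= t -> I (fun x => `|f x|) <= e.
  move=> mf iF fF IF.
  have ib : intg (fun x => s + s `^ (1 - q) * F x).
    by apply: intgD => //; [exact: intg_cst|exact: intgZ].
  have pw x : Omega x -> `|f x| <= s + s `^ (1 - q) * F x.
    move=> Ox; have := powR_young_split q1 ler01 (normr_ge0 (f x)) s0.
    rewrite !powR1 mul1r mulr1 => h1; apply: le_trans h1 _.
    by rewrite lerD2l ler_wpM2l ?powR_ge0// fF.
  have ia : intg (fun x => `|f x|).
    by apply: (intg_le mO _ ib) => [|x Ox]; [exact: measurable_fun_normr|rewrite normr_id pw].
  apply: le_trans (rint_le mO ia ib pw) _.
  rewrite (rintD mO (intg_cst mO s finO) (intgZ mO _ iF)) (rint_cst mu mO) (rintZ mO _ iF).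
  have : s `^ (1 - q) * I F <= s `^ (1 - q) * t by rewrite ler_wpM2l ?powR_ge0.
  by rewrite st -/m; move: sm; lra.
have /(W01P q oO)[mpsi mh /(_ t t0)[phi Cphi [i1 i2 [h1 h2]]]] := Wh.
have p1 := C01_Ck1 Cphi; exists phi => //.
have mdh := continuous_measurable_hgrad oO p1.
split=> [|j].
  apply: key i1 _ h1 => //; apply: measurable_funB => //; exact: continuous_measurable_Ck1.
apply: (key _ _ _ i2 _ h2).
  apply: measurable_funB; first exact: (measurable_fun_rVP mO _).1.
  exact: (measurable_fun_rVP mO _).1.
move=> x _; rewrite normqE; apply: ge0_ler_powR; rewrite ?nnegrE ?euclid_norm_ge0//.
by apply: le_trans (ler_coord_euclid_norm _ j); rewrite !mxE.
Qed.

Lemma C01_parts j (A A' : R -> R) phi : (forall s : R, is_derive s 1 A (A' s)) ->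
  continuous A' -> C01 Omega phi ->
  I (fun x => A (x ord0 (first_coord j)) * hgrad phi x ord0 j +
              A' (x ord0 (first_coord j)) * phi x) = 0.
Proof.
move=> dA cA' Cphi; have [M M0 pM] := C01_box_support bO Cphi.
have := integral_hfield j M0 (C01_Ck1 Cphi) pM dA cA'.
rewrite rintE /Rintegral; set f := (fun x => _) => f0.
have -> : (\int[mu]_(x in Omega) (A (x ord0 (first_coord j)) * hgrad phi x ord0 j +
              A' (x ord0 (first_coord j)) * phi x)%:E = 0)%E; last by [].
rewrite -f0 [LHS]integral_mkcond; apply: eq_integral => x _; rewrite /patch.
case: ifPn => [_|]; first by rewrite /f mxE.
move=> /negP nO; have [//|p0 h0] := C01_outside (x := x) Cphi.
  by move=> Ox; apply: nO; rewrite inE.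
by move/rowP : h0 => /(_ j); rewrite /f !mxE => ->; rewrite p0 !mulr0 addr0.
Qed.

(** Density: A and A' are bounded on Omega, so both sides depend continuously on psi and h in L^1,
    and [C01_parts] covers C_0^1. *)
Lemma W01_parts j (A A' : R -> R) psi h : (forall s : R, is_derive s 1 A (A' s)) ->
  continuous A' -> W01 q Omega psi h ->
  I (fun x => A (x ord0 (first_coord j)) * h x ord0 j) =
  - I (fun x => A' (x ord0 (first_coord j)) * psi x).
Proof.
move=> dA cA' Wh; set k0 := first_coord j.
have cA := is_derive_continuous dA.
have [[C1 AC] mA] := coord_bounded_intg k0 cA.
have [[C2 AC'] mA'] := coord_bounded_intg k0 cA'.
pose C := `|C1| + `|C2| + 1; have C0 : 0 < C by rewrite ltr_wpDl// addr_ge0.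
have AC1 x : Omega x -> `|A (x ord0 k0)| <= C.
  by move=> /AC /le_trans; apply; rewrite /C; have := ler_norm C1; have := normr_ge0 C2; lra.
have AC2 x : Omega x -> `|A' (x ord0 k0)| <= C.
  by move=> /AC' /le_trans; apply; rewrite /C; have := ler_norm C2; have := normr_ge0 C1; lra.
have ih := W01_grad_coord_intg j Wh; have ipsi := W01_fun_intg Wh.
have iAh := intg_boundedM mA ih AC1; have iAp := intg_boundedM mA' ipsi AC2.
apply/eqP; rewrite -addr_eq0 -normr_le0; apply/ler_addgt0Pl => e e0.
rewrite addr0; pose t := e / (2 * C); have t0 : 0 < t by rewrite divr_gt0// mulr_gt0.
have [phi Cphi [n1 /(_ j) n2]] := W01_approx_L1 Wh t0.
have Wphi := C01_W01 q1 oO bO Cphi.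
have ih' := W01_grad_coord_intg j Wphi; have ipsi' := W01_fun_intg Wphi.
have iAh' := intg_boundedM mA ih' AC1; have iAp' := intg_boundedM mA' ipsi' AC2.
have := C01_parts j dA cA' Cphi; rewrite (rintD mO iAh' iAp') => p0.
have i1 := intgB mO iAh iAh'; have i2 := intgB mO iAp iAp'.
have key (f u w : V -> R) : measurable_fun Omega f -> (forall x, Omega x -> `|f x| <= C) ->
    intg u -> intg w -> I (fun x => `|w x - u x|) <= t ->
    `|I (fun x => f x * u x) - I (fun x => f x * w x)| <= e / 2.
  move=> mf fC iu iw uw.
  have a1 := intg_boundedM mf iu fC; have a2 := intg_boundedM mf iw fC.
  have a3 := intgB mO a1 a2; have a4 := intg_norm mO (intgB mO iw iu).
  rewrite -(rintB mO a1 a2).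
  have -> : e / 2 = C * t by rewrite /t; field; rewrite gt_eqF.
  apply: le_trans (_ : C * I (fun x => `|w x - u x|) <= _); last by rewrite ler_pM2l.
  have a5 := intgZ mO C a4.
  have pw x : Omega x -> `|f x * u x - f x * w x| <= C * `|w x - u x|.
    by move=> Ox; rewrite -mulrBr normrM distrC ler_wpM2r// fC.
  rewrite -(rintZ mO _ a4) ler_norml; apply/andP; split.
    rewrite -mulN1r -(rintZ mO _ a5); apply: rint_le => // [|x Ox]; first exact: intgZ.
    by have := pw x Ox; rewrite ler_norml mulN1r => /andP[].
  by apply: rint_le => // x Ox; exact: le_trans (ler_norm _) (pw x Ox).
have k1 := key _ _ _ mA AC1 ih ih' n2; have k2 := key _ _ _ mA' AC2 ipsi ipsi' n1.
move: k1 k2 p0; set a := I _; set b := I _; set c := I _; set d := I _ => k1 k2 p0.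
rewrite (_ : a + c = (a - b) + (c - d)); last by rewrite addrACA -opprD p0 subr0.
by apply: le_trans (ler_normD _ _) _; lra.
Qed.

End parts.

(** * Primitive of a nondecreasing function *)

Section convex_primitive.
Context {R : realType}.
Variable f : R -> R.
Hypothesis f_ndecr : {homo f : s t / s <= t}.
Hypothesis f_ge0 : forall t, 0 <= f t.
Let mf D : measurable D -> measurable_fun D f.
Proof. by move=> mD; exact: nondecreasing_measurable. Qed.

Let J a b : R := \int[lebesgue_measure]_(x in `]a, b]) f x.

Let itv_lty a b : (lebesgue_measure (`]a, b] : set R) < +oo)%E.
Proof. by rewrite lebesgue_measure_itv/=; case: ifP => _; rewrite ?ltry// -EFinB ltry. Qed.

Let int_f a b : lebesgue_measure.-integrable `]a, b] (EFin \o f).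
Proof.
have mI : measurable (`]a, b] : set R) by exact: measurable_itv.
have ib : lebesgue_measure.-integrable `]a, b] (EFin \o (fun=> f b)).
  exact: (@intg_cst R _ _ lebesgue_measure _ mI (f b) (itv_lty a b)).
apply: (@intg_le R _ _ lebesgue_measure _ mI f (fun=> f b) (mf mI) ib) => x.
by rewrite /= in_itv/= => /andP[_ xb]; rewrite ger0_norm// f_ndecr.
Qed.

Let JB a b c : a <= b -> b <= c -> J a c - J a b = J b c.
Proof. by move=> ab bc; rewrite /J (Rintegral_itvB (int_f a c)) ?bnd_simp. Qed.

Let J_bound a b : a <= b -> f a * (b - a) <= J a b <= f b * (b - a).
Proof.
move=> ab; have mI : measurable (`]a, b] : set R) by exact: measurable_itv.
have mab : (lebesgue_measure (`]a, b] : set R) = (b - a)%:E)%E.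
  rewrite lebesgue_measure_itv/= lte_fin; case: ltP => // ba.
  by rewrite (_ : b = a) ?subrr//; apply/eqP; rewrite eq_le ab ba.
have cst r : f r * (b - a) = \int[lebesgue_measure]_(x in `]a, b]) f r.
  by rewrite Rintegral_cst//; congr (_ * _); exact: (esym (congr1 fine mab)).
have ic r : lebesgue_measure.-integrable `]a, b] (EFin \o (fun=> f r)).
  exact: (@intg_cst R _ _ lebesgue_measure _ mI (f r) (itv_lty a b)).
rewrite !cst /J; apply/andP; split; apply: le_Rintegral; rewrite ?ic//; try exact: int_f.
  by move=> x; rewrite /= in_itv/= => /andP[/ltW ax _]; exact: f_ndecr.
by move=> x; rewrite /= in_itv/= => /andP[_ xb]; exact: f_ndecr.
Qed.

(** Monotonicity bounds the integral of f over ]a, b] between f(a) (b - a) and f(b) (b - a); the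
    lower bound is the subgradient inequality to the right of s, the upper bound the one to the
    left. *)
Lemma convex_primitive : exists F : R -> R,
  [/\ F 0 = 0, measurable_fun setT F & forall s t, f s * (t - s) <= F t - F s].
Proof.
pose F t := if 0 <= t then J 0 t else - J t 0.
have Jaa a : J a a = 0 by have := JB (lexx a) (lexx a); rewrite subrr => <-.
have FJ s t : s <= t -> F t - F s = J s t.
  move=> st; rewrite /F; case: (leP 0 s) => s0; case: (leP 0 t) => t0.
  - exact: JB.
  - by exfalso; have := le_lt_trans (le_trans s0 st) t0; rewrite ltxx.
  - by rewrite -(JB (ltW s0) t0) opprK subrK.
  - by rewrite -(JB st (ltW t0)) opprB opprK subrK.
have Fsub s t : f s * (t - s) <= F t - F s.
  have [st|/ltW ts] := leP s t; first by rewrite FJ//; case/andP: (J_bound st).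
  have /andP[_] := J_bound ts; rewrite -FJ//; lra.
exists F; split => //; first by rewrite /F lexx.
apply: nondecreasing_measurable => // s t st.
by rewrite -subr_ge0; apply: le_trans (Fsub s t); rewrite mulr_ge0// subr_ge0.
Qed.

End convex_primitive.

(** * A countable family of bump functions *)

Section bumps.
Context {R : realType} (G : stratified_group R).
Local Notation n := (gdim G).
Local Notation V := 'rV[R]_(gdim G).
Variable Omega : set V.
Hypothesis oO : open Omega.

(** The square of a positive part, hence C^1; it is positive exactly on the open Euclidean ball of
    radius r > 0 about c. *)
Definition bump (c : V) (r : R) (x : V) : R :=
  sqpos (r ^+ 2 - \sum_i (x ord0 i - c ord0 i) ^+ 2).

Definition cbox (c : V) (r : R) : set V := [set x | forall i, `|x ord0 i - c ord0 i| <= r].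

Lemma Ck1_bump c r : Ck 1 (bump c r).
Proof.
have sq (s : R) : is_derive s 1 (fun t : R => t ^+ 2) (2 * s).
  by have := is_derive_quadratic; move=> /(_ R (fun t => t ^+ 2) s (2 * s) 1); apply => h;
    rewrite ler_norml; apply/andP; split; nra.
apply: (Ck1_comp is_derive_sqpos).
  by move=> s; apply: continuous_funM; [exact: cst_continuous|exact: continuous_maxr0].
have sumC : Ck 1 (fun x : V => \sum_i (x ord0 i - c ord0 i) ^+ 2).
  have : forall s : seq 'I_n, Ck 1 (fun x : V => \sum_(i <- s) (x ord0 i - c ord0 i) ^+ 2).
    elim=> [|i s ih].
      rewrite (_ : (fun x => _) = fun=> 0); first exact: Ck1_cst.
      by apply/funext => x; rewrite big_nil.
    rewrite (_ : (fun x => _) = fun x : V => \sum_(i <- s) (x ord0 i - c ord0 i) ^+ 2 +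
       1 * (x ord0 i + (-1) * c ord0 i) ^+ 2); last first.
      by apply/funext => x; rewrite big_cons mul1r mulN1r addrC.
    apply: (Ck1_lin 1 ih).
    apply: (Ck1_comp sq).
      exact: mulrl_continuous.
    apply: Ck1_lin; [exact: Ck1_coord|exact: Ck1_cst].
  exact.
rewrite (_ : (fun x => _) = fun x : V => r ^+ 2 + (-1) * \sum_i (x ord0 i - c ord0 i) ^+ 2).
  exact: (Ck1_lin (-1) (Ck1_cst _ _) sumC).
by apply/funext => x; rewrite mulN1r.
Qed.

Lemma bump_cbox c r x : 0 <= r -> bump c r x != 0 -> cbox c r x.
Proof.
move=> r0; apply: contraNP => nx.
have [i xi] : exists i, r < `|x ord0 i - c ord0 i|.
  apply: contrapT => H; apply: nx => i; rewrite leNgt; apply/negP => ri.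
  by apply: H; exists i.
rewrite /bump /sqpos max_r ?expr0n// subr_le0 (bigD1 i)//= -[leLHS]addr0.
apply: lerD; last by apply: sumr_ge0 => k _; exact: sqr_ge0.
by rewrite -(real_normK (num_real (x _ _ - _))) lerXn2r ?nnegrE// ltW.
Qed.

Lemma C01_bump c r : 0 <= r -> cbox c r `<=` Omega -> C01 Omega (bump c r).
Proof.
move=> r0 cO.
have cc : compact (cbox c r).
  have := @rV_compact _ _ (fun i : 'I_n => `[c ord0 i - r, c ord0 i + r]%classic)
    (fun=> @segment_compact _ _ _).
  congr compact; apply/seteqP; split => x xc i; have := xc i; rewrite /= in_itv/=.
    by rewrite ler_distl.
  by rewrite ler_distl.
have hc : hausdorff_space V by exact: norm_hausdorff.
have cl : closed (cbox c r) by exact: compact_closed.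
have sub : closure [set x | bump c r x != 0] `<=` cbox c r.
  apply: subset_trans (closure_subset (fun x => @bump_cbox c r x r0)) _.
  by rewrite -(closure_id _).1.
split; first exact: Ck1_bump.
  by apply: subclosed_compact cc sub; exact: closed_closure.
exact: subset_trans sub cO.
Qed.

Lemma bump_ge0 c r x : 0 <= bump c r x. Proof. exact: sqr_ge0. Qed.

(** Enumerate the rational centers and the radii 1/(m+1); an index whose closed cube does not fit
    into Omega is given the zero function. *)
Lemma bump_family : exists eta : nat -> V -> R, [/\ forall i, C01 Omega (eta i),
  forall i x, 0 <= eta i x & forall x, Omega x -> exists i, 0 < eta i x].
Proof.
pose rad (m : nat) : R := m.+1%:R^-1.
have rad0 m : 0 < rad m by rewrite invr_gt0.
pose ctr (z : 'rV[rat]_n) : V := map_mx ratr z.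
pose eta (i : nat) : V -> R := if unpickle i is Some (z, m) then
  if `[< cbox (ctr z) (rad m) `<=` Omega >] then bump (ctr z) (rad m) else fun=> 0 else fun=> 0.
exists eta; split=> [i|i x|x Ox].
- rewrite /eta; case: unpickle => [[z m]|]; last exact: C01_cst0.
  by case: asboolP => [zO|_]; [exact: C01_bump (ltW (rad0 m)) zO|exact: C01_cst0].
- rewrite /eta; case: unpickle => [[z m]|]; last by [].
  by case: asboolP => // _; exact: bump_ge0.
have /nbhs_ballP[e /= e0 eO] : nbhs x Omega by exact: open_nbhs_nbhs.
have [m me] : exists m, rad m < e / 2.
  have e2 : 0 < e / 2 by rewrite divr_gt0.
  exact: (filter_ex (near_infty_natSinv_lt (PosNum e2))).
pose r := rad m; have r0 : 0 < r := rad0 m.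
(* Accuracy d in each coordinate puts x within the Euclidean distance r of the center, because n d^2
   < (n+1)^2 d^2 = r^2. *)
pose d := r / n.+1%:R; have d0 : 0 < d by rewrite divr_gt0.
have /choice[z xz] : forall i : 'I_n, exists z : rat, `|x ord0 i - ratr z| < d.
  move=> i; have [z] : exists z : rat, (ratr z : R) \in `](x ord0 i - d), (x ord0 i + d)[.
    by apply: rat_in_itvoo; lra.
  by rewrite in_itv/= -ltr_distl distrC; exists z.
pose c : 'rV[rat]_n := \row_i z i.
have cE i : ctr c ord0 i = ratr (z i) by rewrite !mxE.
have dr : d <= r by rewrite ler_pdivrMr// ler_peMr ?(ltW r0)// ler1n.
have cO : cbox (ctr c) r `<=` Omega.
  move=> y yc; apply: eO; split => // i j; rewrite (ord1 i) /ball/=.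
  have := yc j; rewrite cE => yj; have := xz j => xj.
  rewrite -(subrK (ratr (z j)) (x ord0 j)) -addrA.
  apply: le_lt_trans (ler_normD _ _) _; rewrite (distrC (ratr _)).
  by move: me; rewrite -/r; lra.
exists (pickle (c, m)); rewrite /eta pickleK; case: asboolP => // _.
rewrite /bump /sqpos exprn_gt0// lt_max; apply/orP; left; rewrite subr_gt0 -/r.
apply: (@le_lt_trans _ _ (\sum_(i < n) d ^+ 2)).
  apply: ler_sum => i _; rewrite cE -(real_normK (num_real (x _ _ - _))).
  by rewrite lerXn2r ?nnegrE ?(ltW d0)// ltW.
rewrite sumr_const card_ord.
have n1 : n.+1%:R * d = r by rewrite /d mulrC divfK.
have -> : r ^+ 2 = n.+1%:R ^+ 2 * d ^+ 2 by rewrite -exprMn n1.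
have d2 : 0 < d ^+ 2 by rewrite exprn_gt0.
rewrite -[d ^+ 2 *+ n]mulr_natl ltr_pM2r//.
by have := ler0n R n; rewrite -natr1; nra.
Qed.

End bumps.

Lemma is_derive_expR_comp {R : realType} (K : R) (g : R -> R) (s d : R) :
  is_derive s 1 g d -> is_derive s 1 (fun t => K * expR (g t)) (K * (expR (g s) * d)).
Proof.
move=> dg; have h := @is_derive1_comp _ expR g s _ _ (is_derive_expR (g s)) dg.
exact: (@is_deriveZ _ _ _ _ K _ _ _ h).
Qed.

(** * A supersolution depending on one horizontal coordinate *)

Section supersolution.
Context {R : realType} (G : stratified_group R).
Local Notation V := 'rV[R]_(gdim G).
Local Notation N1 := (layer (ord0 : 'I_(last_layer G).+1)).
Local Notation mu := (lebesgue_rV (gdim G)).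
Variables (q : R) (Omega : set V) (j : 'I_N1).
Hypothesis q1 : 1 < q.
Hypothesis oO : open Omega.
Hypothesis bO : bounded_set Omega.
Local Notation intg f := (mu.-integrable Omega (EFin \o f)).
Local Notation "'I' f" := (rint mu Omega f) (at level 10, f at level 9).

Let mO : measurable Omega. Proof. exact: open_measurable_rV. Qed.
Let finO : (mu Omega < +oo)%E. Proof. exact: bounded_lebesgue_lty. Qed.

(* The profile [t |-> L exp(- exp(- t))] is bounded, positive and increasing, and
   [(profile')^(q-1)] is decreasing on t >= 1. *)
Lemma supersolution (c : R) : 0 < c -> exists (v : V -> R) (L : R),
  [/\ 0 < L, Ck 1 v, forall x, 0 < v x <= L, intg (normq q (hgrad v)) &
    forall psi h, W01 q Omega psi h -> (forall x, Omega x -> 0 <= psi x) ->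
      c * I psi <= I (fluxq q (hgrad v) h)].
Proof.
move=> c0; have q10 : 0 < q - 1 by rewrite subr_gt0.
(* The shift m makes s + m >= 1 for every coordinate value s on Omega, so that E(s) <= 1/2. *)
have [M M0 OM] := bounded_box bO; pose m := M + 1.
(* On Omega s + m + E(s) <= 2 M + 2, so K ensures A >= 2 c / (q - 1); then - A' = (q - 1) A (1 - E)
   >= c. *)
pose K := 2 * c / (q - 1) * expR ((q - 1) * (2 * M + 2)).
have K0 : 0 < K by rewrite mulr_gt0 ?expR_gt0// divr_gt0// mulr_gt0.
pose L := K `^ (q - 1)^-1; have L0 : 0 < L by rewrite powR_gt0.
have LK : L `^ (q - 1) = K by rewrite /L -powRrM mulVf ?gt_eqF// powRr1// ltW.
pose E (s : R) := expR (- (s + m)).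
have dl (s : R) : is_derive s 1 (fun t : R => - (t + m)) (- 1).
  by apply: is_derive_eq; rewrite addr0.
have dE (s : R) : is_derive s 1 E (- E s).
  by have := is_derive_expR_comp 1 (dl s); rewrite mul1r mulrN1; congr is_derive;
    apply/funext => t; rewrite mul1r.
have dnE (s : R) : is_derive s 1 (fun t => - E t) (E s).
  by have := @is_deriveN _ _ _ _ _ _ _ (dE s); rewrite opprK.
have cE := is_derive_continuous dE.
pose b (s : R) := L * expR (- E s).
pose b' (s : R) := L * (expR (- E s) * E s).
have db (s : R) : is_derive s 1 b (b' s) by exact: is_derive_expR_comp.
have cb : continuous (fun s => expR (- E s)).
  by move=> s; exact: (cvg_comp _ _ (cvgN (cE s)) (@continuous_expR R (- E s))).
have cb' : continuous b'.
  by apply: continuous_funM; [exact: cst_continuous|exact: continuous_funM].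
have b'0 s : 0 < b' s by rewrite !mulr_gt0 ?expR_gt0.
pose g (s : R) := (q - 1) * (- (s + m) - E s).
pose A (s : R) := K * expR (g s).
pose A' (s : R) := K * (expR (g s) * ((q - 1) * (- 1 + E s))).
have dg (s : R) : is_derive s 1 g ((q - 1) * (- 1 + E s)).
  have := @is_deriveZ _ _ _ _ (q - 1) _ _ _ (@is_deriveD _ _ _ _ _ _ _ _ _ (dl s) (dnE s)).
  exact.
have dA (s : R) : is_derive s 1 A (A' s) by exact: is_derive_expR_comp.
have cg : continuous (fun s => expR (g s)).
  move=> s; exact: (cvg_comp _ _ (is_derive_continuous dg (x:=s)) (@continuous_expR R (g s))).
have cA' : continuous A'.
  apply: continuous_funM; first exact: cst_continuous.
  apply: continuous_funM => //; apply: continuous_funM; first exact: cst_continuous.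
  by apply: continuous_funD => //; exact: cst_continuous.
(* A is the flux of the profile, so - L_q v = - A'(x_1) in the weak sense of [W01_parts]. *)
have b'q s : b' s `^ (q - 1) = A s.
  rewrite /b' -expRD powRM ?(ltW L0) ?expR_ge0// LK -expRM /A /g; congr (_ * expR _).
  by ring.
set k0 := first_coord j; pose v (x : V) := b (x ord0 k0).
have v1 : Ck 1 v by exact: (Ck1_comp db cb' (Ck1_coord k0)).
have hv x : hgrad v x = b' (x ord0 k0) *: delta_mx ord0 j.
  by rewrite (hgrad_comp x db (Ck1_coord k0)) hgrad_first_coord.
exists v, L; split => //.
- move=> x; rewrite /v /b mulr_gt0 ?expR_gt0//= ger_pMr// expR_le1.
  by rewrite oppr_le0 expR_ge0.
- have [[C bC] mb'] := coord_bounded_intg bO k0 cb'.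
  have q0 : 0 <= q by rewrite ltW// (lt_trans ltr01 q1).
  apply: (intg_le mO _ (intg_cst mO (C `^ q) finO)) => [|x Ox].
    by apply: measurable_normq => //; exact: continuous_measurable_hgrad.
  rewrite (ger0_norm (normq_ge0 _ _ _)) normqE hv euclid_normZ.
  have -> : euclid_norm (delta_mx ord0 j : 'rV[R]_N1) = 1.
    rewrite /euclid_norm /euclid_dot (bigD1 j)//= big1 => [|i ij].
      by rewrite addr0 delta_rVE eqxx mulr1 sqrtr1.
    by rewrite delta_rVE (negPf ij) mul0r.
  rewrite mulr1; apply: ge0_ler_powR; rewrite ?nnegrE//; last exact: bC.
  exact: le_trans (bC x Ox).
move=> psi h Wh psi0.
have -> : I (fluxq q (hgrad v) h) = I (fun x => A (x ord0 k0) * h x ord0 j).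
  apply: eq_rint => // x Ox; rewrite fluxqE /flux hv euclid_normZ euclid_dotZl.
  have dj (w : 'rV[R]_N1) : euclid_dot (delta_mx ord0 j) w = w ord0 j.
    rewrite /euclid_dot (bigD1 j)//= big1 => [|i ij].
      by rewrite addr0 delta_rVE eqxx mul1r.
    by rewrite delta_rVE (negPf ij) mul0r.
  rewrite dj /euclid_norm dj delta_rVE eqxx sqrtr1 mulr1 (gtr0_norm (b'0 _)) mulrA.
  congr (_ * _); rewrite -b'q (_ : q - 1 = (q - 2) + 1); last by ring.
  rewrite [RHS]powRD; first by rewrite powRr1// ltW.
  by rewrite (gt_eqF (b'0 _)) implybT.
rewrite (W01_parts q1 oO bO j dA cA' Wh).
have ipsi := W01_fun_intg q1 oO bO Wh.
have [[C AC] mA'] := coord_bounded_intg bO k0 cA'.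
have iAp := intg_boundedM oO mA' ipsi AC.
rewrite -mulN1r -(rintZ mO _ ipsi) -(rintZ mO _ iAp).
apply: rint_le => // [||x Ox]; [exact: intgZ|exact: intgZ|].
rewrite mulrA; apply: ler_wpM2r; first exact: psi0.
have := OM x Ox k0; set s := x ord0 k0; rewrite ler_norml => /andP[sM1 sM2].
have E1 : E s <= 2^-1.
  have e2 : 2 <= expR (s + m) by apply: le_trans (expR_ge1Dx _); rewrite /m; lra.
  by rewrite /E expRN lef_pV2 ?posrE ?expR_gt0.
have E0 : 0 < E s by exact: expR_gt0.
have gl : - ((q - 1) * (2 * M + 2)) <= g s.
  by rewrite /g -mulrN ler_pM2l// /m; lra.
have Ag : 2 * c / (q - 1) <= A s.
  apply: (@le_trans _ _ (K * expR (- ((q - 1) * (2 * M + 2))))).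
    by rewrite /K -[leRHS]mulrA -expRD subrr expR0 mulr1.
  by rewrite ler_pM2l// ler_expR.
have -> : -1 * A' s = A s * ((q - 1) * (1 - E s)) by rewrite /A' /A; ring.
apply: (@le_trans _ _ (2 * c / (q - 1) * ((q - 1) * 2^-1))).
  by rewrite le_eqVlt; apply/orP; left; apply/eqP; field; rewrite gt_eqF.
have A0 : 0 <= A s by rewrite mulr_ge0 ?expR_ge0// ltW.
apply: ler_pM => //; first by rewrite divr_ge0 ?mulr_ge0// ltW.
  by rewrite mulr_ge0// ltW.
by rewrite ler_pM2l//; lra.
Qed.

End supersolution.

Section reaction.
Context {R : realType}.
Variables (p r lambda alpha L : R).
Hypotheses (p0 : 0 < p) (r0 : 0 < r) (l0 : 0 < lambda) (a0 : 0 < alpha) (L0 : 0 < L).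
Hypotheses (lL : lambda * L `^ p <= 1) (aL : alpha * L `^ r <= ln 2).

Definition reaction (t : R) : R := lambda * t `^ p + expR (alpha * t `^ r).

Definition clip (t : R) : R := Num.min (Num.max t 0) L.

Let clip_bound t : 0 <= clip t <= L.
Proof. by rewrite le_min le_max lexx orbT (ltW L0) ge_min lexx orbT. Qed.

Lemma reaction_clip_ndecr : {homo (fun t => reaction (clip t)) : s t / s <= t}.
Proof.
move=> s t st; have cst : clip s <= clip t.
  rewrite /clip le_min !ge_min lexx orbT andbT; apply/orP; left.
  by rewrite ge_max !le_max st lexx orbT.
have /andP[s0 _] := clip_bound s; have /andP[t0 _] := clip_bound t.
apply: lerD; first by rewrite ler_pM2l//; apply: ge0_ler_powR => //; rewrite ?nnegrE// ltW.
by rewrite ler_expR ler_pM2l//; apply: ge0_ler_powR => //; rewrite ?nnegrE// ltW.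
Qed.

(** For arguments in [0, L] the power term lies in [0, 1] by [lL] and the exponential in [1, 2] by
    [aL]. *)
Lemma reaction_clip_bound t : 1 <= reaction (clip t) <= 3.
Proof.
have /andP[t0 tL] := clip_bound t; rewrite /reaction.
have h1 : 0 <= lambda * clip t `^ p by rewrite mulr_ge0 ?powR_ge0// ltW.
have h2 : lambda * clip t `^ p <= 1.
  apply: le_trans lL; rewrite ler_pM2l//.
  by apply: ge0_ler_powR; rewrite ?nnegrE ?(ltW L0) ?(ltW p0).
have h3 : 1 <= expR (alpha * clip t `^ r).
  by rewrite -expR0 ler_expR mulr_ge0 ?powR_ge0// ltW.
have h4 : expR (alpha * clip t `^ r) <= 2.
  rewrite -[leRHS]lnK ?posrE// ler_expR; apply: le_trans aL; rewrite ler_pM2l//.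
  by apply: ge0_ler_powR; rewrite ?nnegrE ?(ltW L0) ?(ltW r0).
by apply/andP; split; lra.
Qed.

Lemma clip_id t : 0 < t <= L -> clip t = t.
Proof. by move=> /andP[t0 tL]; rewrite /clip max_l ?(ltW t0)// min_l. Qed.

End reaction.

Theorem theorem1p1 (R : realType) (G : stratified_group R) (q p : R)
    (Omega : set 'rV[R]_(gdim G)) :
  (2 <= hom_dim G)%N ->
  1 < q ->
  smooth_bounded_domain Omega ->
  0 < p -> p < q - 1 ->
  exists lambda_star alpha_star : R,
    [/\ 0 < lambda_star, 0 < alpha_star &
      forall lambda alpha : R,
        0 < lambda -> lambda < lambda_star ->
        0 < alpha -> alpha < alpha_star ->
        exists u : 'rV[R]_(gdim G) -> R,
          positive_weak_solution q Omega p lambda alpha u].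
Proof.
move=> Q2 q1 [_ oO _ bO _] p0 _.
have mO : measurable Omega by exact: open_measurable_rV.
have finO := bounded_lebesgue_lty oO bO.
pose Q : R := (hom_dim G)%:R; pose r := Q / (Q - 1).
have Q21 : 2 <= Q by rewrite ler_nat.
have r0 : 0 < r by rewrite divr_gt0//; lra.
pose j := Ordinal (first_layer_gt0 (leq_trans (isT : (0 < 2)%N) Q2)).
have [v [L [L0 v1 vb igam supv]]] := supersolution j q1 oO bO (ltr0n R 3).
have v0 x : 0 < v x by case/andP: (vb x).
have vL x : v x <= L by case/andP: (vb x).
have Lp0 : 0 < L `^ p by exact: powR_gt0.
have Lr0 : 0 < L `^ r by exact: powR_gt0.
have ln20 : 0 < ln (2 : R) by rewrite ln_gt0// ltr1n.
exists (1 / L `^ p), (ln 2 / L `^ r); split; [exact: divr_gt0|exact: divr_gt0|].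
move=> lambda alpha l0 lL a0 aL.
have lL' : lambda * L `^ p <= 1 by rewrite -ler_pdivlMr// ltW.
have aL' : alpha * L `^ r <= ln 2 by rewrite -ler_pdivlMr// ltW.
pose f t := reaction p r lambda alpha (clip L t).
have f_ndecr : {homo f : s t / s <= t} by exact: reaction_clip_ndecr.
have f1 t : 1 <= f t by have /andP[] : 1 <= f t <= 3 by exact: reaction_clip_bound.
have f3 t : f t <= 3 by have /andP[] : 1 <= f t <= 3 by exact: reaction_clip_bound.
have f_ge0 t : 0 <= f t by exact: le_trans (f1 t).
have mf : measurable_fun setT f by exact: nondecreasing_measurable.
have [F [F0 mF Fsub]] := convex_primitive f_ndecr f_ge0.
have [eta [Ceta eta0 etaD]] := bump_family oO.
have [U [g [WU Ub sol]]] := variational_solution mO finO q1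
  (@W01_measurable R G q Omega) (@W01_measurable_grad R G q Omega)
  (@W01_intg R G q Omega q1 oO bO) (@W01_intg_grad R G q Omega q1 oO bO)
  (W01_0 q1 oO bO) (@W01_lin R G q Omega q1 oO) (@W01_closed R G q Omega q1 oO)
  (@W01_pos R G q Omega q1 oO bO)
  (continuous_measurable_Ck1 v1) (continuous_measurable_hgrad oO v1) igam (ltW L0)
  (fun x _ => v0 x) (fun x _ => vL x)
  (fun u g => @W01_trunc R G q Omega q1 oO bO v u g v1 (fun x => ltW (v0 x)) igam)
  supv mf mF F0 Fsub f1 f3
  (fun i => C01_W01 q1 oO bO (Ceta i)) (fun i x _ => eta0 i x) etaD.
have UL x : Omega x -> 0 < U x <= L.
  move=> /Ub /andP[U0 Uv]; rewrite U0/=; exact: le_trans Uv (vL x).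
exists U; split; first by move=> x /UL /andP[].
exists g => // psi h Wpsi; rewrite -/Q -/r.
have ipsi := W01_fun_intg q1 oO bO Wpsi.
have mU := W01_measurable WU.
have iF : (lebesgue_rV (gdim G)).-integrable Omega (EFin \o fluxq q g h).
  apply: (intg_flux mO q1 (W01_measurable_grad WU) (W01_measurable_grad Wpsi)).
    exact: W01_intg_grad WU.
  exact: W01_intg_grad Wpsi.
have FE : fluxq q g h = fun x => euclid_norm (g x) `^ (q - 2) * euclid_dot (g x) (h x).
  by apply/funext => x; rewrite fluxqE.
have iA : (lebesgue_rV (gdim G)).-integrable Omega (EFin \o (fun x => U x `^ p * psi x)).
  apply: (intg_boundedM (C := L `^ p) oO _ ipsi) => [|x /UL /andP[U0 U1]].
    exact: measurable_fun_powR.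
  rewrite ger0_norm ?powR_ge0//.
  by apply: ge0_ler_powR; rewrite ?nnegrE ?(ltW U0) ?(ltW L0) ?(ltW p0).
have iB : (lebesgue_rV (gdim G)).-integrable Omega (EFin \o (fun x => expR (alpha * U x `^ r) * psi x)).
  apply: (intg_boundedM (C := expR (alpha * L `^ r)) oO _ ipsi) => [|x /UL /andP[U0 U1]].
    apply: measurableT_comp => //; apply: measurable_funM => //.
    exact: measurable_fun_powR.
  rewrite ger0_norm ?expR_ge0// ler_expR ler_pM2l//.
  by apply: ge0_ler_powR; rewrite ?nnegrE ?(ltW U0) ?(ltW L0) ?(ltW r0).
split=> //; first by rewrite -FE.
rewrite -FE -!rintE (sol _ _ Wpsi) -(rintZ mO _ iA) -(rintD mO (intgZ mO _ iA) iB).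
(* Since 0 < U <= v <= L, freezing does not affect the reaction at U. *)
apply: eq_rint => // x /UL Ux; rewrite /f clip_id// /reaction; ring.
Qed.
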